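(* Let $k$ be an integer $\geq 2$, or let $k=1+AC$. Then the set of $C^k$-distorted elements of $\mathrm{Diff}_+^k(\mathbb{S}^1)$ is not closed in $\mathrm{Diff}_+^k(\mathbb{S}^1)$. Also, the set of $C^{1+AC}$-distorted elements is not open in $\mathrm{Diff}_+^{1+AC}(\mathbb{S}^1)$.
   Context: $\mathbb{S}^1$ is $[0,1]$ with endpoints identified (i.e. $\mathbb{R}/\mathbb{Z}$); derivatives are taken in the standard coordinate. For an integer $k\ge1$, $\mathrm{Diff}_+^k(\mathbb{S}^1)$ is the group (under composition) of orientation-preserving $C^k$ diffeomorphisms of $\mathbb{S}^1$, a Polish group with the uniform $C^k$ topology. $\mathrm{Diff}_+^{1+AC}(\mathbb{S}^1)$ is the subgroup of $\mathrm{Diff}_+^1(\mathbb{S}^1)$ of diffeomorphisms whose first derivative is absolutely continuous; it is a Polish group with topology given by the metric $\rho(f,g)=\sup_{x\in\mathbb{S}^1}|f(x)-g(x)|+\sup_{x\in\mathbb{S}^1}|f'(x)-g'(x)|+\int_{\mathbb{S}^1}|f''-g''|$ (where $|f(x)-g(x)|$ denotes distance in $\mathbb{S}^1$). A pseudometric $d$ on a topological group $G$ is maximal if it is continuous, right-invariant, and for every continuous right-invariant pseudometric $\sigma$ on $G$ there are constants $K,C$ with $\sigma\le K\cdot d+C$. Any two maximal pseudometrics on $G$ are quasi-isometrically equivalent, and all the groups above admit maximal pseudometrics; for $\mathrm{Diff}_+^{1+AC}(\mathbb{S}^1)$, $d(f,g)=\int_{\mathbb{S}^1}\left|\frac{f''}{f'}-\frac{g''}{g'}\right|$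 is one. For $G$ with a maximal pseudometric $d$, an element $f\in G$ is distorted in $G$ if the inclusion $\langle f\rangle\hookrightarrow G$ is not a quasi-isometric embedding (with respect to a right-invariant Cayley metric on $\langle f\rangle$ and $d$ on $G$), and undistorted otherwise; this is independent of the choice of $d$. For non-torsion $f$, the limit $\lim_{n\to\infty} d(f^n,e)/n$ exists, and $f$ is distorted if and only if it equals $0$. For $k$ a positive integer or $k=1+AC$, $f$ is called $C^k$-distorted if it is distorted in the Polish group $\mathrm{Diff}_+^k(\mathbb{S}^1)$ or is a torsion element (so in particular the identity is $C^k$-distorted); otherwise it is $C^k$-undistorted. *)

(* Defs.v *)
From HB Require Import structures.
From mathcomp Require Import all_boot all_order all_algebra.
From mathcomp Require Import generic_quotient archimedean.
From mathcomp Require Import all_classical all_reals all_analysis.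
From mathcomp Require Import lra ring zify.

Set Implicit Arguments.
Unset Strict Implicit.
Unset Printing Implicit Defensive.

Import Order.TTheory GRing.Theory Num.Theory.
Import numFieldNormedType.Exports.

Local Open Scope ring_scope.
Local Open Scope classical_set_scope.

(* The compatibility of the two structures (continuity of the operations) is
   not recorded: none of the notions below refers to it. *)
#[short(type="groupTopType")]
HB.structure Definition GroupTop := {G of monoid.Group G & Topological G}.

Section CoarseGeometry.
Context {R : realType} {G : groupTopType}.
Implicit Types (d : G -> G -> R) (f g h : G) (A S : set G).

Definition pseudometric d : Prop :=
  [/\ forall f, d f f = 0, forall f g, 0 <= d f g,
      forall f g, d f g = d g f & forall f g h, d f h <= d f g + d g h].

Definition right_invariant d : Prop :=
  forall f g h, d (f * h)%g (g * h)%g = d f g.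

Definition ri_cont_pseudometric d : Prop :=
  [/\ pseudometric d, continuous (fun p : G * G => d p.1 p.2)
    & right_invariant d].

Definition maximal_pseudometric d : Prop :=
  ri_cont_pseudometric d /\
  forall s : G -> G -> R, ri_cont_pseudometric s ->
    exists K C : R, forall f g, s f g <= K * d f g + C.

Definition powers f : set G := [set g | exists n, g = f ^+ n \/ g = f ^- n]%g.

(* The Cayley metric of the group generated by S, in its right-invariant
   version: the least n such that g = x_1 * ... * x_n * h with every x_i in
   S or S^-1. Meant for g and h in the subgroup generated by S. *)
Definition cayley_metric S g h : R :=
  inf [set (size s)%:R | s in [set s : seq G |
    (forall x, x \in s -> S x \/ S x^-1%g) /\ g = foldr (fun x y => x * y)%g h s]].

Definition qi_embedded A (dA d : G -> G -> R) : Prop :=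
  exists K C : R, [/\ 1 <= K, 0 <= C & forall g h, A g -> A h ->
    K^-1 * dA g h - C <= d g h <= K * dA g h + C].

(* Distortion does not depend on the maximal pseudometric that is chosen. *)
Definition distorted f : Prop :=
  exists2 d : G -> G -> R, maximal_pseudometric d &
    ~ qi_embedded (powers f) (cayley_metric [set f]) d.

Definition torsion f : Prop := exists2 n, (0 < n)%N & (f ^+ n = 1)%g.

End CoarseGeometry.

Arguments distorted R {G} f.

Section Circle.
Context {R : realType}.
Local Open Scope quotient_scope.

Definition circle_rel (x y : R) : bool := (x - y) \is a Num.int.

Lemma circle_rel_refl : reflexive circle_rel.
Proof. by move=> x; rewrite /circle_rel subrr. Qed.

Lemma circle_rel_sym : symmetric circle_rel.
Proof. by move=> x y; rewrite /circle_rel -opprB rpredN. Qed.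

Lemma circle_rel_trans : transitive circle_rel.
Proof.
move=> y x z xy yz; rewrite /circle_rel -(subrK y x) -addrA.
exact: rpredD.
Qed.

Canonical circle_equiv :=
  EquivRel circle_rel circle_rel_refl circle_rel_sym circle_rel_trans.

Definition circle := {eq_quot circle_equiv}.

Definition to_circle (x : R) : circle := \pi_circle x.

Lemma to_circleP x y : (to_circle x = to_circle y) <-> (x - y \is a Num.int).
Proof.
split; first by move=> /eqP; rewrite /to_circle eqquotE.
by move=> h; apply/eqP; rewrite /to_circle eqquotE.
Qed.

Lemma to_circle_surj (p : circle) : exists x, to_circle x = p.
Proof. by exists (repr p); rewrite /to_circle reprK. Qed.

Definition circle_dist (p q : circle) : R :=
  inf [set `|x - y| | x in [set x | to_circle x = p]
                    & y in [set y | to_circle y = q]].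

Definition is_lift (F : R -> R) (f : circle -> circle) : Prop :=
  continuous F /\ forall x, to_circle (F x) = f (to_circle x).

(* A chosen continuous lift of f, when there is one; two of them differ by an
   integer constant, so that the derivatives do not depend on the choice. *)
Definition circle_lift (f : circle -> circle) : R -> R :=
  xget (fun x : R => x) [set F | is_lift F f].

(* The i-th derivative (i > 0) in the standard coordinate, as a 1-periodic
   function on R; 0 where the derivative does not exist. *)
Definition cderive (f : circle -> circle) (i : nat) : R -> R := (circle_lift f)^`(i).

Definition Ck (k : nat) (F : R -> R) : Prop :=
  (forall i, (i < k)%N -> forall x, derivable (F^`(i)) x 1) /\
  continuous (F^`(k)).

Definition increasing_Ck_map (k : nat) (f : circle -> circle) : Prop :=
  exists F : R -> R, [/\ is_lift F f, {homo F : x y / x < y} & Ck k F].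

Definition abs_continuous (a b : R) (h : R -> R) : Prop :=
  forall e : R, 0 < e -> exists2 de : R, 0 < de &
    forall (n : nat) (u v : nat -> R),
      (forall i, (i < n)%N -> [/\ a <= u i, u i <= v i & v i <= b]) ->
      trivIset `I_n (fun i => `]u i, v i[) ->
      \sum_(i < n) (v i - u i) < de ->
      \sum_(i < n) `|h (v i) - h (u i)| < e.

(* For a 1-periodic h this is absolute continuity on the circle. *)
Definition locally_abs_continuous (h : R -> R) : Prop :=
  forall a b, abs_continuous a b h.

Definition sup_dist0 (f g : circle -> circle) : R :=
  sup (range (fun p => circle_dist (f p) (g p))).

Definition sup_dist (h1 h2 : R -> R) : R :=
  sup [set `|h1 x - h2 x| | x in `[0, 1]].

End Circle.

Arguments circle R : clear implicits.

Section Calculus.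
Context {R : realType}.
Implicit Types F G H h : R -> R.

Lemma derivable_cont F : (forall x, derivable F x 1) -> continuous F.
Proof. by move=> dF x; apply: differentiable_continuous; exact/derivable1_diffP. Qed.

Lemma Ck0 F : Ck 0 F <-> continuous F.
Proof. by split=> [[]|] //; split. Qed.

Lemma CkS k F : Ck k.+1 F <-> (forall x, derivable F x 1) /\ Ck k (F^`()).
Proof.
split=> [[dF cF]|[dF [dF' cF]]].
  split; first exact: (dF 0%N).
  split; last by rewrite -derive1Sn.
  by move=> i ik; rewrite -derive1Sn; exact: (dF i.+1).
split; last by rewrite derive1Sn.
by case=> [_ //|i ik]; rewrite derive1Sn; exact: dF'.
Qed.

Lemma Ck_cont k F : Ck k F -> continuous F.
Proof. by case: k => [/Ck0//|k /CkS[/derivable_cont]]. Qed.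

Lemma CkW k F : Ck k.+1 F -> Ck k F.
Proof.
elim: k F => [|k IH] F /CkS[dF cF]; first exact/Ck0/derivable_cont.
by apply/CkS; split; [exact: dF|exact: IH _ cF].
Qed.

Lemma CkD k F G : Ck k F -> Ck k G -> Ck k (F \+ G).
Proof.
elim: k F G => [|k IH] F G.
  by move=> /Ck0 cF /Ck0 cG; apply/Ck0 => x; apply: cvgD; [exact: cF|exact: cG].
move=> /CkS[dF cF] /CkS[dG cG]; apply/CkS; split.
  by move=> x; exact: derivableD.
rewrite (_ : (_ \+ _)^`() = F^`() \+ G^`()); first exact: IH.
by apply/funext => x; rewrite derive1E (deriveD (dF x) (dG x)) /= !derive1E.
Qed.

Lemma CkM k F G : Ck k F -> Ck k G -> Ck k (F \* G).
Proof.
elim: k F G => [|k IH] F G.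
  by move=> /Ck0 cF /Ck0 cG; apply/Ck0 => x; apply: cvgM; [exact: cF|exact: cG].
move=> cF1 cG1; have [/CkS[dF cF] /CkS[dG cG]] := (cF1, cG1).
apply/CkS; split.
  by move=> x; exact: (derivableM (dF x) (dG x)).
rewrite (_ : (F \* G : R -> R)^`() = (F \* G^`()) \+ (G \* F^`())).
  exact (CkD (IH _ _ (CkW cF1) cG) (IH _ _ (CkW cG1) cF)).
by apply/funext => x; rewrite derive1E (deriveM (dF x) (dG x)) /= !derive1E.
Qed.

Lemma derivable_comp1 F G x : derivable G x 1 -> derivable F (G x) 1 ->
  derivable (F \o G) x 1.
Proof.
move=> /derivable1_diffP dG /derivable1_diffP dF.
by apply/derivable1_diffP; exact: differentiable_comp.
Qed.

Lemma derive1_comp_fun F G :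
  (forall x, derivable F x 1) -> (forall x, derivable G x 1) ->
  (F \o G)^`() = (F^`() \o G) \* G^`().
Proof. by move=> dF dG; apply/funext => x; rewrite derive1_comp. Qed.

Lemma Ck_comp k F G : Ck k F -> Ck k G -> Ck k (F \o G).
Proof.
elim: k F G => [|k IH] F G.
  move=> /Ck0 cF /Ck0 cG; apply/Ck0 => x.
  by apply: continuous_comp; [exact: cG|exact: cF].
move=> /CkS[dF cF] cG1; have /CkS[dG cG] := cG1.
apply/CkS; split; first by move=> x; exact: derivable_comp1.
rewrite (derive1_comp_fun dF dG); exact (CkM (IH _ _ cF (CkW cG1)) cG).
Qed.

Lemma Ck_id k : Ck k (id : R -> R).
Proof.
have Ck_cst j (c : R) : Ck j (fun _ : R => c).
  elim: j c => [|j IH] c; first by apply/Ck0 => x; exact: cvg_cst.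
  apply/CkS; split; first by move=> x; exact: derivable_cst.
  by rewrite (_ : (fun _ : R => c)^`() = fun=> 0 : R)//; apply/funext => x; rewrite derive1_cst.
case: k => [|k]; first by apply/Ck0 => x; exact: cvg_id.
apply/CkS; split; first by move=> x; exact: derivable_id.
by rewrite (_ : (id : R -> R)^`() = fun=> 1 : R)//; apply/funext => x; rewrite derive1E derive_id.
Qed.

Lemma continuous_bounded h (a b : R) : continuous h ->
  exists2 M, 0 < M & forall x, a <= x <= b -> `|h x| <= M.
Proof.
move=> ch; case: (leP a b) => [ab|ba]; last first.
  by exists 1 => // x /andP[ax xb]; have := le_lt_trans (le_trans ax xb) ba; rewrite ltxx.
have /= cn : {within `[a, b], continuous (fun x => `|h x|)}.
  by apply: continuous_subspaceT => x; apply: cvg_norm; exact: ch.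
have [c cab hc] := EVT_max ab cn.
exists (`|h c| + 1); first by rewrite ltr_wpDl.
by move=> x xab; rewrite (le_trans (hc x _)) ?in_itv// lerDl.
Qed.

Lemma C1_lipschitz F (a b : R) : Ck 1 F ->
  exists2 L, 0 < L & forall x y, a <= x -> x <= y -> y <= b ->
    `|F y - F x| <= L * (y - x).
Proof.
move=> /CkS[dF /Ck0 cF]; have [L L0 hL] := continuous_bounded a b cF.
exists L => // x y ax; rewrite le_eqVlt => /orP[/eqP <- _|xy yb].
  by rewrite !subrr normr0 mulr0.
have [] := @MVT R F (F^`()) x y xy.
- by move=> z _; rewrite derive1E; exact/derivableP.
- by apply: continuous_subspaceT; exact: derivable_cont.
move=> c; rewrite in_itv/= => /andP[xc cy] ->.
rewrite normrM (gtr0_norm (x := y - x)) ?subr_gt0//.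
rewrite ler_wpM2r ?subr_ge0 ?(ltW xy)// hL// (le_trans ax (ltW xc))/=.
exact: le_trans (ltW cy) yb.
Qed.

Lemma C1_abs_continuous F : Ck 1 F -> locally_abs_continuous F.
Proof.
move=> cF a b e e0; have [L L0 hL] := C1_lipschitz a b cF.
exists (e / L); first exact: divr_gt0.
move=> n u v uv _ s; apply: (@le_lt_trans _ _ (L * \sum_(i < n) (v i - u i))).
  by rewrite mulr_sumr; apply: ler_sum => i _; have [] := uv i (ltn_ord i) => *; exact: hL.
by rewrite mulrC -ltr_pdivlMr.
Qed.

Lemma abs_continuousM F G : continuous F -> continuous G ->
  locally_abs_continuous F -> locally_abs_continuous G ->
  locally_abs_continuous (F \* G).
Proof.
move=> cF cG aF aG a b e e0.
have [M M0 hM] := continuous_bounded a b cF.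
have [N N0 hN] := continuous_bounded a b cG.
have [d1 d10 h1] := aF a b (e / (2 * N)) (divr_gt0 e0 (mulr_gt0 (ltr0Sn _ 1) N0)).
have [d2 d20 h2] := aG a b (e / (2 * M)) (divr_gt0 e0 (mulr_gt0 (ltr0Sn _ 1) M0)).
exists (Num.min d1 d2); first by rewrite lt_min d10.
move=> n u v uv tuv; rewrite lt_min => /andP[s1 s2].
have := h1 n u v uv tuv s1; have := h2 n u v uv tuv s2.
rewrite !ltr_pdivlMr ?mulr_gt0// => H2 H1.
apply: (@le_lt_trans _ _ (N * \sum_(i < n) `|F (v i) - F (u i)| +
                          M * \sum_(i < n) `|G (v i) - G (u i)|)); last by lra.
rewrite !mulr_sumr -big_split/=; apply: ler_sum => i _.
have [au uvi vb] := uv i (ltn_ord i).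
have -> : F (v i) * G (v i) - F (u i) * G (u i) =
  G (u i) * (F (v i) - F (u i)) + F (v i) * (G (v i) - G (u i)) by ring.
apply: (le_trans (ler_normD _ _)); rewrite !normrM.
apply: lerD; apply: ler_wpM2r => //.
  by apply: hN; rewrite au (le_trans uvi vb).
by apply: hM; rewrite vb (le_trans au uvi).
Qed.

Lemma abs_continuous_comp F G : {homo G : x y / x < y} ->
  locally_abs_continuous F -> locally_abs_continuous G ->
  locally_abs_continuous (F \o G).
Proof.
move=> iG aF aG a b e e0.
have mG : {mono G : x y / x <= y} by apply: le_mono.
have [d1 d10 h1] := aF (G a) (G b) e e0.
have [d2 d20 h2] := aG a b d1 d10.
exists d2 => // n u v uv tuv s.
apply: (h1 n (G \o u) (G \o v)).
- by move=> i ni; have [? ? ?] := uv i ni; rewrite /= !mG.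
- apply/trivIsetP => i j /= ni nj ij; apply/seteqP; split=> // y [] /=.
  rewrite !in_itv/= => /andP[uiy yvi] /andP[ujy yvj].
  have uvij : u i < v j by rewrite -(leW_mono mG); exact: lt_trans uiy yvj.
  have uvji : u j < v i by rewrite -(leW_mono mG); exact: lt_trans ujy yvi.
  have uvi : u i < v i by rewrite -(leW_mono mG); exact: lt_trans uiy yvi.
  have uvj : u j < v j by rewrite -(leW_mono mG); exact: lt_trans ujy yvj.
  move/trivIsetP : tuv => /(_ i j ni nj ij) /seteqP[+ _].
  have mm : Num.max (u i) (u j) < Num.min (v i) (v j).
    by rewrite lt_min !gt_max uvij uvji uvi uvj.
  move=> /(_ ((Num.max (u i) (u j) + Num.min (v i) (v j)) / 2)); apply.
  have := midf_lt mm => -[/[dup]]; rewrite {1}gt_max => /andP[? ?] _.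
  by rewrite lt_min => /andP[? ?]; split; rewrite /= in_itv/=; apply/andP; split.
- apply: le_lt_trans (h2 n u v uv tuv s).
  by apply: ler_sum => i _; exact: ler_norm.
Qed.

Lemma lift_unique (f : circle R -> circle R) F G : is_lift F f -> is_lift G f ->
  exists c, F = fun x => G x + c.
Proof.
move=> [cF lF] [cG lG]; pose D x := F x - G x.
have cD : continuous D by move=> x; apply: cvgB; [exact: cF|exact: cG].
have intD x : D x \is a Num.int by apply/to_circleP; rewrite lF lG.
have half (z : R) m : z \is a Num.int -> m \is a Num.int -> z != m + 2^-1.
  move=> /intrP[i ->] /intrP[j ->]; apply/negP => /eqP ijh.
  have : ((i - j) * 2)%:~R = 1%:~R :> R by rewrite intrM intrB ijh; field.
  by move=> /eqP; rewrite eqr_int => /eqP; lia.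
have ltD x y : x <= y -> D x = D y.
  move=> xy; apply/eqP; apply/negPn/negP => neq.
  have : exists2 c, c \in `[x, y]%R & D c = Num.min (D x) (D y) + 2^-1.
    apply: IVT => //; first exact: continuous_subspaceT.
    have [/intrP[i Di] /intrP[j Dj]] := (intD x, intD y).
    have nij : i != j by apply: contraNneq neq => ij; rewrite Di Dj ij.
    rewrite {}Di {}Dj; case: (ltgtP i j) nij => // ij _.
      have := ij; rewrite -(@ltr_int R) => /ltW/min_idPl ->.
      rewrite (_ : Num.max _ _ = j%:~R); last by apply/max_idPr; rewrite ler_int ltW.
      move: ij; rewrite -lezD1 -(@ler_int R) intrD => ij; lra.
    have := ij; rewrite -(@ltr_int R) => /ltW/min_idPr ->.
    rewrite (_ : Num.max _ _ = i%:~R); last by apply/max_idPl; rewrite ler_int ltW.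
    move: ij; rewrite -lezD1 -(@ler_int R) intrD => ij; lra.
  move=> [c _ Dc]; have := half (D c) (Num.min (D x) (D y)) (intD c).
by rewrite Dc eqxx => /(_ _)/negP; apply=> //; rewrite minEle; case: ifP.
exists (D 0); apply/funext => x.
have -> : D 0 = D x.
  by case: (leP 0 x) => [/ltD//|/ltW/ltD].
by rewrite /D addrC subrK.
Qed.

Lemma derive1_addc F (c : R) : (fun x => F x + c)^`() = F^`().
Proof.
apply/funext => x; rewrite /derive1.
suff -> : (fun h : R => h^-1 *: (F (h + x) + c - (F x + c))) =
  (fun h : R => h^-1 *: (F (h + x) - F x)) by [].
by apply/funext => h; congr (_ *: _); ring.
Qed.

Lemma lift_is_lift (f : circle R -> circle R) F : is_lift F f -> is_lift (circle_lift f) f.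
Proof. by move=> lF; rewrite /circle_lift; case: xgetP => [G _ //|/(_ F lF)]. Qed.

Lemma cderive1E (f : circle R -> circle R) F : is_lift F f -> cderive f 1 = F^`().
Proof.
move=> lF; have [c ->] := lift_unique lF (lift_is_lift lF).
by rewrite derive1_addc.
Qed.

Lemma is_lift_comp (f g : circle R -> circle R) F G :
  is_lift F f -> is_lift G g -> is_lift (F \o G) (f \o g).
Proof.
move=> [cF lF] [cG lG]; split; last by move=> x /=; rewrite lF lG.
by move=> x; apply: continuous_comp; [exact: cG|exact: cF].
Qed.

Lemma is_lift_id : is_lift (id : R -> R) (id : circle R -> circle R).
Proof. by split=> // x; exact: cvg_id. Qed.

Lemma increasing_Ck_map_comp k (f g : circle R -> circle R) :
  increasing_Ck_map k f -> increasing_Ck_map k g -> increasing_Ck_map k (f \o g).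
Proof.
move=> [F [lF iF kF]] [G [lG iG kG]]; exists (F \o G).
split; [exact: is_lift_comp|by move=> x y xy; apply/iF/iG|exact: Ck_comp].
Qed.

Lemma increasing_Ck_map_id k : increasing_Ck_map k (id : circle R -> circle R).
Proof. by exists id; split; [exact: is_lift_id| |exact: Ck_id]. Qed.

Lemma abs_continuous_cderive_comp (f g : circle R -> circle R) :
  increasing_Ck_map 1 f -> increasing_Ck_map 1 g ->
  locally_abs_continuous (cderive f 1) -> locally_abs_continuous (cderive g 1) ->
  locally_abs_continuous (cderive (f \o g) 1).
Proof.
move=> [F [lF iF kF]] [G [lG iG kG]].
rewrite (cderive1E lF) (cderive1E lG) (cderive1E (is_lift_comp lF lG)) => aF aG.
have /CkS[dF /Ck0 cF] := kF; have /CkS[dG /Ck0 cG] := kG.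
have cFG : continuous (F^`() \o G).
  by move=> x; apply: continuous_comp; [exact: derivable_cont|exact: cF].
rewrite (derive1_comp_fun dF dG); apply: (abs_continuousM cFG cG _ aG).
exact (abs_continuous_comp iG aF (C1_abs_continuous kG)).
Qed.

Lemma abs_continuous_cderive_id : locally_abs_continuous (cderive (id : circle R -> circle R) 1).
Proof.
rewrite (cderive1E is_lift_id) (_ : (id : R -> R)^`() = fun=> 1 : R); last first.
  by apply/funext => x; rewrite derive1E derive_id.
move=> a b e e0; exists 1 => // n u v _ _ _.
by under eq_bigr do rewrite subrr normr0; rewrite big1.
Qed.

Lemma abs_continuous_cderive_inv (f g : circle R -> circle R) :
  increasing_Ck_map 1 f -> increasing_Ck_map 1 g -> cancel g f ->
  locally_abs_continuous (cderive f 1) -> locally_abs_continuous (cderive g 1).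
Proof.
move=> [F [lF iF kF]] [G [lG iG kG]] gf.
rewrite (cderive1E lF) (cderive1E lG) => aF.
have /CkS[dF /Ck0 cF] := kF; have /CkS[dG /Ck0 cG] := kG.
have lFG : is_lift (F \o G) id.
  by have := is_lift_comp lF lG; congr is_lift; apply/funext => x /=; rewrite gf.
have [c Ec] := lift_unique lFG is_lift_id.
have FG x : derive1 F (G x) * derive1 G x = 1.
  rewrite -(derive1_comp (dG x) (dF (G x))) Ec derive1_addc.
  by rewrite derive1E derive_id.
have aFG : locally_abs_continuous (F^`() \o G).
  exact (abs_continuous_comp iG aF (C1_abs_continuous kG)).
move=> a b e e0; have [M M0 hM] := continuous_bounded a b cG.
have [de de0 h] := aFG a b (e / M ^+ 2) (divr_gt0 e0 (exprn_gt0 2 M0)).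
exists de => // n u v uv tuv s.
have := h n u v uv tuv s; rewrite ltr_pdivlMr ?exprn_gt0//; apply: le_lt_trans.
rewrite mulr_suml; apply: ler_sum => i _; have [au uvi vb] := uv i (ltn_ord i).
have -> : derive1 G (v i) - derive1 G (u i) =
    - ((derive1 F (G (v i)) - derive1 F (G (u i))) *
       (derive1 G (v i) * derive1 G (u i))).
  rewrite mulrBl mulrA FG [derive1 G (v i) * _]mulrC mulrA FG; ring.
rewrite normrN !normrM ler_wpM2l// expr2; apply: ler_pM => //; apply: hM.
  by rewrite (le_trans au uvi).
by rewrite au (le_trans uvi vb).
Qed.

End Calculus.

Section MetricTopology.
Context {R : realType} {T : Type} (rho : T -> T -> R).

Definition metric_open : set (set T) :=
  [set U | forall f, U f -> exists2 e, 0 < e & forall g, rho f g < e -> U g].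

Lemma metric_openT : metric_open setT.
Proof. by move=> f _; exists 1. Qed.

Lemma metric_openI : setI_closed metric_open.
Proof.
move=> U V oU oV f [/oU[e1 e10 h1] /oV[e2 e20 h2]].
exists (Num.min e1 e2); first by rewrite lt_min e10.
by move=> g; rewrite lt_min => /andP[/h1 ? /h2].
Qed.

Lemma metric_open_bigcup (I : Type) (U : I -> set T) :
  (forall i, metric_open (U i)) -> metric_open (\bigcup_i U i).
Proof.
move=> oU f [i _ /oU[e e0 h]]; exists e => // g /h Ug; by exists i.
Qed.

End MetricTopology.

(* An orientation-preserving C^k diffeomorphism: a bijection of the circle
   that is C^k with increasing lifts, and so is its inverse. *)
Record Cdiff (R : realType) (k : nat) := MkCdiff {
  dmap :> circle R -> circle R;
  dinv : circle R -> circle R;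
  dmapK : cancel dmap dinv;
  dinvK : cancel dinv dmap;
  dmap_Ck : increasing_Ck_map k dmap;
  dinv_Ck : increasing_Ck_map k dinv }.

HB.instance Definition _ R k := gen_eqMixin (Cdiff R k).
HB.instance Definition _ R k := gen_choiceMixin (Cdiff R k).

Section CdiffGroup.
Context (R : realType) (k : nat).
Local Notation D := (Cdiff R k).

Lemma Cdiff_inj : injective (@dmap R k).
Proof.
move=> [f f' fK f'K fC f'C] [g g' gK g'K gC g'C] /= E; subst g.
have E : f' = g' by apply/funext => x; rewrite -{1}(g'K x) fK.
by subst g'; congr MkCdiff; exact: Prop_irrelevance.
Qed.

Definition cdiff1 : D :=
  @MkCdiff R k id id (fun _ => erefl) (fun _ => erefl)
    (increasing_Ck_map_id k) (increasing_Ck_map_id k).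

Definition cdiffV (f : D) : D :=
  MkCdiff (dinvK f) (dmapK f) (dinv_Ck f) (dmap_Ck f).

Definition cdiffM (f g : D) : D :=
  @MkCdiff R k (f \o g) (dinv g \o dinv f)
    (can_comp (dmapK f) (dmapK g)) (can_comp (dinvK g) (dinvK f))
    (increasing_Ck_map_comp (dmap_Ck f) (dmap_Ck g))
    (increasing_Ck_map_comp (dinv_Ck g) (dinv_Ck f)).

Lemma cdiffMA : associative cdiffM.
Proof. by move=> f g h; exact: Cdiff_inj. Qed.

Lemma cdiff1M : left_id cdiff1 cdiffM.
Proof. by move=> f; exact: Cdiff_inj. Qed.

Lemma cdiffM1 : right_id cdiff1 cdiffM.
Proof. by move=> f; exact: Cdiff_inj. Qed.

Lemma cdiffVM : left_inverse cdiff1 cdiffV cdiffM.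
Proof. by move=> f; apply/Cdiff_inj/funext => x; exact: dmapK. Qed.

Lemma cdiffMV : right_inverse cdiff1 cdiffV cdiffM.
Proof. by move=> f; apply/Cdiff_inj/funext => x; exact: dinvK. Qed.

HB.instance Definition _ := monoid.isGroup.Build D
  cdiffMA cdiff1M cdiffM1 cdiffVM cdiffMV.

Definition Ck_dist (f g : D) : R :=
  sup_dist0 f g + \sum_(1 <= i < k.+1) sup_dist (cderive f i) (cderive g i).

HB.instance Definition _ := isOpenTopological.Build D
  (metric_openT Ck_dist) (@metric_openI _ _ Ck_dist)
  (@metric_open_bigcup _ _ Ck_dist).

End CdiffGroup.

Record ACdiff (R : realType) := MkACdiff {
  acmap :> Cdiff R 1;
  acmap_ac : locally_abs_continuous (cderive acmap 1) }.

HB.instance Definition _ R := gen_eqMixin (ACdiff R).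
HB.instance Definition _ R := gen_choiceMixin (ACdiff R).

Section ACdiffGroup.
Context (R : realType).
Local Notation D := (ACdiff R).

Lemma ACdiff_inj : injective (@acmap R).
Proof.
move=> [f fa] [g ga] /= E; subst g.
by congr MkACdiff; exact: Prop_irrelevance.
Qed.

Definition acdiff1 : D :=
  @MkACdiff R (1%g : Cdiff R 1) abs_continuous_cderive_id.

Definition acdiffV (f : D) : D :=
  @MkACdiff R (f : Cdiff R 1)^-1%g
    (abs_continuous_cderive_inv (dmap_Ck f) (dinv_Ck f) (dinvK f) (acmap_ac f)).

Definition acdiffM (f g : D) : D :=
  @MkACdiff R ((f : Cdiff R 1) * (g : Cdiff R 1))%g
    (abs_continuous_cderive_comp (dmap_Ck f) (dmap_Ck g) (acmap_ac f) (acmap_ac g)).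

Lemma acdiffMA : associative acdiffM.
Proof. by move=> f g h; apply: ACdiff_inj; exact: mulgA. Qed.

Lemma acdiff1M : left_id acdiff1 acdiffM.
Proof. by move=> f; apply: ACdiff_inj; exact: mul1g. Qed.

Lemma acdiffM1 : right_id acdiff1 acdiffM.
Proof. by move=> f; apply: ACdiff_inj; exact: mulg1. Qed.

Lemma acdiffVM : left_inverse acdiff1 acdiffV acdiffM.
Proof. by move=> f; apply: ACdiff_inj; exact: mulVg. Qed.

Lemma acdiffMV : right_inverse acdiff1 acdiffV acdiffM.
Proof. by move=> f; apply: ACdiff_inj; exact: mulgV. Qed.

HB.instance Definition _ := monoid.isGroup.Build D
  acdiffMA acdiff1M acdiffM1 acdiffVM acdiffMV.

(* f'' exists almost everywhere and is integrable, as f' is absolutely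
   continuous; so the real-valued integral is the true one. *)
Definition AC_dist (f g : D) : R :=
  sup_dist0 f g + sup_dist (cderive f 1) (cderive g 1) +
  \int[lebesgue_measure]_(x in `[0, 1]) `|cderive f 2 x - cderive g 2 x|.

HB.instance Definition _ := isOpenTopological.Build D
  (metric_openT AC_dist) (@metric_openI _ _ AC_dist)
  (@metric_open_bigcup _ _ AC_dist).

End ACdiffGroup.

Definition Ck_distorted (R : realType) (k : nat) : set (Cdiff R k) :=
  [set f | distorted R f \/ torsion f].

Definition AC_distorted (R : realType) : set (ACdiff R) :=
  [set f | distorted R f \/ torsion f].

Arguments Ck_distorted : clear implicits.
Arguments AC_distorted : clear implicits.

(* Main.v *)
(** Var(log f' - log g'), the total variation over the circle, is a continuous
right-invariant pseudometric on Diff^{1+AC}: by the fundamental theorem of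
calculus it is controlled by the L1 distance of the derivatives of f' and g'.
An element whose powers f^m have Var(log (f^m)') growing linearly in m is
therefore undistorted and non-torsion, in Diff^{1+AC} and in every Diff^k,
k >= 2.

Identify the circle with the rays of the plane, on which SL_2(R) acts. Let g be
the parabolic matrix [[1, -1], [0, 1]], h the half turn, and t a diffeomorphism
supported in the cone 0 < x < y, fixing the ray y = 2x with a large derivative.
The elliptic matrices g_s = [[1, -1], [s, 1 - s]], s = 2 - 2 cos (pi / n), satisfy
g_s^n = h and tend to g. Since t commutes with g_s^i t g_s^-i for 0 <= i < n, the
element g_s t^-1 h t h = g_s t^-1 (g_s^n t g_s^-n) is conjugate to g_s by
telescoping, hence torsion. These elements tend to f = g t^-1 h t h, which moves
the rays of (j, 1) and of (j + 1/2, 1) by the parabolic step x |-> x - 1, but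
picks up the derivative of t^-1 only along the second family: Var(log (f^m)') is
at least a constant times m. So the distorted elements are not closed.

They are not open in Diff^{1+AC} because the identity is the limit of the
hyperbolic diag(l, 1/l), l -> 1, for which log (f^m)' differs by 4 m ln l between
two fixed points. *)

(* Undistortedness needs only a lower bound for maximal pseudometrics, and maximality transfers one
   from any continuous right-invariant pseudometric; no maximal one has to be constructed. Measuring
   log f' by variation turns right invariance into a reparametrization of chains of intervals. The
   price is continuity: the topology is given by an integral of second derivatives that exist only
   almost everywhere, which calls for the theorem that an absolutely continuous function is the
   integral of its derivative. It is obtained here from Jordan decomposition, Radon-Nikodym and
   Lebesgue differentiation.

   Under g_s, the twist t^-1 met in the cone is undone by h t h in the opposite cone, n steps later;
   under g a ray of the upper half plane never gets there, so the twist remains. It outweighs the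
   rest because the logarithmic derivative of g is a coboundary, that of ln (1 + x^2) along x, x -
   1, x - 2, ...: between orbits of neighbouring rays it contributes at most 2 ln 3, whatever the
   number of iterations. A power of t makes its logarithmic derivative on the ray y = 2x exceed
   this. *)
From HB Require Import structures.
Require Import Defs.
From mathcomp Require Import all_boot all_order all_algebra.
From mathcomp Require Import finmap.
From mathcomp Require Import all_classical all_reals all_analysis.
From mathcomp Require Import measurable_realfun.
From mathcomp Require Import lra ring zify.

Set Implicit Arguments.
Unset Strict Implicit.
Unset Printing Implicit Defensive.

Import Order.TTheory GRing.Theory Num.Theory.
Import numFieldNormedType.Exports.

Local Open Scope ring_scope.
Local Open Scope classical_set_scope.

(** * Absolutely continuous functions are integrals of their derivatives *)

Section AbsoluteContinuity.
Context {R : realType}.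
Implicit Types (h : R -> R) (s : seq (R * R)).

Definition nonoverlap (p q : R * R) : bool := (p.2 <= q.1) || (q.2 <= p.1).

(** Absolute continuity on the whole line, tested on unsorted lists: these can be concatenated and
    refined freely, and no ambient interval has to be carried along. *)
Definition list_abs_continuous h : Prop :=
  forall e : R, 0 < e -> exists2 d : R, 0 < d & forall s,
    all (fun p => p.1 <= p.2) s -> pairwise nonoverlap s ->
    \sum_(p <- s) (p.2 - p.1) < d -> \sum_(p <- s) `|h p.2 - h p.1| < e.

(** The retraction of the line onto [a, b]. Composing with it extends a function by constants; it
    neither lengthens intervals nor makes them overlap. *)
Definition clamp (a b x : R) := Num.max a (Num.min b x).

Lemma clamp_nd a b : {homo clamp a b : x y / x <= y}.
Proof.
move=> x y xy; rewrite /clamp /Num.max /Num.min.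
by do !case: ifP; lra.
Qed.

Lemma clamp_in a b x : a <= b -> a <= clamp a b x <= b.
Proof. by rewrite /clamp /Num.max /Num.min => ab; do !case: ifP; lra. Qed.

Lemma clamp_id a b x : a <= x <= b -> clamp a b x = x.
Proof. by rewrite /clamp /Num.max /Num.min => ab; do !case: ifP; lra. Qed.

Lemma clamp_lip a b x y : x <= y -> clamp a b y - clamp a b x <= y - x.
Proof. by rewrite /clamp /Num.max /Num.min => ab; do !case: ifP; lra. Qed.

Lemma clamp_abs_continuous (a b : R) h : a <= b -> abs_continuous a b h ->
  list_abs_continuous (h \o clamp a b).
Proof.
move=> ab ach e /ach[d d0 hd]; exists d => // s sle spw slt.
pose u i := clamp a b (nth (0, 0) s i).1.
pose v i := clamp a b (nth (0, 0) s i).2.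
have uv i : (i < size s)%N -> (nth (0, 0) s i).1 <= (nth (0, 0) s i).2.
  by move=> si; move/all_nthP : sle => /(_ (0, 0)); exact.
rewrite (big_nth (0, 0)) big_mkord; apply: (hd _ u v).
- move=> i si; have /andP[? _] := clamp_in (nth (0, 0) s i).1 ab.
  have /andP[_ ?] := clamp_in (nth (0, 0) s i).2 ab.
  by split => //; apply: clamp_nd; exact: uv.
- have no i j : (i < j)%N -> (j < size s)%N -> `]u i, v i[ `&` `]u j, v j[ = set0.
    move=> ij js; move/(pairwiseP (0, 0)) : spw => /(_ i j).
    rewrite !inE => /(_ (ltn_trans ij js) js ij) nij.
    apply/seteqP; split => // x [] /=; rewrite !in_itv/= => /andP[uix xvi] /andP[ujx xvj].
    case/orP : nij => /(clamp_nd a b) nij.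
      by have := lt_trans (lt_le_trans xvi nij) ujx; rewrite ltxx.
    by have := lt_trans (lt_le_trans xvj nij) uix; rewrite ltxx.
  apply/trivIsetP => i j /= is1 js ij; case: (ltngtP i j) ij => // [ij|ji] _.
    exact: no.
  by rewrite setIC; exact: no.
- apply: le_lt_trans slt; rewrite (big_nth (0, 0)) big_mkord; apply: ler_sum => i _.
  by apply: clamp_lip; exact: uv.
Qed.

Lemma list_abs_continuousB (g h : R -> R) : list_abs_continuous g -> list_abs_continuous h ->
  list_abs_continuous (fun x => g x - h x).
Proof.
move=> ag ah e e0.
have [d1 d10 h1] := ag (e / 2) (divr_gt0 e0 (ltr0Sn _ 1)).
have [d2 d20 h2] := ah (e / 2) (divr_gt0 e0 (ltr0Sn _ 1)).
exists (Num.min d1 d2); first by rewrite lt_min d10.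
move=> s sle spw; rewrite lt_min => /andP[/h1-/(_ sle spw) s1 /h2-/(_ sle spw) s2].
have := ltrD s1 s2; rewrite -splitr; apply: le_lt_trans.
rewrite -big_split/=; apply: ler_sum => p _.
have -> : g p.2 - h p.2 - (g p.1 - h p.1) = (g p.2 - g p.1) - (h p.2 - h p.1) by ring.
exact: ler_normB.
Qed.

Lemma itv_partition_pairs (c d : R) (t : seq R) h : itv_partition c d t ->
  exists s, [/\ all (fun p => [&& c <= p.1, p.1 <= p.2 & p.2 <= d]) s,
    pairwise nonoverlap s,
    \sum_(p <- s) (p.2 - p.1) = d - c &
    \sum_(p <- s) `|h p.2 - h p.1| = variation c d h t].
Proof.
elim: t c => [|x t IH] c.
  by move=> /itv_partition_nil ->; exists [::]; rewrite !big_nil subrr variation_nil.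
move=> upper_pt; have pt' := itv_partition_cons upper_pt; have [s [sin spw slen sE]] := IH _ pt'.
have cx : c < x by case: upper_pt => /= /andP[].
have xd : x <= d by exact: itv_partition_le pt'.
exists ((c, x) :: s); split => /=.
- rewrite lexx (ltW cx) xd/=; apply: sub_all sin => p /and3P[xp p12 pd].
  by rewrite (le_trans (ltW cx) xp) p12.
- rewrite spw andbT; apply: sub_all sin => p /and3P[xp _ _].
  by rewrite /nonoverlap xp.
- by rewrite big_cons slen/=; ring.
- rewrite big_cons sE /= -[x :: t]cat1s (@variation_cat _ x)//; last 2 first.
    exact: ltW.
    exact: itv_partition1.
  by congr (_ + _); rewrite /variation big_nat1.
Qed.

(** With e = 1, the variation over an interval shorter than d is at most 1. Pieces of length d / 2
    are cut off on the right until such an interval is left. *)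
Lemma list_abs_continuous_BV h (a b : R) : a <= b -> list_abs_continuous h ->
  bounded_variation a b h.
Proof.
move=> ab /(_ 1 ltr01)[d d0 hd].
have small c e : c <= e -> e - c < d -> bounded_variation c e h.
  move=> ce ced; exists 1 => _ [t /[dup] ct + <-].
  move=> /(itv_partition_pairs h)[s [sin spw slen <-]]; apply/ltW/hd => //.
    by apply: sub_all sin => p /and3P[].
  by rewrite slen.
have step n : forall e, a <= e -> e - a < n%:R * (d / 2) -> bounded_variation a e h.
  elim: n => [|n IH] e ae; first by rewrite mul0r subr_lt0 ltNge ae.
  move=> en; case: (ltP (e - d / 2) a) => eda.
    by apply: small => //; lra.
  have e1 : a <= e - d / 2 <= e by lra.
  have /andP[ae1 e1e] := e1.
  have bv1 : bounded_variation a (e - d / 2) h.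
    by apply: IH => //; move: en; rewrite -natr1 mulrDl mul1r; lra.
  have bv2 : bounded_variation (e - d / 2) e h by apply: small; lra.
  apply/(bounded_variationP _ ae); rewrite (total_variationD h ae1 e1e) fin_numD.
  by apply/andP; split; apply/bounded_variationP.
have [n hn] : exists n, b - a < n%:R * (d / 2).
  exists (Num.bound ((b - a) / (d / 2))).
  rewrite -ltr_pdivrMr ?divr_gt0//; apply: archi_boundP.
  by rewrite divr_ge0 ?subr_ge0 ?divr_ge0// ltW.
exact: step hn.
Qed.

(** [Num.max] freezes the function to the left of [a], so that it is nondecreasing on the whole
    line, as a Stieltjes function has to be. *)
Definition variation_from (a : R) h (x : R) : R := fine (total_variation a (Num.max a x) h).

Section variation_from.
Variables (a : R) (h : R -> R).
Hypothesis ah : list_abs_continuous h.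
Let V := variation_from a h.

Lemma variation_fromB x y : x <= y ->
  (total_variation (Num.max a x) (Num.max a y) h = (V y - V x)%:E)%E.
Proof.
move=> xy; have ax : a <= Num.max a x by rewrite le_max lexx.
have mxy : Num.max a x <= Num.max a y by rewrite ge_max !le_max lexx xy/= orbT.
have fx : total_variation a (Num.max a x) h \is a fin_num.
  by apply/bounded_variationP => //; exact: list_abs_continuous_BV.
have fxy : total_variation (Num.max a x) (Num.max a y) h \is a fin_num.
  by apply/bounded_variationP => //; exact: list_abs_continuous_BV.
rewrite /V /variation_from (total_variationD h ax mxy) fineD// [(_ + fine _)%R]addrC addrK.
by rewrite fineK.
Qed.

Lemma variation_from_nd : {homo V : x y / x <= y}.
Proof.
move=> x y xy; rewrite -subr_ge0 -lee_fin -variation_fromB// total_variation_ge0//.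
by rewrite ge_max !le_max lexx xy/= orbT.
Qed.

Lemma variation_from_ge x y : a <= x -> x <= y -> `|h y - h x| <= V y - V x.
Proof.
move=> ax xy; rewrite -lee_fin -variation_fromB//.
have ay := le_trans ax xy.
by rewrite (max_idPr ax) (max_idPr ay) total_variation_ge.
Qed.

Lemma variation_from_refine x y (e : R) : x <= y -> 0 < e ->
  exists s, [/\ all (fun p => [&& x <= p.1, p.1 <= p.2 & p.2 <= y]) s,
    pairwise nonoverlap s,
    \sum_(p <- s) (p.2 - p.1) <= y - x &
    V y - V x <= \sum_(p <- s) `|h p.2 - h p.1| + e].
Proof.
move=> xy e0; have := variation_fromB xy.
have mxy : Num.max a x <= Num.max a y by rewrite ge_max !le_max lexx xy/= orbT.
case: (ltP (Num.max a x) (Num.max a y)) => mlt; last first.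
  have -> : Num.max a x = Num.max a y by apply/eqP; rewrite eq_le mxy.
  rewrite total_variationxx => -[] E; exists [::]; split => //.
    by rewrite big_nil subr_ge0.
  by rewrite big_nil add0r -E ltW.
move=> tvE; have : (total_variation (Num.max a x) (Num.max a y) h > (V y - V x - e)%:E)%E.
  by rewrite tvE lte_fin gtrBl.
move=> /ereal_sup_gt[_ [_ [t upper_pt <-] <-]]; rewrite lte_fin => tl.
have ay : a < y.
  by move: mlt; rewrite gt_max => /andP[]; rewrite lt_max ltxx.
have [s [sin spw slen sE]] := itv_partition_pairs h upper_pt.
exists s; split => //.
- apply: sub_all sin => p /and3P[ap -> pa]/=; move: ap; rewrite ge_max => /andP[_ ->]/=.
  by rewrite (le_trans pa)// ge_max lexx (ltW ay).
- by rewrite slen (max_idPr (ltW ay)) lerB// le_max lexx orbT.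
- by rewrite sE; lra.
Qed.

(** That each interval of [t] lies in one of [s] is what keeps the concatenated lists nonoverlapping
    in the induction. *)
Lemma variation_from_refine_seq s (e : R) : 0 < e ->
  all (fun p => p.1 <= p.2) s -> pairwise nonoverlap s ->
  exists t, [/\ all (fun p => p.1 <= p.2) t,
    all (fun p => has (fun q => (q.1 <= p.1) && (p.2 <= q.2)) s) t,
    pairwise nonoverlap t,
    \sum_(p <- t) (p.2 - p.1) <= \sum_(p <- s) (p.2 - p.1) &
    \sum_(p <- s) (V p.2 - V p.1) <= \sum_(p <- t) `|h p.2 - h p.1| + (size s)%:R * e].
Proof.
move=> e0; elim: s => [|q s IH] /=.
  by move=> _ _; exists [::]; rewrite !big_nil mul0r addr0.
move=> /andP[q12 sle] /andP[qs spw].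
have [t [tle tin tpw tlen tE]] := IH sle spw.
have [r [rin rpw rlen rE]] := variation_from_refine q12 e0.
exists (r ++ t); split.
- by rewrite all_cat tle andbT; apply: sub_all rin => p /and3P[].
- rewrite all_cat; apply/andP; split.
    by apply: sub_all rin => p /and3P[-> _ ->].
  by apply: sub_all tin => p ->; rewrite orbT.
- rewrite pairwise_cat rpw tpw !andbT; apply/allrelP => p p' pr p't.
  move/allP : rin => /(_ _ pr) /and3P[qp _ pq].
  move/allP : tin => /(_ _ p't) /hasP[q' q's /andP[q'p' p'q']].
  move/allP : qs => /(_ _ q's); rewrite /nonoverlap => /orP[qq'|q'q].
    by rewrite (le_trans pq (le_trans qq' q'p')).
  by rewrite (le_trans p'q' (le_trans q'q qp)) orbT.
- by rewrite big_cat big_cons/= lerD.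
- rewrite big_cat big_cons/= -natr1 mulrDl mul1r.
  by apply: le_trans (lerD rE tE) _; lra.
Qed.

(** A variation is a supremum, so each interval contains pieces on which the increments of [h]
    nearly add up to the increment of [V]. The total length has not grown, and the absolute
    continuity of [h] applies to the pieces. *)
Lemma variation_from_abs_continuous : list_abs_continuous V.
Proof.
move=> e e0; have [d d0 hd] := ah (divr_gt0 e0 (ltr0Sn _ 1)).
exists d => // s sle spw slt.
have n0 : 0 < (size s).+1%:R :> R by rewrite ltr0n.
(* Half of [e] is shared among the intervals; the successor covers the empty list. *)
have e10 : 0 < e / 2 / (size s).+1%:R by rewrite divr_gt0// divr_gt0.
have [t [tle _ tpw tlen tE]] := variation_from_refine_seq e10 sle spw.
rewrite (eq_big_seq (fun p => V p.2 - V p.1)); last first.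
  move=> p ps; rewrite ger0_norm// subr_ge0 variation_from_nd//.
  by move/allP : sle; exact.
apply: le_lt_trans tE _.
have te := hd _ tle tpw (le_lt_trans tlen slt).
rewrite [ltRHS]splitr ltr_leD//.
rewrite mulrA ler_pdivrMr// mulrC ler_wpM2l ?ler_nat ?leqnSn//.
by rewrite divr_ge0// ltW.
Qed.

End variation_from.

Lemma list_abs_continuous_cont h : list_abs_continuous h -> continuous h.
Proof.
move=> ah x; apply/cvgrPdist_lt => e /ah[d d0 hd].
have le_case u v : u <= v -> v - u < d -> `|h v - h u| < e.
  by move=> uv uvd; have := hd [:: (u, v)]; rewrite /= !big_seq1 /= uv; apply.
near=> y; have : `|x - y| < d by near: y; exact: cvgr_dist_lt.
case: (leP y x) => [yx|/ltW xy]; first by rewrite ger0_norm ?subr_ge0//; exact: le_case.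
by rewrite distrC ger0_norm ?subr_ge0// [X in _ -> X < _]distrC; exact: le_case.
Unshelve. all: by end_near. Qed.

End AbsoluteContinuity.

(** * Absolutely continuous Stieltjes measures vanish on Lebesgue null sets *)

Section StieltjesDominated.
Context {R : realType}.
Local Open Scope measure_display_scope.

(** The list is independent of [f]: it will be measured both by an absolutely continuous function
    and by the identity, whose Stieltjes measure is Lebesgue measure. *)
Lemma ocitv_bigU_list (B : nat -> set R) n : (forall i, ocitv (B i)) ->
  exists s : seq (R * R), [/\ all (fun p => p.1 <= p.2) s, pairwise nonoverlap s &
    forall f : cumulative R R,
    (lebesgue_stieltjes_measure f (\big[setU/set0]_(i < n) B i) =
    (\sum_(p <- s) (f p.2 - f p.1))%:E)%E].
Proof.
move=> ocB; pose A := \big[setU/set0]_(i < n) B i.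
have mA : (R.-ocitv).-ring.-measurable (A : set (SetRing.type (ocitv_type R))).
  apply: bigsetU_measurable => i _. apply: sub_gen_smallest. exact: ocB.
have [D [finD D0 trivD mD AE]] := SetRing.ring_finite_set mA.
have bnd X : exists ab : R * R, D X -> ab.1 < ab.2 /\ X = `]ab.1, ab.2]%classic.
  have [DX|nDX] := pselect (D X); last by exists (0, 0).
  have /ocitvP[X0|[ab ab12 ->]] : ocitv X by apply: mD; rewrite inE.
    by have := D0 _ DX; rewrite X0 => -[].
  by exists ab.
have [g gP] := choice bnd.
pose L : seq (set R) := enum_fset (fset_set D); exists [seq g X | X <- L]; split.
- apply/allP => _ /mapP[X + ->]; rewrite in_fset_set// inE => DX.
  by have [/ltW] := gP _ DX.
- rewrite pairwise_map; apply/(pairwiseP set0) => i j.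
  rewrite !inE => iL jL ij.
  have Lin k : (k < size L)%N -> D (nth set0 L k).
    by move=> kL; rewrite -[D _]inE -(in_fset_set finD) mem_nth.
  have Lij : nth set0 L i <> nth set0 L j.
    by apply/eqP; rewrite nth_uniq ?fset_uniq// ltn_eqF.
  have [iab iE] := gP _ (Lin _ iL); have [jab jE] := gP _ (Lin _ jL).
  rewrite /relpre/=; move: iE jE iab jab.
  set p := g _; set q := g _ => iE jE iab jab.
  rewrite /nonoverlap; case: (leP p.2 q.1) => //= qp; case: (leP q.2 p.1) => //= pq.
  have : (nth set0 L i `&` nth set0 L j) !=set0.
    exists (Num.min p.2 q.2); rewrite iE jE; split; rewrite /= in_itv/=.
      by rewrite lt_min iab pq ge_min lexx.
    by rewrite lt_min qp jab ge_min lexx orbT.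
  by move=> /(trivD _ _ (Lin _ iL) (Lin _ jL)).
- move=> f; rewrite -/A AE big_map.
  have mD' X : D X -> measurable (X : set (measurableTypeR R)).
    by move=> DX; apply: sub_sigma_algebra; apply: mD; rewrite inE.
  rewrite measure_fin_bigcup//.
  rewrite fsbig_finite//= -sumEFin big_seq [RHS]big_seq; apply: eq_bigr => X.
  rewrite in_fset_set// inE => DX; have [/ltW ab XE] := gP _ DX.
  rewrite {1}XE /lebesgue_stieltjes_measure /measure_extension.
  by rewrite measurable_mu_extE/= ?wlength_itv_bnd//; exact: is_ocitv.
Qed.

(** A null set is covered by half-open intervals of total length below [d]. Every finite part of the
    cover is a nonoverlapping list of length below [d], hence of [g]-measure at most [e]; continuity
    from below passes to the whole cover. *)
Lemma stieltjes_null_dominates (g : cumulative R R) : list_abs_continuous g ->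
  lebesgue_stieltjes_measure g `<< @lebesgue_measure R.
Proof.
move=> ag N N0 A mA AN; have lA := N0 A mA AN.
apply/eqP; rewrite eq_le measure_ge0 andbT.
apply/lee_addgt0Pr => e e0; rewrite add0e.
have [d d0 hd] := ag _ e0.
have /ereal_inf_lt[_ [/= B [mB AB] <-] Bd] : (lebesgue_measure A < d%:E)%E.
  by rewrite lA lte_fin.
have mB' i : measurable (B i : set (measurableTypeR R)).
  by apply: sub_sigma_algebra; exact: mB.
pose F n := \big[setU/set0]_(i < n) B i.
have mF n : measurable (F n : set (measurableTypeR R)) by exact: bigsetU_measurable.
have ndF : nondecreasing_seq F.
  by move=> n m nm; apply/subsetPset; exact: subset_bigsetU.
have UF : \bigcup_n F n = \bigcup_n B n.
  rewrite -[RHS]bigcup_bigsetU_bigcup; apply/seteqP; split => x [n _ Fx].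
    by exists n => //; move/subsetPset : (ndF _ _ (leqnSn n)); exact.
  by exists n.+1.
have leF n : (lebesgue_stieltjes_measure g (F n) <= e%:E)%E.
  have [s [sle spw sE]] := ocitv_bigU_list n mB.
  rewrite sE lee_fin; apply: le_trans (_ : \sum_(p <- s) `|g p.2 - g p.1| <= _).
    by apply: ler_sum => p _; exact: ler_norm.
  apply/ltW/hd => //; rewrite -lte_fin; apply: le_lt_trans Bd.
  have := sE (@idfun R); rewrite -/lebesgue_measure => <-.
  apply: le_trans (_ : (\sum_(i < n) lebesgue_measure (B i) <= _)%E).
    by apply: (@Boole_inequality _ _ _ (@lebesgue_measure R)).
  apply: (le_trans _ (nneseries_lim_ge (P := xpredT) n _)); last first.
    by move=> i _ _; exact: wlength_ge0.
  rewrite big_mkord; apply: lee_sum => i _.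
  by rewrite /lebesgue_measure /lebesgue_stieltjes_measure /measure_extension measurable_mu_extE.
apply: (@le_trans _ _ (lebesgue_stieltjes_measure g (\bigcup_n F n))).
  apply: le_measure; rewrite ?inE//; first exact: bigcup_measurable.
  by rewrite UF.
have := @nondecreasing_cvg_mu _ _ _ (lebesgue_stieltjes_measure g) F mF
  (bigcup_measurable (fun n _ => mF n)) ndF.
move=> /cvg_lim <- //; apply: lime_le.
  apply: ereal_nondecreasing_is_cvgn => n m nm; apply: le_measure; rewrite ?inE//.
  by apply/subsetPset; exact: ndF.
by apply: nearW => n; exact: leF.
Qed.

End StieltjesDominated.

Section AbsoluteContinuityFTC.
Context {R : realType}.
Notation mu := (@lebesgue_measure R).

(** [r] is an integrable representative of the derivative of [h]. The derivative itself takes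
    default values where [h] is not derivable, and is compared with [r] only almost everywhere. *)
Definition density_on (a b : R) (h r : R -> R) : Prop :=
  [/\ mu.-integrable setT (EFin \o r),
      {ae mu, forall x, a < x < b -> derivable h x 1 /\ h^`() x = r x} &
      forall x, a <= x <= b -> h x - h a = (\int[mu]_(t in `]a, x]) r t)%R].

(** The Stieltjes measure of [g] has no mass on null sets, so Radon-Nikodym provides [r]; Lebesgue
    differentiation of the integral of [r] then recovers the derivative of [g]. *)
Lemma nondecreasing_density (a b : R) (g : R -> R) : a < b -> {homo g : x y / x <= y} ->
  list_abs_continuous g -> exists r, density_on a b g r.
Proof.
move=> ab ndg ag.
have rcg : right_continuous g by apply: right_continuousW; exact: list_abs_continuous_cont.
pose gc : cumulative R R := HB.pack g (isCumulative.Build R _ R g ndg rcg).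
pose lg := lebesgue_stieltjes_measure gc.
have lgE x y : x <= y -> lg (`]x, y]%classic : set (measurableTypeR R)) = (g y - g x)%:E.
  move=> xy; rewrite /lg /lebesgue_stieltjes_measure /measure_extension.
  by rewrite measurable_mu_extE/= ?wlength_itv_bnd//; exact: is_ocitv.
(* Restriction to ]a, b] makes the measure finite before Radon-Nikodym is applied. *)
have mab : measurable (`]a, b]%classic : set (measurableTypeR R)) by exact: measurable_itv.
have finab : (lg (`]a, b]%classic : set (measurableTypeR R)) < +oo)%E.
  by rewrite lgE ?ltry// ltW.
pose nu : {finite_measure set (measurableTypeR R) -> \bar R} := mfrestr mab finab.
have numu : nu `<< mu.
  move=> N N0 A mA AN; apply/eqP; rewrite eq_le measure_ge0 andbT.
  rewrite -(@stieltjes_null_dominates R gc ag N N0 A mA AN).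
  by apply: le_measure; rewrite ?inE//; exact: measurableI.
pose f := Radon_Nikodym (charge_of_finite_measure nu) mu.
have fint : mu.-integrable setT f by exact: Radon_Nikodym_integrable.
pose r x := fine (f x).
have fr x : f x = (r x)%:E by rewrite /r fineK//; exact: Radon_Nikodym_fin_num.
have rint : mu.-integrable setT (EFin \o r).
  by rewrite (_ : EFin \o r = f)//; apply/funext => x; rewrite fr.
have gE x : a <= x <= b -> g x - g a = (\int[mu]_(t in `]a, x]) r t)%R.
  move=> /andP[ax xb]; rewrite /Rintegral.
  under eq_integral do rewrite -fr.
  rewrite -Radon_Nikodym_integral//=.
  rewrite /mfrestr /mrestr setIidl.
    by have := lgE _ _ ax; rewrite /lg => ->.
  by move=> y /=; rewrite !in_itv/= => /andP[-> yx]; exact: le_trans yx xb.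
exists r; split => //.
have locr : locally_integrable setT r.
  by apply: open_integrable_locally rint; exact: openT.
have inti y : mu.-integrable [set` Interval (BRight a) (BRight y)] (EFin \o r).
  by apply: integrableS rint.
have := @FTC1 R r (BRight a) inti locr.
apply: filterS; first exact: (ae_filter_ringOfSetsType mu).
move=> x H /andP[ax xb]; move: H; set F := fun y : R => _ => H.
have [|dF FE] := H; first by rewrite /= lte_fin.
have Fg y : a < y -> y < b -> F y + g a = g y.
  by move=> ay yb; rewrite /F -gE ?subrK// (ltW ay) (ltW yb).
clearbody F; have gF : {near x, (fun y => F y + g a) =1 g}.
  near=> y; have : y \in `]a, b[%R.
    by near: y; apply: near_in_itvoo; rewrite in_itv/= ax.
  by rewrite in_itv/= => /andP[]; exact: Fg.
have dga : derivable (cst (g a) : R -> R) x 1 by exact: derivable_cst.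
split; first exact: near_eq_derivable gF (derivableD dF dga).
rewrite -FE derive1E -(near_eq_derive _ gF) (deriveD dF dga).
by rewrite derive_cst addr0 derive1E.
Unshelve. all: by end_near. Qed.

End AbsoluteContinuityFTC.

Section DensityTheory.
Context {R : realType}.
Notation mu := (@lebesgue_measure R).
Implicit Types (a b : R) (g h r : R -> R).

Lemma density_onB a b g h r r' : density_on a b g r -> density_on a b h r' ->
  density_on a b (fun x => g x - h x) (fun x => r x - r' x).
Proof.
move=> [ir dg gE] [ir' dh hE]; split.
- rewrite (_ : EFin \o _ = (EFin \o r) \- (EFin \o r'))%E//.
  exact: integrableB.
- have ae_filter := ae_filter_ringOfSetsType mu.
  apply: filterS2 dg dh => x gx hx xab.
  have [[dgx gxE] [dhx hxE]] := (gx xab, hx xab).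
  split; first exact: (derivableB dgx dhx).
  by rewrite derive1E (deriveB dgx dhx) -!derive1E gxE hxE.
- move=> x xab; rewrite RintegralB//.
  + by rewrite -gE// -hE//; ring.
  + by apply: integrableS ir.
  + by apply: integrableS ir'.
Qed.

Lemma density_on_eq a b g h r : (forall x, a <= x <= b -> g x = h x) ->
  density_on a b g r -> density_on a b h r.
Proof.
move=> gh [ir dg gE]; split=> //; last first.
  move=> x /[dup] xab /gE <-; have /andP[ax xb] := xab.
  by rewrite !gh// lexx (le_trans ax xb).
apply: filterS dg; first exact: (ae_filter_ringOfSetsType mu).
move=> x H /[dup] xab /H [dgx <-].
have ghx : {near x, g =1 h}.
  near=> y; have : y \in `]a, b[%R.
    by near: y; apply: near_in_itvoo; rewrite in_itv.
  by rewrite in_itv/= => /andP[ay yb]; rewrite gh// (ltW ay) (ltW yb).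
split; first exact: near_eq_derivable ghx dgx.
by rewrite !derive1E -(near_eq_derive _ ghx).
Unshelve. all: by end_near. Qed.

(** Jordan decomposition: [h] is the difference of its variation V and of V - h, both nondecreasing
    and absolutely continuous. *)
Lemma abs_continuous_density a b h : a < b -> abs_continuous a b h ->
  exists r, density_on a b h r.
Proof.
move=> ab ach; pose k := h \o clamp a b.
have ack : list_abs_continuous k := clamp_abs_continuous (ltW ab) ach.
have acV := variation_from_abs_continuous a ack.
have ndV := variation_from_nd a ack.
set V := variation_from a k in acV ndV.
(* Both [k] and [V] are constant to the left of [a], which extends [variation_from_ge] to the whole
   line. *)
have kV x y : x <= y -> `|k y - k x| <= V y - V x.
  move=> xy; have km z : k (Num.max a z) = k z.
    by rewrite /k /=; congr (h _); rewrite /clamp /Num.max /Num.min; do !case: ifP; lra.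
  have Vm z : V (Num.max a z) = V z by rewrite /V /variation_from maxA maxxx.
  rewrite -(km x) -(km y) -(Vm x) -(Vm y); apply: (variation_from_ge ack).
    by rewrite le_max lexx.
  by rewrite ge_max !le_max lexx xy orbT.
have ndW : {homo (fun x => V x - k x) : x y / x <= y}.
  by move=> x y /kV; have := ler_norm (k y - k x); lra.
have [r rP] := nondecreasing_density ab ndV acV.
have [r' rP'] := nondecreasing_density ab ndW (list_abs_continuousB acV ack).
exists (fun x => r x - r' x); apply: density_on_eq (density_onB rP rP') => x xab.
by rewrite /k/= clamp_id//; ring.
Qed.

Lemma density_on_le a b h r x y : density_on a b h r -> a <= x -> x <= y -> y <= b ->
  `|h y - h x| <= (\int[mu]_(t in `]a, y]) `|r t| - \int[mu]_(t in `]a, x]) `|r t|)%R.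
Proof.
move=> [ir _ hE] ax xy yb.
have mr A : measurable A -> mu.-integrable A (EFin \o r).
  by move=> mA; apply: integrableS ir.
have mnr A : measurable A -> mu.-integrable A (EFin \o (fun t => `|r t|)).
  by move=> mA; apply: (integrable_norm (mr _ mA)).
have -> : h y - h x = (h y - h a) - (h x - h a) by ring.
rewrite !hE ?ax ?(le_trans xy yb) ?(le_trans ax xy)//.
rewrite !Rintegral_itvB ?bnd_simp//.
- apply: le_normr_Rintegral => //; exact: mr.
- exact: mnr.
- exact: mr.
Qed.

(** The integral of a nonnegative function is the supremum over the simple functions below it, which
    is monotone without any measurability. *)
Lemma ge0_le_integral_any d (T : measurableType d) (m : {measure set T -> \bar R})
    (f g : T -> \bar R) : (forall x, 0 <= f x)%E -> (forall x, f x <= g x)%E ->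
  (\int[m]_x f x <= \int[m]_x g x)%E.
Proof.
move=> f0 fg; rewrite !ge0_integralTE//; last by move=> x; exact: le_trans (f0 x) (fg x).
apply: le_ereal_sup => _ [s sf <-]; exists s => // x; exact: le_trans (sf x) (fg x).
Qed.

(* The point is that [f] need not be measurable. *)
Lemma ae_eq_integral_any (f g : measurableTypeR R -> \bar R) :
  (forall x, 0 <= f x)%E -> (forall x, 0 <= g x)%E -> measurable_fun setT g ->
  {ae mu, forall x, f x = g x} -> (\int[mu]_x f x = \int[mu]_x g x)%E.
Proof.
move=> f0 g0 mg [N [mN N0 fgN]].
have fgE x : ~ N x -> f x = g x by move=> nN; apply: contrapT => /fgN.
(* [f] is squeezed between [gN] and [gy], that is [g] changed to 0 and to +oo on the null set [N];
   both have the integral of [g]. *)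
pose gN := (g \_ (~` N)).
have gN0 x : (0 <= gN x)%E by rewrite /gN patchE; case: ifP.
have gNE : (\int[mu]_x g x = \int[mu]_x gN x)%E.
  by rewrite (ge0_negligible_integral mN)// setTD integral_mkcond.
apply/eqP; rewrite eq_le; apply/andP; split; last first.
  rewrite gNE; apply: ge0_le_integral_any => // x; rewrite /gN patchE.
  by case: ifPn => //; rewrite in_setC notin_setE => /fgE ->.
pose gy x := if x \in N then +oo%E else g x.
have gy0 x : (0 <= gy x)%E by rewrite /gy; case: ifP.
have mgy : measurable_fun setT gy.
  rewrite (_ : gy = (fun x => if x \in N then cst +oo%E x else g x))//.
  apply: measurable_fun_ifT => //; apply: (measurable_fun_bool true).
  rewrite setTI (_ : _ @^-1` _ = N)//.
  by apply/seteqP; split => x /=; [exact: set_mem|exact: mem_set].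
apply: (@le_trans _ _ (\int[mu]_x gy x)%E).
  apply: ge0_le_integral_any => // x; rewrite /gy; case: ifPn => [_|]; first exact: leey.
  by rewrite notin_setE => /fgE ->.
rewrite (ge0_negligible_integral mN)// setTD.
rewrite [leRHS](ge0_negligible_integral mN)// setTD.
rewrite (@eq_integral _ _ _ _ _ g)// => x; rewrite in_setC /gy => /negbTE -> //.
Qed.

(** For [k] the difference of second derivatives in [AC_dist], defaults included, whose
    measurability is not established. *)
Lemma density_on_Rintegral a b (k r : R -> R) : mu.-integrable setT (EFin \o r) ->
  {ae mu, forall x, a < x < b -> k x = r x} ->
  (\int[mu]_(x in `[a, b]) `|k x| = \int[mu]_(x in `]a, b]) `|r x|)%R.
Proof.
move=> ir kr; rewrite Rintegral_itv_obnd_cbnd; last first.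
  by apply: integrable_norm; apply: integrableS ir.
rewrite /Rintegral; congr fine; rewrite [LHS]integral_mkcond [RHS]integral_mkcond.
set f := (X in integral _ _ X = _); set g := (X in _ = integral _ _ X).
apply: (@ae_eq_integral_any f g); rewrite /f /g.
- by move=> x; rewrite patchE; case: ifP => //; rewrite lee_fin.
- by move=> x; rewrite patchE; case: ifP => //; rewrite lee_fin.
- apply/(measurable_restrictT _ _).1 => //; apply/measurable_EFinP.
  apply: measurable_funTS; apply: measurableT_comp => //.
  apply: measurableT_comp => //; apply/measurable_EFinP.
  exact: measurable_int ir.
- have ae_filter := ae_filter_ringOfSetsType mu.
  have nea : {ae mu, forall x, x <> a}.
    exists [set a]; split; [exact: measurable_set1|exact: lebesgue_measure_set1|].
    by move=> x /= /contrapT.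
  have neb : {ae mu, forall x, x <> b}.
    exists [set b]; split; [exact: measurable_set1|exact: lebesgue_measure_set1|].
    by move=> x /= /contrapT.
  apply: filterS3 kr nea neb => x krx xa xb; rewrite !patchE; case: ifPn => // xab.
  rewrite krx//; move: xab; rewrite inE/= in_itv/= !le_eqVlt => /andP[/orP[/eqP ax|->]].
    by case: xa.
  by case/orP => [/eqP|].
Qed.

End DensityTheory.

(** * A criterion for undistortedness *)

Section UndistortedCriterion.
Context {R : realType} {G : groupTopType}.
Implicit Types (d s : G -> G -> R) (f g h : G).

Lemma inf_le_of_mem (A : set R) x : (forall y, A y -> 0 <= y) -> A x -> inf A <= x.
Proof. by move=> A0 Ax; apply: ge_inf => //; exists 0. Qed.

Lemma cayley_word_nonneg (A : set G) g h y :
  [set (size s)%:R | s in [set s : seq G |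
    (forall x, x \in s -> A x \/ A x^-1%g) /\ g = foldr (fun x y => x * y)%g h s]] y ->
  0 <= y :> R.
Proof. by move=> [s _ <-]. Qed.

Lemma cayley_metric_ge0 (A : set G) g h : 0 <= cayley_metric A g h :> R.
Proof.
rewrite /cayley_metric; set B := [set _ | _ in _].
have [->|/set0P B0] := eqVneq B set0; first by rewrite inf0.
by apply: lb_le_inf => // y /cayley_word_nonneg.
Qed.

Lemma foldr_nseq_mulg f h m :
  foldr (fun x y => x * y)%g h (nseq m f) = (f ^+ m * h)%g.
Proof. by elim: m => [|m IH] /=; rewrite ?mul1g// IH expgS mulgA. Qed.

Lemma cayley_metric_expl f h m : cayley_metric [set f] (f ^+ m * h)%g h <= m%:R :> R.
Proof.
apply: inf_le_of_mem; first by move=> y /cayley_word_nonneg.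
exists (nseq m f); last by rewrite size_nseq.
split; last by rewrite foldr_nseq_mulg.
by move=> x; rewrite mem_nseq => /andP[_ /eqP ->]; left.
Qed.

Lemma cayley_metric_expr f g m : cayley_metric [set f] g (f ^+ m * g)%g <= m%:R :> R.
Proof.
apply: inf_le_of_mem; first by move=> y /cayley_word_nonneg.
exists (nseq m f^-1%g); last by rewrite size_nseq.
split; last by rewrite foldr_nseq_mulg mulgA expVgn mulVg mul1g.
by move=> x; rewrite mem_nseq => /andP[_ /eqP ->]; right; rewrite /= invgK.
Qed.

(** This disposes of negative exponents: by right invariance, the distance of two powers of [f]
    becomes that of a nonnegative power to 1. *)
Lemma powers_cmp f g h : powers f g -> powers f h ->
  exists m, g = (f ^+ m * h)%g \/ h = (f ^+ m * g)%g.
Proof.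
have expB i j : (i <= j)%N -> (f ^+ j = f ^+ (j - i) * f ^+ i)%g.
  by move=> ij; rewrite -expgnDr subnK.
have expBV i j : (i <= j)%N -> (f ^- i = f ^+ (j - i) * f ^- j)%g.
  move=> ij; rewrite [X in (_ * X^-1)%g](expB i j ij) invgM mulgA.
  rewrite (_ : f ^+ (j - i) * f ^- i = f ^- i * f ^+ (j - i))%g; last first.
    by apply: (mulgI (f ^+ i)%g); rewrite !mulgA mulgV mul1g -expgnDr addnC expgnDr mulgK.
  by rewrite -mulgA mulgV mulg1.
have expD i j : (f ^+ i = f ^+ (i + j) * f ^- j)%g by rewrite expgnDr mulgK.
move=> [i [->|->]] [j [->|->]].
- have [ij|/ltnW ji] := leqP i j.
    by exists (j - i)%N; right; exact: expB.
  by exists (i - j)%N; left; exact: expB.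
- by exists (i + j)%N; left; exact: expD.
- by exists (j + i)%N; right; exact: expD.
- have [ij|/ltnW ji] := leqP i j.
    by exists (j - i)%N; left; exact: expBV.
  by exists (i - j)%N; right; exact: expBV.
Qed.

Lemma pseudometric_word d f g h (t : seq G) : pseudometric d -> right_invariant d ->
  (forall x, x \in t -> [set f] x \/ [set f] x^-1%g) ->
  g = foldr (fun x y => x * y)%g h t -> d g h <= (size t)%:R * d f 1%g.
Proof.
move=> [d0 dge dsym dtri] dri; elim: t g => [|x t IH] g /=.
  by move=> _ ->; rewrite d0 mul0r.
move=> tf ->; set y := foldr _ _ _.
have yh : d y h <= (size t)%:R * d f 1%g.
  by apply: IH => // z zt; apply: tf; rewrite inE zt orbT.
have xy : d (x * y)%g y = d f 1%g.
  rewrite -[in X in d _ X](mul1g y) dri.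
  have [->//|xf] := tf x (mem_head _ _).
  by rewrite -(dri _ _ x^-1%g) mulgV mul1g dsym xf.
by rewrite -natr1 mulrDl mul1r addrC (le_trans (dtri _ y _))// xy lerD2l.
Qed.

(** By maximality s <= K d + C1, so d(f^m, 1) grows linearly for every maximal [d]; the upper bound
    of a quasi-isometric embedding follows from right invariance, letter by letter. A torsion
    element would make s(f^m, 1) vanish for arbitrarily large m. *)
Lemma linear_growth_undistorted s f (c C : R) : ri_cont_pseudometric s -> 0 < c ->
  (forall m : nat, c * m%:R - C <= s (f ^+ m)%g 1%g) -> ~ distorted R f /\ ~ torsion f.
Proof.
move=> sP c0 growth; split; last first.
  move=> [n n0 fn]; have [[s0 _ _ _] _ _] := sP.
  pose j := Num.bound (C / c).
  have := growth (n * j)%N; rewrite expgnA fn expg1n s0 leNgt => /negP; apply.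
  rewrite subr_gt0 mulrC -ltr_pdivrMr//.
  have [Cc|Cc] := leP 0 (C / c); last first.
    by rewrite (lt_le_trans Cc).
  by rewrite (lt_le_trans (archi_boundP Cc))// ler_nat leq_pmull.
move=> [d [[dP dcont dri] dmax]]; apply.
have [K0 [C1 sd]] := dmax _ sP.
have [d0 dge dsym dtri] := dP.
(* The constant provided by maximality may be nonpositive. *)
pose K := Num.max K0 1; have K1 : 1 <= K by rewrite le_max lexx orbT.
have Kgt0 : 0 < K by exact: lt_le_trans ltr01 K1.
have sdK g h : s g h <= K * d g h + C1.
  by rewrite (le_trans (sd g h))// lerD2r ler_wpM2r// le_max lexx.
have lower m h : K^-1 * (c * m%:R - C - C1) <= d (f ^+ m * h)%g h.
  rewrite -[in X in d _ X](mul1g h) dri mulrC ler_pdivrMr// lerBlDr [_ * K]mulrC.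
  exact: le_trans (growth m) (sdK _ _).
pose M := Num.max (d f 1%g) 1; have M1 : 1 <= M by rewrite le_max lexx orbT.
have Mgt0 : 0 < M by exact: lt_le_trans ltr01 M1.
(* One constant serves both inequalities: M for the upper one, K / c for the lower one. *)
pose L := Num.max M (K / c).
have L1 : 1 <= L by rewrite le_max M1.
have Lgt0 : 0 < L by exact: lt_le_trans ltr01 L1.
pose C2 := Num.max 0 (K^-1 * (C + C1)).
have C20 : 0 <= C2 by rewrite le_max lexx.
exists L, C2; split => // g h pg ph.
have [m gh] := powers_cmp pg ph.
have [cm dm] : cayley_metric [set f] g h <= m%:R :> R /\ K^-1 * (c * m%:R - C - C1) <= d g h.
  case: gh => ->; split; [exact: cayley_metric_expl|exact: lower|
    exact: cayley_metric_expr|by rewrite dsym; exact: lower].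
apply/andP; split.
  apply: le_trans dm; rewrite -addrA -opprD mulrBr lerB ?le_max ?lexx ?orbT//.
  rewrite mulrA; apply: ler_pM => //; [by rewrite invr_ge0 ltW|exact: cayley_metric_ge0|].
  rewrite -[leRHS]invrK invfM invrK lef_pV2 ?posrE ?divr_gt0// le_max lexx orbT//.
rewrite -[leLHS]addr0 lerD// (@le_trans _ _ (M * cayley_metric [set f] g h))//; last first.
  by rewrite ler_wpM2r ?cayley_metric_ge0// le_max lexx.
(* The bound holds for each word, hence for the infimum. A word has to be exhibited, [inf] being 0
   on the empty set. *)
rewrite mulrC -ler_pdivrMr//; apply: lb_le_inf.
  case: gh => ->; [exists m%:R, (nseq m f)|exists m%:R, (nseq m f^-1%g)]; rewrite ?size_nseq//.
    split; last by rewrite foldr_nseq_mulg.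
    by move=> x; rewrite mem_nseq => /andP[_ /eqP ->]; left.
  split; last by rewrite foldr_nseq_mulg mulgA expVgn mulVg mul1g.
  by move=> x; rewrite mem_nseq => /andP[_ /eqP ->]; right; rewrite /= invgK.
move=> _ [t [tf tE] <-]; rewrite ler_pdivrMr//.
rewrite (le_trans (pseudometric_word dP dri tf tE))// ler_wpM2l// le_max lexx//.
Qed.

End UndistortedCriterion.

(** Brings the variation pseudometric of Diff^{1+AC} to Diff^k along the inclusion. *)
Lemma ri_cont_pseudometric_pullback {R : realType} {G H : groupTopType} (i : G -> H)
    (s : H -> H -> R) : {morph i : x y / (x * y)%g} -> continuous i ->
  ri_cont_pseudometric s -> ri_cont_pseudometric (fun x y => s (i x) (i y)).
Proof.
move=> iM ci [[s0 sge ssym stri] scont sri]; split.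
- by split => *.
- have c1 : continuous (fun p : G * G => i p.1).
    by move=> p; apply: (@continuous_comp _ _ _ fst i); [exact: cvg_fst|exact: ci].
  have c2 : continuous (fun p : G * G => i p.2).
    by move=> p; apply: (@continuous_comp _ _ _ snd i); [exact: cvg_snd|exact: ci].
  move=> p; apply: (@continuous_comp _ _ _ (fun p : G * G => (i p.1, i p.2))
    (fun p : H * H => s p.1 p.2)); last exact: scont.
  by apply: cvg_pair; [exact: c1|exact: c2].
- by move=> f g h; rewrite !iM sri.
Qed.

(** * The derivative on the circle and its total variation *)

Section CircleDerivative.
Context {R : realType}.
Local Open Scope quotient_scope.
Implicit Types (f g : circle R -> circle R) (F G : R -> R).

Lemma to_circleD x n : to_circle (x + n%:~R) = to_circle x :> circle R.
Proof. by apply/to_circleP; rewrite addrC addKr intr_int. Qed.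

Lemma to_circleB x n : to_circle (x - n%:~R) = to_circle x :> circle R.
Proof. by rewrite -mulrNz to_circleD. Qed.

Lemma to_circle_int x y : to_circle x = to_circle y :> circle R ->
  exists n : int, x = y + n%:~R.
Proof. by move=> /to_circleP /intrP[n xy]; exists n; rewrite -xy addrC subrK. Qed.

Lemma is_lift_shift f F n : is_lift F f -> is_lift (fun x => F (x + n%:~R)) f.
Proof.
move=> [cF lF]; split; last by move=> x; rewrite lF to_circleD.
move=> x; apply: (@continuous_comp _ _ _ (fun y : R => y + n%:~R) F); last exact: cF.
by apply: cvgD; [exact: cvg_id|exact: cvg_cst].
Qed.

Lemma lift_shift f F n : is_lift F f -> exists c, forall x, F (x + n%:~R) = F x + c.
Proof.
move=> lF; have [c E] := lift_unique (is_lift_shift n lF) lF.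
by exists c => x; have := congr1 (fun h => h x) E.
Qed.

Lemma derive1_shift F c x : (fun y => F (y + c))^`() x = F^`() (x + c).
Proof.
rewrite /derive1.
suff -> : (fun h : R => h^-1 *: (F (h + x + c) - F (x + c))) =
  (fun h : R => h^-1 *: (F (h + (x + c)) - F (x + c))) by [].
by apply/funext => h; rewrite addrA.
Qed.

Lemma lift_derive1_periodic f F n x : is_lift F f -> F^`() (x + n%:~R) = F^`() x.
Proof.
move=> lF; have [c E] := lift_shift n lF.
by rewrite -derive1_shift (_ : (fun y => _) = (fun y => F y + c)) ?derive1_addc//; exact/funext.
Qed.

Definition cD f (p : circle R) : R := cderive f 1 (repr p).

Lemma cD_lift f F x : is_lift F f -> cD f (to_circle x) = F^`() x.
Proof.
move=> lF; rewrite /cD (cderive1E lF).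
have /to_circle_int[n ->] : to_circle (repr (to_circle x)) = to_circle x.
  by rewrite /to_circle reprK.
exact: lift_derive1_periodic lF.
Qed.

Lemma circle_rep (p : circle R) : exists2 x : R, 0 <= x < 1 & to_circle x = p.
Proof.
have [y yp] := to_circle_surj p; exists (y - (Num.floor y)%:~R); last by rewrite to_circleB.
by have /andP[] := floor_itv y; rewrite intrD; lra.
Qed.

End CircleDerivative.

Section CdiffDerivative.
Context {R : realType}.
Implicit Types (k : nat) (p : circle R).

Lemma increasing_Ck_mapW k (f : circle R -> circle R) :
  increasing_Ck_map k.+1 f -> increasing_Ck_map 1 f.
Proof.
move=> [F [lF iF kF]]; exists F; split => //.
by elim: k kF => // k IH /CkW.
Qed.

Lemma cD_id p : cD (id : circle R -> circle R) p = 1.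
Proof.
have [x <-] := to_circle_surj p; rewrite (cD_lift _ is_lift_id).
by rewrite derive1E derive_id.
Qed.

Lemma cD_comp (f g : circle R -> circle R) p : increasing_Ck_map 1 f -> increasing_Ck_map 1 g ->
  cD (f \o g) p = cD f (g p) * cD g p.
Proof.
move=> [F [lF iF /CkS[dF _]]] [G [lG iG /CkS[dG _]]]; have [x <-] := to_circle_surj p.
rewrite (cD_lift _ (is_lift_comp lF lG)) (cD_lift _ lG); have [_ <-] := lG.
by rewrite (cD_lift _ lF) derive1_comp.
Qed.

Lemma cD_ge0 (f : circle R -> circle R) p : increasing_Ck_map 1 f -> 0 <= cD f p.
Proof.
move=> [F [lF iF /CkS[dF _]]]; have [x <-] := to_circle_surj p; rewrite (cD_lift _ lF).
apply: (@incr_derive1_ge0 _ F setT) => //; first by move=> y z _ _; exact: iF.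
by rewrite interiorT.
Qed.

Lemma cD_cont (f : circle R -> circle R) : increasing_Ck_map 1 f ->
  continuous (cD f \o to_circle).
Proof.
move=> [F [lF iF /CkS[dF /Ck0 cF]]].
rewrite (_ : cD f \o _ = F^`())//; apply/funext => x /=; exact: cD_lift.
Qed.

Section one_diffeo.
Variable f : Cdiff R 1.

Lemma cD_dinv p : cD f (Defs.dinv f p) * cD (Defs.dinv f) p = 1.
Proof.
rewrite -cD_comp; [|exact: dmap_Ck|exact: dinv_Ck].
rewrite (_ : _ \o _ = id) ?cD_id//; apply/funext => q /=; exact: dinvK.
Qed.

Lemma cD_gt0 p : 0 < cD f p.
Proof.
rewrite lt_neqAle cD_ge0 ?andbT; last exact: dmap_Ck.
apply/eqP => f0; have := cD_dinv (f p); rewrite dmapK -f0 mul0r => /eqP.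
by rewrite eq_sym oner_eq0.
Qed.

Lemma cD_lbound : exists2 m : R, 0 < m & forall p, m <= cD f p.
Proof.
have cn : {within `[0, 1], continuous (cD f \o to_circle)}.
  by apply: continuous_subspaceT; apply: cD_cont; exact: dmap_Ck.
have [c c01 hc] := EVT_min ler01 cn.
exists (cD f (to_circle c)); first exact: cD_gt0.
move=> p; have [x /andP[x0 x1] <-] := circle_rep p; apply: hc.
by rewrite in_itv/= x0 ltW.
Qed.

(** If the lift gained more than 1 over a period, it would take the value F x + 1 strictly between x
    and x + 1, and [f] would not be injective. *)
Lemma lift_succ F x : is_lift F f -> {homo F : x y / x < y} -> F (x + 1) <= F x + 1.
Proof.
move=> lF iF; rewrite leNgt; apply/negP => Fx1.
have [cF EF] := lF.
have : exists2 c, c \in `[x, x + 1]%R & F c = F x + 1.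
  apply: IVT; [lra|exact: continuous_subspaceT|].
  have /ltW F1 : F x < F (x + 1) by apply: iF; lra.
  by rewrite (min_idPl F1) (max_idPr F1); lra.
move=> [c]; rewrite in_itv/= => /andP[xc cx] Fc.
have /to_circle_int[n cxn] : to_circle c = to_circle x.
  apply: (can_inj (dmapK f)); rewrite -!EF Fc.
  by rewrite (_ : 1 = 1%:~R)// to_circleD.
have c_lt : c < x + 1.
  by rewrite lt_neqAle cx andbT; apply/eqP => cE; move: Fx1; rewrite -cE Fc ltxx.
have c_gt : x < c.
  by rewrite lt_neqAle xc andbT; apply/eqP => cE; move: Fc; rewrite -cE; lra.
have n0 : (0 < n)%R by rewrite -(ltr_int R) ; lra.
have n1 : (n < 1)%R by rewrite -(ltr_int R); lra.
by move: n0 n1; lia.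
Qed.

End one_diffeo.

End CdiffDerivative.

Section CyclicVariation.
Context {R : realType}.
Implicit Types (phi psi : circle R -> R) (u v : nat -> R) (n : nat) (B : R).

Definition pair_chain n u v : Prop := forall i, (i < n)%N ->
  [/\ u i <= v i, (i.+1 < n)%N -> v i <= u i.+1 & v i <= u 0%N + 1].

Definition chain_sum phi n u v : R :=
  \sum_(i < n) `|phi (to_circle (v i)) - phi (to_circle (u i))|.

(** A real [sup] is meaningful only on a bounded set; this supplies the bound wherever [circle_var]
    is compared with its chain sums from above. *)
Definition var_le phi B : Prop := forall n u v, pair_chain n u v -> chain_sum phi n u v <= B.

(* The total variation over the circle, base point free: the chain may start
   anywhere and goes around at most once. *)
Definition circle_var phi : R :=
  sup [set w | exists n u v, pair_chain n u v /\ w = chain_sum phi n u v].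

Lemma circle_var_le phi B : var_le phi B -> circle_var phi <= B.
Proof.
move=> phiB; apply: ge_sup.
  by exists 0, 0%N, (fun=> 0), (fun=> 0); split => //; rewrite /chain_sum big_ord0.
by move=> _ [n [u [v [c ->]]]]; exact: phiB.
Qed.

Lemma le_circle_var phi B n u v : var_le phi B -> pair_chain n u v ->
  chain_sum phi n u v <= circle_var phi.
Proof.
move=> phiB c; apply: ub_le_sup; last by exists n, u, v.
by exists B => _ [n' [u' [v' [c' ->]]]]; exact: phiB.
Qed.

Lemma var_le_comb psi phi phi' B B' (K K' : R) : 0 <= K -> 0 <= K' ->
  (forall p q, `|psi q - psi p| <= K * `|phi q - phi p| + K' * `|phi' q - phi' p|) ->
  var_le phi B -> var_le phi' B' -> var_le psi (K * B + K' * B').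
Proof.
move=> K0 K'0 H vB vB' n u v c.
apply: (@le_trans _ _ (K * chain_sum phi n u v + K' * chain_sum phi' n u v)).
  by rewrite /chain_sum !mulr_sumr -big_split/=; apply: ler_sum => i _; exact: H.
by apply: lerD; apply: ler_wpM2l => //; [exact: vB|exact: vB'].
Qed.

Lemma pair_chain_ge n u v i : pair_chain n u v -> (i < n)%N -> u 0%N <= u i.
Proof.
move=> c; elim: i => // i IH i1n.
have [uv vu _] := c i (ltn_trans (ltnSn i) i1n).
by rewrite (le_trans (IH (ltn_trans (ltnSn i) i1n)))// (le_trans uv)// vu.
Qed.

Lemma pair_chain_telescope (M : R -> R) n u v : pair_chain n.+1 u v ->
  (forall x y, u 0%N <= x -> x <= y -> y <= u 0%N + 1 -> M x <= M y) ->
  \sum_(i < n.+1) (M (v i) - M (u i)) <= M (v n) - M (u 0%N).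
Proof.
elim: n => [|n IH] c ndM; first by rewrite big_ord1.
rewrite big_ord_recr/=.
have cn : pair_chain n.+1 u v.
  move=> i ilt; have [uv vu v1] := c i (ltnW ilt); split => // i1.
  by apply: vu; exact: ltnW.
have := IH cn ndM; have [uv vu v1] := c n (leqnSn _).
have [uv' _ v1'] := c n.+1 (leqnn _).
have : M (v n) <= M (u n.+1).
  apply: ndM; [|exact: vu|exact: le_trans uv' v1'].
  by rewrite (le_trans _ uv)// (pair_chain_ge c)// leqW.
by lra.
Qed.

(** A chain starts anywhere: translated so that it starts in [0, 1[, it stays in [0, 2[ and may meet
    both laps. Hence the factor 2. *)
Lemma var_le_dominated phi (L : R -> R) :
  (forall x y, 0 <= x -> x <= y -> y <= 1 ->
    `|phi (to_circle y) - phi (to_circle x)| <= L y - L x) ->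
  var_le phi (2 * (L 1 - L 0)).
Proof.
move=> H [|n] u v c.
  rewrite /chain_sum big_ord0 mulr_ge0//; have := H 0 1 (lexx _) ler01 (lexx _).
  exact: le_trans.
pose k := Num.floor (u 0%N).
pose u' i := u i - k%:~R; pose v' i := v i - k%:~R.
have -> : chain_sum phi n.+1 u v = chain_sum phi n.+1 u' v'.
  by apply: eq_bigr => i _; rewrite /u' /v' !to_circleB.
have c' : pair_chain n.+1 u' v'.
  by move=> i /c[uv vu v1]; rewrite /u' /v'; split; [lra|move=> /vu; lra|lra].
have u0 : 0 <= u' 0%N < 1.
  by have /andP[] := floor_itv (u 0%N); rewrite -/k intrD /u'; lra.
(* [L] continued over two laps, the first term varying on [0, 1] and the second on [1, 2]; [phiE]
   splits [phi] likewise. *)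
pose M x := L (Num.min x 1) + L (Num.max (x - 1) 0).
have ndL x y : 0 <= x -> x <= y -> y <= 1 -> L x <= L y.
  by move=> x0 xy y1; rewrite -subr_ge0; exact: le_trans (H _ _ x0 xy y1).
have phiE x : 0 <= x <= 2 -> phi (to_circle x) =
    phi (to_circle (Num.min x 1)) + phi (to_circle (Num.max (x - 1) 0)) - phi (to_circle 0).
  move=> x02; case: (leP x 1) => x1.
    by have -> : Num.max (x - 1) 0 = 0; [apply/max_idPr; lra|rewrite addrK].
  have -> : Num.max (x - 1) 0 = x - 1 by apply/max_idPl; lra.
  have -> : to_circle (x - 1) = to_circle x :> circle R.
    by rewrite (_ : 1 = 1%:~R)// to_circleB.
  have -> : to_circle 1 = to_circle 0 :> circle R.
    by rewrite -[1]add0r (_ : 1 = 1%:~R)// to_circleD.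
  by rewrite addrAC subrr add0r.
have dom x y : 0 <= x -> x <= y -> y <= 2 ->
    `|phi (to_circle y) - phi (to_circle x)| <= M y - M x.
  move=> x0 xy y2; rewrite (phiE x) ?(phiE y); [|lra..].
  have -> (a b z d e : R) : a + b - z - (d + e - z) = (a - d) + (b - e) by ring.
  apply: le_trans (ler_normD _ _) _.
  rewrite /M opprD addrACA lerD//; apply: H.
  - by rewrite le_min x0 ler01.
  - by rewrite le_min !ge_min xy lexx/= orbT.
  - by rewrite ge_min lexx orbT.
  - by rewrite le_max lexx orbT.
  - by rewrite ge_max !le_max lexx orbT andbT; apply/orP; left; lra.
  - by rewrite ge_max ler01 andbT; lra.
have ndM x y : 0 <= x -> x <= y -> y <= 2 -> M x <= M y.
  by move=> x0 xy y2; rewrite -subr_ge0; exact: le_trans (dom _ _ x0 xy y2).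
have vn i : (i < n.+1)%N -> v' i <= 2 by move=> /c'[_ _]; move: u0; lra.
have ui i : (i < n.+1)%N -> 0 <= u' i.
  by move=> /(pair_chain_ge c'); move: u0; lra.
apply: (@le_trans _ _ (\sum_(i < n.+1) (M (v' i) - M (u' i)))).
  apply: ler_sum => i _; have [uv _ _] := c' i (ltn_ord i).
  by apply: dom; [exact: ui|exact: uv|exact: vn].
apply: le_trans (pair_chain_telescope c' _) _.
  by move=> x y xu xy yu; apply: ndM => //; move: u0 xu yu; lra.
have : M 0 <= M (u' 0%N) by apply: ndM => //; move: u0; lra.
have : M (v' n) <= M 2.
  by apply: ndM; [|exact: vn|]; have [+ _ _] := c' n (leqnn _); have := ui n (leqnn _); lra.
have -> : M 2 = L 1 + L 1.
  rewrite /M; have -> : Num.min (2 : R) 1 = 1 by apply/min_idPr; lra.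
  have -> : Num.max (2 - 1 : R) 0 = 2 - 1 by apply/max_idPl; lra.
  by congr (_ + L _); lra.
have -> : M 0 = L 0 + L 0.
  by rewrite /M (min_idPl _) ?ler01// (max_idPr _)//; lra.
by lra.
Qed.

Lemma pair_chain_map (f : Cdiff R 1) n u v F : is_lift F f -> {homo F : x y / x < y} ->
  pair_chain n u v -> pair_chain n (F \o u) (F \o v).
Proof.
move=> lF iF c i /c[uv vu v1]; have ndF : {homo F : x y / x <= y} by exact: ltW_homo.
split; [exact: ndF|by move=> /vu; exact: ndF|].
by apply: le_trans (lift_succ _ lF iF); exact: ndF.
Qed.

(** Lifts of [f] and of its inverse carry chains to chains, by [lift_succ], so both suprema run over
    the same sums. *)
Lemma circle_var_comp (f : Cdiff R 1) phi : circle_var (phi \o f) = circle_var phi.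
Proof.
rewrite /circle_var; congr sup; apply/seteqP; split => _ [n [u [v [c ->]]]].
  have [F [lF iF _]] := dmap_Ck f; exists n, (F \o u), (F \o v).
  split; first exact: (@pair_chain_map f).
  by apply: eq_bigr => i _; have [_ E] := lF; rewrite /= !E.
have [F [lF iF _]] := dinv_Ck f; exists n, (F \o u), (F \o v).
split; first exact: (@pair_chain_map (f^-1)%g).
by apply: eq_bigr => i _; have [_ E] := lF; rewrite /= !E !dinvK.
Qed.

End CyclicVariation.

Lemma pseudometric_dist_le {R : realType} {G : groupTopType} (d : G -> G -> R) (f g f' g' : G) :
  pseudometric d -> `|d f g - d f' g'| <= d f f' + d g g'.
Proof.
move=> [_ _ dsym dtri]; have := dtri f f' g; have := dtri f' g' g.
have := dtri f' f g'; have := dtri f g g'; rewrite (dsym f' f) (dsym g' g).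
by move=> *; rewrite ler_norml; apply/andP; split; lra.
Qed.

Section LogVariation.
Context {R : realType}.
Notation mu := (@lebesgue_measure R).
Implicit Types (f g h : ACdiff R) (p q : circle R).

Lemma ler_dist_ln (m a b : R) : 0 < m -> m <= a -> m <= b ->
  `|ln a - ln b| <= m^-1 * `|a - b|.
Proof.
move=> m0; wlog ba : a b / b <= a.
  move=> W ma mb; case: (leP b a) => [ba|/ltW ab]; first exact: W.
  by rewrite distrC [ `|a - b|]distrC; exact: W.
move=> ma mb; have [a0 b0] := (lt_le_trans m0 ma, lt_le_trans m0 mb).
have lab : ln b <= ln a by rewrite ler_ln ?posrE.
rewrite !ger0_norm ?subr_ge0// -ln_div ?posrE//.
have -> : a / b = 1 + (a - b) / b by field; rewrite gt_eqF.
have ab0 : 0 <= (a - b) / b by rewrite divr_ge0 ?subr_ge0// ltW.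
apply: (@le_trans _ _ ((a - b) / b)).
  by apply: le_ln1Dx; apply: lt_le_trans ab0; rewrite ltrN10.
by rewrite mulrC ler_wpM2r ?subr_ge0// lef_pV2 ?posrE.
Qed.

Lemma AC_density f : exists2 r, mu.-integrable setT (EFin \o r) &
  {ae mu, forall x, 0 < x < 1 -> cderive f 2 x = r x} /\
  density_on 0 1 (cderive f 1) r.
Proof.
have [r rP] := abs_continuous_density (@ltr01 R) (acmap_ac f 0 1).
have [ir dr _] := rP; exists r => //; split => //.
apply: filterS dr; first exact: (ae_filter_ringOfSetsType mu).
by move=> x H /H[].
Qed.

Lemma cD_cderive f x : cD f (to_circle x) = cderive f 1 x.
Proof.
have [F [lF _ _]] := dmap_Ck f.
by rewrite (cD_lift _ (lift_is_lift lF)) (cderive1E (lift_is_lift lF)).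
Qed.

Lemma density_var_le (phi : circle R -> R) (k r : R -> R) :
  (forall x, phi (to_circle x) = k x) -> density_on 0 1 k r ->
  var_le phi (2 * (\int[mu]_(t in `]0%R, 1%R]) `|r t|)%R).
Proof.
move=> phik kr; pose L y := (\int[mu]_(t in `]0%R, y]) `|r t|)%R.
have -> : (\int[mu]_(t in `]0%R, 1%R]) `|r t|)%R = L 1 - L 0.
  by rewrite /L [X in _ - X](_ : _ = 0) ?subr0// set_itv_ge ?Rintegral_set0// bnd_simp ltxx.
by apply: var_le_dominated => x y x0 xy y1; rewrite !phik; exact: density_on_le kr x0 xy y1.
Qed.

Lemma AC_dist_ge f g : [/\ 0 <= sup_dist0 f g, 0 <= sup_dist (cderive f 1) (cderive g 1) &
  0 <= (\int[mu]_(x in `[0%R, 1%R]) `|cderive f 2 x - cderive g 2 x|)%R].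
Proof.
have sup_ge0 (A : set R) : (forall x, A x -> 0 <= x) -> 0 <= sup A.
  move=> A0; have [[[x Ax] uA]|nA] := pselect (has_sup A); last by rewrite sup_out.
  by apply: le_trans (A0 _ Ax) _; exact: ub_le_sup.
split; last by apply: Rintegral_ge0.
- apply: sup_ge0 => _ [p _ <-]; rewrite /circle_dist; set A := [set _ | _ in _ & _ in _].
  have [->|/set0P A0] := eqVneq A set0; first by rewrite inf0.
  by apply: lb_le_inf => // _ [x _ [y _ <-]].
- by apply: sup_ge0 => _ [x _ <-].
Qed.

Lemma cD_dist_le f g p : `|cD g p - cD f p| <= AC_dist f g.
Proof.
have [d0 d1 d2] := AC_dist_ge f g.
apply: (@le_trans _ _ (sup_dist (cderive f 1) (cderive g 1))); last by rewrite /AC_dist; lra.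
have [x /andP[x0 x1] <-] := circle_rep p; rewrite !cD_cderive distrC.
apply: ub_le_sup; last by exists x => //; rewrite /= in_itv/= x0 ltW.
have cc (h : ACdiff R) : continuous (cderive h 1).
  have [F [lF _ /CkS[_ /Ck0 cF]]] := dmap_Ck h.
  by rewrite (cderive1E lF).
have [M M0 hM] := continuous_bounded 0 1 (cc f).
have [N N0 hN] := continuous_bounded 0 1 (cc g).
exists (M + N) => _ [y y01 <-]; move: y01; rewrite /= in_itv/= => y01.
by apply: le_trans (ler_normB _ _) _; apply: lerD; [exact: hM|exact: hN].
Qed.

(** The variation of g' - f' is controlled by the integral of |g'' - f''|, the last term of
    [AC_dist]; here the densities replace the second derivatives. *)
Lemma cD_sub_var_le f g : var_le (fun p => cD g p - cD f p) (2 * AC_dist f g).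
Proof.
have [r ir [fr dr]] := AC_density f; have [r' ir' [gr' dr']] := AC_density g.
have -> : AC_dist f g = sup_dist0 f g + sup_dist (cderive f 1) (cderive g 1) +
    (\int[mu]_(x in `]0%R, 1%R]) `|r' x - r x|)%R.
  rewrite /AC_dist; congr (_ + _).
  rewrite (@density_on_Rintegral _ _ _ (fun x => cderive f 2 x - cderive g 2 x) (fun x => r x - r' x)).
  - by apply: eq_Rintegral => x _; rewrite distrC.
  - by have [] := density_onB dr dr'.
  - apply: filterS2 fr gr'; first exact: (ae_filter_ringOfSetsType mu).
    by move=> x fx gx x01; rewrite fx// gx.
have [d0 d1 _] := AC_dist_ge f g.
move=> n u v c; apply: (@le_trans _ _ (2 * (\int[mu]_(x in `]0%R, 1%R]) `|r' x - r x|)%R)); last by lra.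
apply: (density_var_le (k := fun x => cderive g 1 x - cderive f 1 x)) c.
  by move=> x; rewrite !cD_cderive.
exact: density_onB dr' dr.
Qed.

Lemma cD_var_le f : exists2 B : R, 0 <= B & var_le (cD f) B.
Proof.
have [r ir [fr dr]] := AC_density f.
exists (2 * (\int[mu]_(t in `]0%R, 1%R]) `|r t|)%R).
  by rewrite mulr_ge0// Rintegral_ge0.
by apply: density_var_le dr => x; exact: cD_cderive.
Qed.

Lemma circle_var0 (phi : circle R -> R) : (forall p, phi p = 0) -> circle_var phi = 0.
Proof.
move=> phi0; rewrite /circle_var (_ : [set _ | _] = [set 0]) ?sup1//; apply/seteqP; split => w /=.
  by move=> [n [u [v [_ ->]]]]; rewrite /chain_sum big1// => i _; rewrite !phi0 subrr normr0.
by move=> ->; exists 0%N, (fun=> 0), (fun=> 0); split => //; rewrite /chain_sum big_ord0.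
Qed.

Lemma circle_var_ge0 (phi : circle R -> R) B : var_le phi B -> 0 <= circle_var phi.
Proof.
move=> phiB; have c : pair_chain 0 (fun=> 0 : R) (fun=> 0) by [].
by have := le_circle_var phiB c; rewrite /chain_sum big_ord0.
Qed.

Lemma circle_varN (phi psi : circle R -> R) : (forall p, phi p = - psi p) ->
  circle_var phi = circle_var psi.
Proof.
move=> E; rewrite /circle_var; congr sup; apply/funext => w; apply/propext.
suff S n u v : chain_sum phi n u v = chain_sum psi n u v.
  by split => -[n [u [v [c ->]]]]; exists n, u, v; rewrite S.
by apply: eq_bigr => i _; rewrite !E -opprD normrN.
Qed.

Lemma circle_varD (phi psi psi' : circle R -> R) B B' : var_le psi B -> var_le psi' B' ->
  (forall p, phi p = psi p + psi' p) -> circle_var phi <= circle_var psi + circle_var psi'.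
Proof.
move=> vB vB' E; apply: circle_var_le => n u v c.
apply: le_trans (lerD (le_circle_var vB c) (le_circle_var vB' c)).
rewrite /chain_sum -big_split/=; apply: ler_sum => i _.
by rewrite !E opprD addrACA ler_normD.
Qed.

Definition logD f p : R := ln (cD f p).

Lemma logDM f g p : logD (f * g)%g p = logD f (g p) + logD g p.
Proof. by rewrite /logD cD_comp ?lnM ?posrE ?cD_gt0//; exact: dmap_Ck. Qed.

(** Mathematically, the integral of |f''/f' - g''/g'| over the circle. *)
Definition logvar f g : R := circle_var (fun p => logD f p - logD g p).

Lemma logD_sub_var_le f g : exists2 B : R, 0 <= B & var_le (fun p => logD f p - logD g p) B.
Proof.
have [B B0 fB] := cD_var_le f; have [B' B'0 gB] := cD_var_le g.
have [m m0 hm] := cD_lbound f; have [m' m'0 hm'] := cD_lbound g.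
exists (m^-1 * B + m'^-1 * B').
  by rewrite addr_ge0// mulr_ge0// invr_ge0 ltW.
apply: var_le_comb fB gB; [by rewrite invr_ge0 ltW|by rewrite invr_ge0 ltW|].
move=> p q; have -> (a b c d : R) : a - b - (c - d) = (a - c) - (b - d) by ring.
apply: le_trans (ler_normB _ _) _; apply: lerD; exact: ler_dist_ln.
Qed.

Lemma logvar_pseudometric : pseudometric logvar.
Proof.
split.
- by move=> f; apply: circle_var0 => p; rewrite subrr.
- by move=> f g; have [B _ fgB] := logD_sub_var_le f g; exact: circle_var_ge0 fgB.
- by move=> f g; apply: circle_varN => p; rewrite opprB.
- move=> f g h; have [B _ fgB] := logD_sub_var_le f g.
  have [B' _ ghB] := logD_sub_var_le g h.
  by apply: circle_varD fgB ghB _ => p; rewrite addrA subrK.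
Qed.

Lemma logvar_right_invariant : right_invariant logvar.
Proof.
move=> f g h; rewrite /logvar -[RHS](circle_var_comp h); congr circle_var; apply/funext => p /=.
by rewrite !logDM opprD addrACA subrr addr0.
Qed.

(** For w = g'/f', log g' - log f' = ln w. Near [f], w is at least 1/2, where ln is 2-Lipschitz, and
    a quotient rule for differences bounds the variation of w. *)
Lemma logvar_le_AC_dist f : exists2 K : R, 0 < K & exists2 d : R, 0 < d &
  forall g, AC_dist f g < d -> logvar f g <= K * AC_dist f g.
Proof.
have [B B0 fB] := cD_var_le f; have [m m0 hm] := cD_lbound f.
(* With e the distance: Var(g' - f') <= 2e enters with 1/m, Var f' <= B with e/m^2, and ln doubles
   both; the last 1 is slack. *)
exists (4 / m + 2 * B / m ^+ 2 + 1).
  by rewrite ltr_wpDl// addr_ge0// divr_ge0// ?exprn_ge0 ?mulr_ge0// ltW.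
exists (m / 2); first exact: divr_gt0.
move=> g fg; set e := AC_dist f g in fg *.
have e0 : 0 <= e by rewrite /e /AC_dist; have [] := AC_dist_ge f g; lra.
have close p : `|cD g p - cD f p| <= e := cD_dist_le f g p.
pose w p := cD g p / cD f p.
have w_ge p : 2^-1 <= w p.
  rewrite ler_pdivlMr ?cD_gt0//; have := close p; rewrite ler_norml => /andP[+ _].
  by have := hm p; lra.
apply: (@le_trans _ _ ((2 / m) * (2 * e) + (2 * e / m ^+ 2) * B)); last first.
  rewrite (_ : _ + _ = (4 / m + 2 * B / m ^+ 2) * e); last by field; rewrite gt_eqF.
  by rewrite ler_wpM2r// lerDl.
apply: circle_var_le; apply: var_le_comb (cD_sub_var_le f g) fB.
- by rewrite divr_ge0// ltW.
- by rewrite divr_ge0 ?exprn_ge0 ?mulr_ge0// ltW.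
move=> p q.
have lw x : logD f x - logD g x = - ln (w x).
  by rewrite /logD /w ln_div ?posrE ?cD_gt0// opprB.
have [fp fq] : 0 < cD f p /\ 0 < cD f q by split; exact: cD_gt0.
have -> : logD f q - logD g q - (logD f p - logD g p) = ln (w p) - ln (w q).
  by rewrite !lw; ring.
apply: le_trans (ler_dist_ln _ (w_ge p) (w_ge q)) _; first by rewrite invr_gt0.
rewrite invrK.
have -> : w p - w q = - (((cD g q - cD f q) - (cD g p - cD f p)) / cD f q)
    + (cD g p - cD f p) / (cD f p * cD f q) * (cD f q - cD f p).
  by rewrite /w; field; rewrite !gt_eqF.
have {}e0 := e0.
apply: (@le_trans _ _ (2 * (m^-1 * `|cD g q - cD f q - (cD g p - cD f p)| +
    e / m ^+ 2 * `|cD f q - cD f p|))); last first.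
  by rewrite le_eqVlt; apply/orP; left; apply/eqP; field; rewrite gt_eqF.
rewrite ler_wpM2l// (le_trans (ler_normD _ _))// lerD//.
  rewrite normrN normrM mulrC ler_wpM2r// ger0_norm ?invr_ge0 ?(ltW fq)//.
  by rewrite lef_pV2 ?posrE.
rewrite normrM ler_wpM2r// normrM ler_pM//.
have fpq : 0 < cD f p * cD f q by exact: mulr_gt0.
rewrite ger0_norm; last by rewrite invr_ge0 ltW.
rewrite lef_pV2 ?posrE ?exprn_gt0//.
by rewrite expr2 ler_pM// ltW.
Qed.

Lemma logvar_continuous : continuous (fun x : ACdiff R * ACdiff R => logvar x.1 x.2).
Proof.
have [_ nn sym tri] := logvar_pseudometric.
have near_small f (e : R) : 0 < e -> \forall g \near f, logvar f g < e.
  move=> e0; exists [set g | logvar f g < e]; split => //=; last first.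
    by have [-> _ _ _] := logvar_pseudometric.
  move=> g /= fg; have [K K0 [d d0 H]] := logvar_le_AC_dist g.
  exists (Num.min d ((e - logvar f g) / K)).
    by rewrite lt_min d0 divr_gt0// subr_gt0.
  move=> h; rewrite lt_min => /andP[/H gh]; rewrite (ltr_pdivlMr _ _ K0) => hK.
  change (logvar f h < e).
  apply: le_lt_trans (tri f g h) _; rewrite -ltrBrDl.
  by apply: le_lt_trans gh _; rewrite mulrC.
move=> [f g]; apply/cvgrPdist_lt => e e0.
have e20 : 0 < e / 2 by exact: divr_gt0.
exists ([set f' | logvar f f' < e / 2], [set g' | logvar g g' < e / 2]).
  by split; exact: near_small.
move=> [f' g'] [ff' gg']; rewrite [ltRHS]splitr.
apply: le_lt_trans (pseudometric_dist_le f g f' g' logvar_pseudometric) _.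
exact (ltrD ff' gg').
Qed.

Lemma logvar_ri_cont : ri_cont_pseudometric logvar.
Proof.
split; [exact: logvar_pseudometric|exact: logvar_continuous|exact: logvar_right_invariant].
Qed.

End LogVariation.

(** * From C^k to 1 + AC *)

Section Forgetful.
Context {R : realType}.
Notation mu := (@lebesgue_measure R).

Lemma open_CkE k (U : set (Cdiff R k)) : open U <-> metric_open (@Ck_dist R k) U.
Proof.
rewrite openE; split => [UU f /UU[V [oV Vf VU]]|oU f Uf].
  by have [e e0 H] := oV _ Vf; exists e => // g /H /VU.
by exists U; split.
Qed.

Lemma open_ACE (U : set (ACdiff R)) : open U <-> metric_open (@AC_dist R) U.
Proof.
rewrite openE; split => [UU f /UU[V [oV Vf VU]]|oU f Uf].
  by have [e e0 H] := oV _ Vf; exists e => // g /H /VU.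
by exists U; split.
Qed.

Lemma Ck_le j k (F : R -> R) : (j <= k)%N -> Ck k F -> Ck j F.
Proof.
elim: k => [|k IH]; first by rewrite leqn0 => /eqP ->.
by rewrite leq_eqVlt => /predU1P[-> //|]; rewrite ltnS => jk /CkW; exact: IH.
Qed.

Section forget.
Variable k : nat.
Implicit Types f g : Cdiff R k.+2.

Definition forget1 f : Cdiff R 1 :=
  MkCdiff (dmapK f) (dinvK f) (increasing_Ck_mapW (dmap_Ck f)) (increasing_Ck_mapW (dinv_Ck f)).

Lemma cderive_C1 f : Ck 1 (cderive f 1).
Proof.
have [F [lF _ kF]] := dmap_Ck f; rewrite (cderive1E lF).
have k2 : Ck 2 F by exact: (Ck_le _ kF).
by have [_] := (CkS 1 F).1 k2.
Qed.

Definition forget f : ACdiff R :=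
  MkACdiff (acmap := forget1 f) (C1_abs_continuous (cderive_C1 f)).

Lemma forgetM : {morph forget : f g / (f * g)%g}.
Proof. by move=> f g; apply/ACdiff_inj/Cdiff_inj. Qed.

Lemma forget1g : forget 1%g = 1%g.
Proof. by apply/ACdiff_inj/Cdiff_inj. Qed.

Lemma forgetX f n : forget (f ^+ n)%g = (forget f ^+ n)%g.
Proof. by elim: n => [|n IH]; [exact: forget1g|rewrite !expgS forgetM IH]. Qed.

Lemma sup_dist_ge (h1 h2 : R -> R) x : continuous h1 -> continuous h2 -> 0 <= x <= 1 ->
  `|h1 x - h2 x| <= sup_dist h1 h2.
Proof.
move=> c1 c2 x01; apply: ub_le_sup; last by exists x => //; rewrite /= in_itv.
have [M M0 hM] := continuous_bounded 0 1 c1.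
have [N N0 hN] := continuous_bounded 0 1 c2.
exists (M + N) => _ [y y01 <-]; move: y01; rewrite /= in_itv/= => y01.
by apply: le_trans (ler_normB _ _) _; apply: lerD; [exact: hM|exact: hN].
Qed.

Lemma sup_dist_ge0 (h1 h2 : R -> R) : 0 <= sup_dist h1 h2.
Proof.
set A := [set `|h1 x - h2 x| | x in `[0, 1]].
have [[[x Ax] uA]|nA] := pselect (has_sup A); last by rewrite /sup_dist sup_out.
by case: (Ax) => y _ yx; apply: le_trans (ub_le_sup uA Ax); rewrite -yx.
Qed.

(** The circle has length 1, so the integral of |f'' - g''| is at most the supremum, the
    second-order term of [Ck_dist]. *)
Lemma forget_dist f g : AC_dist (forget f) (forget g) <= Ck_dist f g.
Proof.
rewrite /AC_dist /Ck_dist -addrA lerD2l big_ltn// lerD2l big_ltn//.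
have c2 (h : Cdiff R k.+2) : continuous (cderive h 2).
  by have /CkS[_ /Ck0] := cderive_C1 h.
apply: (@le_trans _ _ (sup_dist (cderive f 2) (cderive g 2))); last first.
  by rewrite lerDl sumr_ge0// => i _; exact: sup_dist_ge0.
set S := sup_dist _ _.
have cn : continuous (fun x => `|cderive f 2 x - cderive g 2 x|).
  by move=> x; apply: cvg_norm; apply: cvgB; exact: c2.
have -> : S = (\int[mu]_(x in `[0%R, 1%R]) S)%R.
  rewrite Rintegral_cst//= lebesgue_measure_itv/= lte_fin ltr01 -EFinD subr0/=.
  by rewrite mulr1.
apply: le_Rintegral => //.
- apply: continuous_compact_integrable; first exact: segment_compact.
  exact: continuous_subspaceT.
- apply: continuous_compact_integrable; first exact: segment_compact.
  by apply: continuous_subspaceT => x; exact: cvg_cst.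
- by move=> x; rewrite /= in_itv/= => x01; exact: (sup_dist_ge (c2 f) (c2 g) x01).
Qed.

Lemma forget_continuous : continuous forget.
Proof.
apply/continuousP => U /open_ACE oU; apply/open_CkE => f /oU[e e0 H].
by exists e => // g fg; apply: H; exact: le_lt_trans (forget_dist f g) fg.
Qed.

End forget.

End Forgetful.

(** * C^k functions on the line and diffeomorphisms given by their lifts *)

Section CkFunctions.
Context {R : realType}.
Implicit Types (F G h : R -> R) (k : nat).

Lemma derive1_cst_fun (c : R) : (fun _ : R => c)^`() = fun=> 0.
Proof. by apply/funext => x; rewrite derive1_cst. Qed.

Lemma Ck_cst k (c : R) : Ck k (fun _ : R => c).
Proof.
elim: k c => [|k IH] c; first by apply/Ck0 => x; exact: cvg_cst.
by apply/CkS; split; [move=> x; exact: derivable_cst|rewrite derive1_cst_fun].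
Qed.

Lemma CkZ k (c : R) F : Ck k F -> Ck k (fun x => c * F x).
Proof. by move=> kF; exact: CkM (Ck_cst k c) kF. Qed.

Lemma CkB k F G : Ck k F -> Ck k G -> Ck k (fun x => F x - G x).
Proof.
move=> kF kG; rewrite (_ : (fun x => _) = F \+ (fun x => - 1 * G x)).
  by apply: CkD => //; exact: CkZ.
by apply/funext => x /=; rewrite mulN1r.
Qed.

Lemma derive1_inv h : (forall x, h x != 0) -> (forall x, derivable h x 1) ->
  (fun x => (h x)^-1)^`() = (fun x => - 1 * derive1 h x) \* ((fun x => (h x)^-1) \* (fun x => (h x)^-1)).
Proof.
move=> h0 dh; apply/funext => x; rewrite derive1E /=.
rewrite (deriveV (h0 x) (dh x)) -derive1E scaleNr mulN1r mulNr; congr (- _).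
by rewrite -invfM -expr2 mulrC.
Qed.

Lemma derivable_inv h x : (forall x, h x != 0) -> derivable h x 1 ->
  derivable (fun x => (h x)^-1) x 1.
Proof. by move=> h0 dh; exact: derivableV. Qed.

Lemma CkV k h : (forall x, h x != 0) -> Ck k h -> Ck k (fun x => (h x)^-1).
Proof.
move=> h0; elim: k => [/Ck0 ch|k IH kh]; first by apply/Ck0 => x; apply: cvgV (h0 x) (ch x).
have /CkS[dh kh'] := kh; apply/CkS; split.
  by move=> x; exact: derivable_inv.
rewrite (derive1_inv h0 dh); have ih := IH (CkW kh).
by apply: CkM; [exact: CkZ|exact: CkM].
Qed.

Lemma Ck_ext k F G : F =1 G -> Ck k F -> Ck k G.
Proof. by move=> /funext ->. Qed.

Lemma derive1_pos_increasing F : (forall x, derivable F x 1) -> (forall x, 0 < F^`() x) ->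
  {homo F : x y / x < y}.
Proof.
move=> dF F0 x y xy; rewrite -subr_gt0.
have [] := @MVT R F (F^`()) x y xy.
- by move=> z _; rewrite derive1E; exact/derivableP.
- by apply: continuous_subspaceT; exact: derivable_cont.
by move=> c _ ->; rewrite mulr_gt0// subr_gt0.
Qed.

Lemma lift_addz F n x : (forall x, F (x + 1) = F x + 1) -> F (x + n%:~R) = F x + n%:~R.
Proof.
move=> F1; have Fn m y : F (y + m%:R) = F y + m%:R.
  by elim: m y => [|m IH] y; rewrite ?addr0// -natr1 !addrA F1 IH.
case: n => m; first exact: Fn.
rewrite NegzE mulrNz; apply: (addIr (m.+1%:~R : R)).
by rewrite -addrA addNr addr0 -Fn subrK.
Qed.

Lemma lift_surjective F y : continuous F -> (forall x, F (x + 1) = F x + 1) ->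
  exists x, F x = y.
Proof.
move=> cF F1; pose n := Num.floor (y - F 0).
have Fn m : F m%:~R = F 0 + m%:~R by rewrite -[LHS](congr1 F (add0r _)) lift_addz.
have [le lt] : F n%:~R <= y /\ y <= F (n + 1)%:~R.
  by rewrite !Fn; have /andP[] := floor_itv (y - F 0); rewrite -/n; split; lra.
have [] := @IVT R F n%:~R (n + 1)%:~R y.
- by rewrite ler_int lerDl.
- exact: continuous_subspaceT.
- by have le2 := le_trans le lt; rewrite (min_idPl le2) (max_idPr le2) le.
by move=> c _ <-; exists c.
Qed.

Definition circle_map F (p : circle R) : circle R := to_circle (F (repr p)).

Lemma is_lift_circle_map F : continuous F -> (forall x, F (x + 1) = F x + 1) ->
  is_lift F (circle_map F).
Proof.
move=> cF F1; split => // x; rewrite /circle_map.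
have /to_circle_int[n ->] : to_circle (repr (to_circle x)) = to_circle x.
  by rewrite /to_circle reprK.
by rewrite lift_addz// to_circleD.
Qed.

(** Bootstrap on G' = 1 / (F' o G): if G is C^j with j <= k, then so is G', and G is C^{j+1}. *)
Lemma Ck_inverse k F G : Ck k.+1 F -> (forall x, 0 < F^`() x) -> cancel G F ->
  Ck k.+1 G.
Proof.
move=> kF F0 GK; have /CkS[dF kF'] := kF.
have iF := derive1_pos_increasing dF F0.
have injF : injective F by exact: inc_inj (le_mono iF).
have FK : cancel F G by move=> x; apply: injF; rewrite GK.
have dG (y : R) : is_derive y (1 : R) G (derive1 F (G y))^-1.
  rewrite -{1}(GK y); apply: (@is_derive_inverse _ F).
  - by near=> z; exact: FK.
  - by near=> z; exact: derivable_cont.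
  - by rewrite derive1E; exact/derivableP.
  - by rewrite gt_eqF.
have derG (y : R) : derivable G y 1 by have [] := dG y.
have G'E : G^`() = fun y => (derive1 F (G y))^-1.
  by apply/funext => y; rewrite derive1E; have [_ ->] := dG y.
suff : forall j, (j <= k.+1)%N -> Ck j G by apply.
elim=> [_|j IH jk]; first by apply/Ck0; exact: derivable_cont.
apply/CkS; split; [exact: derG|rewrite G'E; apply: CkV].
  by move=> y; rewrite gt_eqF.
apply: (@Ck_comp R j (F^`()) G); first exact: Ck_le kF'.
by apply: IH; exact: ltnW.
Unshelve. all: by end_near. Qed.

Lemma diffeo_of_lift k F : Ck k.+1 F -> (forall x, 0 < F^`() x) ->
  (forall x, F (x + 1) = F x + 1) -> exists f : Cdiff R k.+1, is_lift F f.
Proof.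
move=> kF F0 F1; have cF := Ck_cont kF; have /CkS[dF _] := kF.
have iF := derive1_pos_increasing dF F0.
have [G GK] := choice (fun y => lift_surjective y cF F1).
have kG := Ck_inverse kF F0 GK; have cG := Ck_cont kG.
have mF : {mono F : x y / x < y} by exact: leW_mono (le_mono iF).
have injF : injective F by exact: inc_inj (le_mono iF).
have FK : cancel F G by move=> x; apply: injF; rewrite GK.
have iG : {homo G : x y / x < y} by move=> x y xy; rewrite -mF !GK.
have G1 x : G (x + 1) = G x + 1 by apply: injF; rewrite F1 !GK.
have [_ lF] := is_lift_circle_map cF F1; have [_ lG] := is_lift_circle_map cG G1.
have FGK : cancel (circle_map F) (circle_map G).
  by move=> p; have [x <-] := to_circle_surj p; rewrite -lF -lG FK.
have GFK : cancel (circle_map G) (circle_map F).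
  by move=> p; have [x <-] := to_circle_surj p; rewrite -lG -lF GK.
have cdF : increasing_Ck_map k.+1 (circle_map F).
  by exists F; split => //; exact: is_lift_circle_map.
have cdG : increasing_Ck_map k.+1 (circle_map G).
  by exists G; split => //; exact: is_lift_circle_map.
by exists (MkCdiff FGK GFK cdF cdG); exact: is_lift_circle_map.
Qed.

Definition cos2pi (x : R) : R := cos (2 * pi * x).
Definition sin2pi (x : R) : R := sin (2 * pi * x).

Lemma is_derive_cos2pi (x : R) : is_derive x (1 : R) cos2pi (- (2 * pi) * sin2pi x).
Proof.
have d : is_derive x (1 : R) (fun y : R => 2 * pi * y) (2 * pi).
  by apply: is_derive_eq; rewrite /GRing.scale /= ?mulr0 ?addr0 mulr1.
have := is_derive1_comp (is_derive_cos (2 * pi * x)) d.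
by congr (is_derive _ _ _ _); rewrite /sin2pi; ring.
Qed.

Lemma is_derive_sin2pi (x : R) : is_derive x (1 : R) sin2pi (2 * pi * cos2pi x).
Proof.
have d : is_derive x (1 : R) (fun y : R => 2 * pi * y) (2 * pi).
  by apply: is_derive_eq; rewrite /GRing.scale /= ?mulr0 ?addr0 mulr1.
have := is_derive1_comp (is_derive_sin (2 * pi * x)) d.
by congr (is_derive _ _ _ _); rewrite /cos2pi; ring.
Qed.

Lemma derive1_cos2pi : cos2pi^`() = fun x => - (2 * pi) * sin2pi x.
Proof. by apply/funext => x; rewrite derive1E; have [_ ->] := is_derive_cos2pi x. Qed.

Lemma derive1_sin2pi : sin2pi^`() = fun x => 2 * pi * cos2pi x.
Proof. by apply/funext => x; rewrite derive1E; have [_ ->] := is_derive_sin2pi x. Qed.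

Lemma Ck_cos2pi_sin2pi k : Ck k cos2pi /\ Ck k sin2pi.
Proof.
have dc (x : R) : derivable cos2pi x 1 by have [] := is_derive_cos2pi x.
have ds (x : R) : derivable sin2pi x 1 by have [] := is_derive_sin2pi x.
elim: k => [|k [IHc IHs]].
  by split; apply/Ck0; [exact: derivable_cont dc|exact: derivable_cont ds].
split; apply/CkS; split; [exact: dc| |exact: ds|].
  by rewrite derive1_cos2pi; exact: CkZ.
by rewrite derive1_sin2pi; exact: CkZ.
Qed.

Lemma cos2piDsin2pi x : cos2pi x ^+ 2 + sin2pi x ^+ 2 = 1.
Proof. exact: cos2Dsin2. Qed.

Lemma cos2piD1 x : cos2pi (x + 1) = cos2pi x.
Proof. by rewrite /cos2pi mulrDr mulr1 mulr_natl cosD2pi. Qed.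

Lemma sin2piD1 x : sin2pi (x + 1) = sin2pi x.
Proof. by rewrite /sin2pi mulrDr mulr1 mulr_natl sinD2pi. Qed.

End CkFunctions.

(** * The action of SL_2(R) on rays *)

Section CircleCoordinates.
Context {R : realType}.
Implicit Types (p q : circle R).

Lemma periodic_addz (h : R -> R) (n : int) x : (forall y, h (y + 1) = h y) ->
  h (x + n%:~R) = h x.
Proof.
move=> h1; have H i y : h (y + i%:R) = h y.
  by elim: i y => [|i IH] y; rewrite ?addr0// -natr1 addrA h1 IH.
case: n => i; first exact: H.
by rewrite NegzE mulrNz -(H i.+1) subrK.
Qed.

Lemma cos2piDz (x : R) (n : int) : cos2pi (x + n%:~R) = cos2pi x.
Proof. by apply: periodic_addz => y; exact: cos2piD1. Qed.

Lemma sin2piDz (x : R) (n : int) : sin2pi (x + n%:~R) = sin2pi x.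
Proof. by apply: periodic_addz => y; exact: sin2piD1. Qed.

(* [ccos p, csin p] is the unit vector on the ray that corresponds to [p]. *)
Definition ccos p : R := cos2pi (repr p).
Definition csin p : R := sin2pi (repr p).

Lemma ccos_to x : ccos (to_circle x) = cos2pi x.
Proof.
rewrite /ccos; have /to_circle_int[n ->] : to_circle (repr (to_circle x)) = to_circle x.
  by rewrite /to_circle reprK.
exact: cos2piDz.
Qed.

Lemma csin_to x : csin (to_circle x) = sin2pi x.
Proof.
rewrite /csin; have /to_circle_int[n ->] : to_circle (repr (to_circle x)) = to_circle x.
  by rewrite /to_circle reprK.
exact: sin2piDz.
Qed.

Lemma ccos2Dcsin2 p : ccos p ^+ 2 + csin p ^+ 2 = 1.
Proof. exact: cos2piDsin2pi. Qed.

(** The hypotheses give cos(2 pi (x - y)) = 1. If the fractional part t of x - y were nonzero,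
    sin(pi t) > 0 would contradict cos(2 pi t) = 1 - 2 sin(pi t)^2. *)
Lemma circle_eq p q : ccos p = ccos q -> csin p = csin q -> p = q.
Proof.
have [x <-] := to_circle_surj p; have [y <-] := to_circle_surj q.
rewrite !ccos_to !csin_to => Ec Es.
have c1 : cos2pi (x - y) = 1.
  by rewrite /cos2pi mulrBr cosB -/(cos2pi x) -/(cos2pi y) -/(sin2pi x) -/(sin2pi y) Ec Es
    -!expr2 cos2piDsin2pi.
pose n := Num.floor (x - y); pose t := x - y - n%:~R.
have t01 : 0 <= t < 1.
  by have /andP[] := floor_itv (x - y); rewrite -/n intrD /t; lra.
have ct : cos2pi t = 1 by rewrite /t -mulrNz cos2piDz.
have [t0|tN0] := eqVneq t 0.
  apply/to_circleP; rewrite (_ : x - y = n%:~R) ?intr_int//.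
  by move: t0; rewrite /t; lra.
have t_gt0 : 0 < t by rewrite lt_neqAle eq_sym tN0; have /andP[] := t01.
have s0 : 0 < sin (pi * t).
  apply: sin_gt0_pi; rewrite mulr_gt0 ?pi_gt0//= gtr_pMr ?pi_gt0//.
  by have /andP[] := t01.
move: ct; rewrite /cos2pi (_ : 2 * pi * t = pi * t + pi * t); last by ring.
rewrite cosD => ct; exfalso; have cs := cos2Dsin2 (pi * t); nra.
Qed.

(** Both points are the direction of the vector (c, s), whose norm forces r = r'. Images under
    matrices are compared in this form, their lengths being left implicit. *)
Lemma circle_eq_ray p q (r r' c s : R) : 0 < r -> 0 < r' ->
  ccos p * r = c -> csin p * r = s -> ccos q * r' = c -> csin q * r' = s -> p = q.
Proof.
move=> r0 r'0 pc ps qc qs; have := ccos2Dcsin2 p; have := ccos2Dcsin2 q.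
move=> q2 p2.
have rr : r = r'.
  have : r ^+ 2 = r' ^+ 2.
    transitivity (c ^+ 2 + s ^+ 2).
      by rewrite -pc -ps !exprMn -mulrDl p2 mul1r.
    by rewrite -qc -qs !exprMn -mulrDl q2 mul1r.
  by move/eqP; rewrite eqrXn2// ?ltW// => /eqP.
by apply: circle_eq; apply: (mulIf (lt0r_neq0 r0)); rewrite {2}rr ?pc ?ps ?qc ?qs.
Qed.

End CircleCoordinates.

Section Moebius.
Context {R : realType}.
Implicit Types (p q : circle R) (x : R).

Section one_matrix.
Variables a b e d : R.
Hypotheses (a0 : 0 < a) (d0 : 0 < d) (det1 : a * d - b * e = 1)
  (be : (b + e) ^+ 2 < 4 * (a * d)).

Definition mv1 x := a * cos2pi x + b * sin2pi x.
Definition mv2 x := e * cos2pi x + d * sin2pi x.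
(** For the unit vector v = (cos, sin), this is v.Av and [mwedge] is det(v, Av): |Av| times the
    cosine and the sine of the angle from v to Av. *)
Definition mdot x :=
  a * (cos2pi x * cos2pi x) + (b + e) * (cos2pi x * sin2pi x) + d * (sin2pi x * sin2pi x).
Definition mwedge x :=
  e * (cos2pi x * cos2pi x) + (d - a) * (cos2pi x * sin2pi x) - b * (sin2pi x * sin2pi x).
Definition mnorm2 x := mv1 x ^+ 2 + mv2 x ^+ 2.

(* The angle from v to Av lies in ]-pi/2, pi/2[ as v.Av > 0, whence atan. *)
Definition mlift x := x + (2 * pi)^-1 * atan (mwedge x / mdot x).

(** The condition [be] says that the symmetric part of the matrix is positive definite; after
    multiplication by 4a the square is completed. *)
Lemma mdot_gt0 x : 0 < mdot x.
Proof.
have := cos2piDsin2pi x; rewrite /mdot; set c := cos2pi x; set s := sin2pi x => cs.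
have [s0|sN0] := eqVneq s 0.
  by move: cs; rewrite s0 expr0n /= addr0 !mulr0 !addr0 -expr2 => ->; rewrite mulr1.
have s2 : 0 < s ^+ 2 by rewrite exprn_even_gt0.
have : 0 < 4 * a * (a * (c * c) + (b + e) * (c * s) + d * (s * s)).
  rewrite (_ : 4 * a * _ = (2 * a * c + (b + e) * s) ^+ 2 +
    (4 * (a * d) - (b + e) ^+ 2) * s ^+ 2); last by ring.
  by rewrite ltr_wpDl ?sqr_ge0// mulr_gt0// subr_gt0.
by rewrite pmulr_rgt0// mulr_gt0.
Qed.

Lemma mnorm2E x : mnorm2 x = mdot x ^+ 2 + mwedge x ^+ 2.
Proof.
have := cos2piDsin2pi x; rewrite /mnorm2 /mdot /mwedge /mv1 /mv2.
set c := cos2pi x; set s := sin2pi x => cs.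
rewrite -[LHS]mulr1 -cs; ring.
Qed.

Lemma mnorm2_gt0 x : 0 < mnorm2 x.
Proof. by rewrite mnorm2E ltr_wpDr ?sqr_ge0// exprn_gt0// mdot_gt0. Qed.

Lemma mlift_dir x : exists r, [/\ 0 < r, cos2pi (mlift x) * r = mv1 x & sin2pi (mlift x) * r = mv2 x].
Proof.
pose al := atan (mwedge x / mdot x).
have p0 := mdot_gt0 x.
have ca : 0 < cos al.
  by rewrite cos_gt0_pihalf// /al atan_gtNpi2 atan_ltpi2.
have sa : sin al = mwedge x / mdot x * cos al.
  by rewrite -[X in X * _](atanK (mwedge x / mdot x)) -/al /tan divfK// gt_eqF.
pose r := mdot x / cos al.
have cr : cos al * r = mdot x by rewrite /r mulrC divfK// gt_eqF.
have sr : sin al * r = mwedge x.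
  by rewrite sa -mulrA cr divfK// gt_eqF.
have angE : 2 * pi * mlift x = 2 * pi * x + al.
  by rewrite /mlift mulrDr mulrA mulfV ?mul1r// mulf_neq0 ?gt_eqF ?pi_gt0.
have cs := cos2piDsin2pi x; exists r; split; first exact: divr_gt0.
- rewrite /cos2pi angE cosD -/(cos2pi x) -/(sin2pi x) mulrBl -!mulrA cr sr.
  move: cs; rewrite /mdot /mwedge /mv1; set c := cos2pi x; set s := sin2pi x => cs.
  by rewrite -[RHS]mulr1 -cs; ring.
- rewrite /sin2pi angE sinD -/(cos2pi x) -/(sin2pi x) mulrDl -!mulrA cr sr.
  move: cs; rewrite /mdot /mwedge /mv2; set c := cos2pi x; set s := sin2pi x => cs.
  by rewrite -[RHS]mulr1 -cs; ring.
Qed.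

End one_matrix.
End Moebius.

Section MoebiusDerivative.
Context {R : realType}.
Implicit Types (x : R).

Lemma is_derive_quadratic (al be ga x : R) :
  is_derive x (1 : R) (fun y : R =>
     al * (cos2pi y * cos2pi y) + be * (cos2pi y * sin2pi y) + ga * (sin2pi y * sin2pi y))
   (2 * pi * (be * (cos2pi x * cos2pi x - sin2pi x * sin2pi x) + 2 * (ga - al) * (cos2pi x * sin2pi x))).
Proof.
have dc := is_derive_cos2pi x; have ds := is_derive_sin2pi x.
apply: is_derive_eq; rewrite /GRing.scale /=.
ring.
Qed.

Section one_matrix.
Variables a b e d : R.
Hypotheses (a0 : 0 < a) (det1 : a * d - b * e = 1)
  (be : (b + e) ^+ 2 < 4 * (a * d)).

Lemma is_derive_mlift x : is_derive x (1 : R) (mlift a b e d) (mnorm2 a b e d x)^-1.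
Proof.
have P0 := mdot_gt0 a0 be x; have Q0 := mnorm2_gt0 a0 be x.
have cs := cos2piDsin2pi x.
have QE := mnorm2E a b e d x.
have dP : is_derive x (1 : R) (mdot a b e d) _ := is_derive_quadratic a (b + e) d x.
have dW := is_derive_quadratic e (d - a) (- b) x.
rewrite (_ : (fun y : R => _) = mwedge a b e d) in dW; last first.
  by apply/funext => y; rewrite /mwedge mulNr.
set P' := (X in is_derive _ _ (mdot _ _ _ _) X) in dP.
set W' := (X in is_derive _ _ (mwedge _ _ _ _) X) in dW.
(* The angle atan(W / P) has derivative (W' P - W P') / (P^2 + W^2), so this says that it equals 2
   pi (1 / |Av|^2 - 1), whose -1 cancels the derivative of x. The right-hand side is made
   homogeneous by det A = 1 and cos^2 + sin^2 = 1 for [ring]. *)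
have key : W' * mdot a b e d x - mwedge a b e d x * P' = 2 * pi * (1 - mnorm2 a b e d x).
  rewrite -[RHS](_ : 2 * pi * ((a * d - b * e) * (cos2pi x ^+ 2 + sin2pi x ^+ 2) ^+ 2 -
    mnorm2 a b e d x * (cos2pi x ^+ 2 + sin2pi x ^+ 2)) = _); last first.
    by rewrite det1 cs expr1n !mulr1.
  by rewrite /W' /P' /mdot /mwedge /mnorm2 /mv1 /mv2; ring.
have PN0 : mdot a b e d x != 0 by rewrite gt_eqF.
have dq := is_deriveM dW (is_deriveV PN0 dP).
have dat := is_derive1_comp (is_derive1_atan _) dq.
have dM := is_deriveD (is_derive_id x (1 : R)) (is_deriveZ (2 * pi)^-1 dat).
apply: (@is_derive_eq _ _ _ _ _ _ _ _ dM).
move: key QE PN0 Q0; rewrite /GRing.scale /=.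
set P := mdot _ _ _ _ _; set W := mwedge _ _ _ _ _; set Q := mnorm2 _ _ _ _ _.
move=> key QE PN0 Q0.
have pi0 : 2 * pi != 0 :> R by rewrite mulf_neq0// gt_eqF// pi_gt0.
have PW0 : P ^+ 2 + W ^+ 2 != 0 by rewrite -QE gt_eqF.
transitivity (1 + (2 * pi)^-1 * ((W' * P - W * P') / (P ^+ 2 + W ^+ 2))).
  congr (_ + _ * _).
  change ((1 + (W / P) ^+ 2)^-1 * (W * (- P ^- 2 * P') + P^-1 * W') =
    (W' * P - W * P') / (P ^+ 2 + W ^+ 2)).
  by field; rewrite PN0 PW0.
rewrite key -QE mulrA mulKf// mulrBl mul1r mulfV ?gt_eqF//; ring.
Qed.

Lemma mlift_diffeo k : exists2 f : Cdiff R k.+1, is_lift (mlift a b e d) f &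
  forall x, derive1 (mlift a b e d) x = (mnorm2 a b e d x)^-1.
Proof.
have dM x := is_derive_mlift x.
have dM1 x : derive1 (mlift a b e d) x = (mnorm2 a b e d x)^-1.
  by rewrite derive1E; have [_ ->] := dM x.
have Q0 x : mnorm2 a b e d x != 0 by rewrite gt_eqF// (mnorm2_gt0 a0 be).
have [kc ks] := @Ck_cos2pi_sin2pi R k.
have kM : Ck k.+1 (mlift a b e d).
  apply/CkS; split; first by move=> x; have [] := dM x.
  rewrite (_ : derive1 _ = fun x => (mnorm2 a b e d x)^-1); last exact/funext.
  apply: CkV => //; apply: (@Ck_ext _ _ ((mv1 a b \* mv1 a b) \+ (mv2 e d \* mv2 e d))).
    by move=> x; rewrite /= -!expr2.
  have k1 : Ck k (mv1 a b) by apply: CkD; exact: CkZ.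
  have k2 : Ck k (mv2 e d) by apply: CkD; exact: CkZ.
  by apply: CkD; exact: CkM.
have M0 x : 0 < derive1 (mlift a b e d) x.
  by rewrite dM1 invr_gt0 (mnorm2_gt0 a0 be).
have [|f lf] := diffeo_of_lift kM M0; last by exists f.
move=> x; rewrite /mlift addrAC; congr (_ + _ * atan (_ / _) + _).
  by rewrite /mwedge cos2piD1 sin2piD1.
by rewrite /mdot cos2piD1 sin2piD1.
Qed.

End one_matrix.
End MoebiusDerivative.

Section Actions.
Context {R : realType}.
Implicit Types (p q : circle R) (x : R).

(* [f] is the action of the matrix [[a, b], [e, d]] of determinant 1 on rays, whose
   derivative at the ray of a unit vector v is |Av|^-2. *)
Definition acts_by (f : circle R -> circle R) (a b e d : R) : Prop := forall p,
  (exists r, [/\ 0 < r, ccos (f p) * r = a * ccos p + b * csin p &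
     csin (f p) * r = e * ccos p + d * csin p]) /\
  cD f p = ((a * ccos p + b * csin p) ^+ 2 + (e * ccos p + d * csin p) ^+ 2)^-1.

Lemma mlift_acts_by (f : circle R -> circle R) a b e d : 0 < a -> a * d - b * e = 1 ->
  (b + e) ^+ 2 < 4 * (a * d) -> is_lift (mlift a b e d) f -> acts_by f a b e d.
Proof.
move=> a0 det1 be lf p; have [x <-] := to_circle_surj p; have [_ E] := lf.
rewrite -E !ccos_to !csin_to; split; first exact: mlift_dir.
rewrite (cD_lift _ lf) derive1E.
by have [_ ->] := is_derive_mlift a0 det1 be x.
Qed.

Lemma is_derive_half_shift (x : R) : is_derive x (1 : R) (fun y : R => y + 2^-1) 1.
Proof.
by have := is_deriveD (is_derive_id x (1 : R)) (is_derive_cst (2^-1 : R) x (1 : R)); rewrite addr0.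
Qed.

Lemma half_rotation k : exists f : Cdiff R k.+1, forall p,
  [/\ ccos (f p) = - ccos p, csin (f p) = - csin p & cD f p = 1].
Proof.
have d1 : (fun y : R => y + 2^-1)^`() = fun=> 1.
  by apply/funext => x; rewrite derive1E; have [_ ->] := is_derive_half_shift x.
have kF : Ck k.+1 (fun y : R => y + 2^-1).
  apply/CkS; split; first by move=> x; have [] := is_derive_half_shift x.
  by rewrite d1; exact: Ck_cst.
have [||f lf] := diffeo_of_lift kF.
- by move=> x; rewrite d1.
- by move=> x; rewrite addrAC.
exists f => p; have [x <-] := to_circle_surj p; have [_ E] := lf.
have e2 : 2 * pi * (x + 2^-1) = 2 * pi * x + pi by field.
rewrite -E !ccos_to !csin_to (cD_lift _ lf) d1; split => //.
  by rewrite /cos2pi e2 cosDpi.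
by rewrite /sin2pi e2 sinDpi.
Qed.

Section elliptic.
Variables (al s : R) (f : circle R -> circle R).
Hypotheses (sal : 0 < sin al) (sE : s = 2 - 2 * cos al) (fP : acts_by f 1 (- 1) s (1 - s)).

Lemma elliptic_iter j p : exists r, [/\ 0 < r,
  ccos (iter j f p) * r = sin (j%:R * al) * (ccos p - csin p) - sin (j%:R * al - al) * ccos p &
  csin (iter j f p) * r = sin (j%:R * al) * (s * ccos p + (1 - s) * csin p)
    - sin (j%:R * al - al) * csin p].
Proof.
elim: j => [|j [r [r0 IHc IHs]]].
  exists (sin al); rewrite mul0r sin0 !mul0r !sub0r sinN !mulNr !opprK.
  by split => //; rewrite mulrC.
have [[r' [r'0 fc fs]] _] := fP (iter j f p).
exists (r' * r); rewrite iterS; split; first exact: mulr_gt0.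
  rewrite mulrA fc mul1r mulN1r mulrBl IHc IHs.
  have -> : j.+1%:R * al - al = j%:R * al by rewrite -natr1; ring.
  have -> : sin (j.+1%:R * al) = 2 * cos al * sin (j%:R * al) - sin (j%:R * al - al).
    by rewrite -natr1 mulrDl mul1r sinD sinB; ring.
  have -> : 2 * cos al = 2 - s by rewrite sE; ring.
  ring.
rewrite mulrA fs mulrDl -!mulrA IHc IHs.
have -> : j.+1%:R * al - al = j%:R * al by rewrite -natr1; ring.
have -> : sin (j.+1%:R * al) = 2 * cos al * sin (j%:R * al) - sin (j%:R * al - al).
  by rewrite -natr1 mulrDl mul1r sinD sinB; ring.
have -> : 2 * cos al = 2 - s by rewrite sE; ring.
ring.
Qed.

(** At n al = pi the formula of [elliptic_iter] reduces to A^n = -I. *)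
Lemma elliptic_half_turn n (h : circle R -> circle R) p : n%:R * al = pi ->
  ccos (h p) = - ccos p -> csin (h p) = - csin p -> iter n f p = h p.
Proof.
move=> nal hc hs; have [r [r0 fc fs]] := elliptic_iter n p.
move: fc fs; rewrite nal sinpi !mul0r !sub0r sinB cospi sinpi mul0r mulN1r sub0r opprK => fc fs.
apply: (circle_eq_ray r0 sal fc fs).
  by rewrite hc mulNr mulrC.
by rewrite hs mulNr mulrC.
Qed.

(** For p on the ray of (x, y), the first coordinate of sin(al) A^j (x, y) is sin(j al) (x - y) -
    sin((j - 1) al) x. Both angles lie in [0, pi], so this is nonpositive when 0 < x < y. *)
Lemma elliptic_leaves_cone n j p : n%:R * al = pi -> (0 < j <= n)%N ->
  0 < ccos p < csin p -> ccos (iter j f p) <= 0.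
Proof.
move=> nal /andP[j0 jn] /andP[c0 cs]; have [r [r0 fc _]] := elliptic_iter j p.
have al0 : 0 <= al.
  have : 0 <= n%:R * al by rewrite nal pi_ge0.
  by rewrite pmulr_rge0// ltr0n (leq_trans j0).
have sin_ge (i : nat) : (i <= n)%N -> 0 <= sin (i%:R * al).
  move=> i_n; apply: sin_ge0_pi; rewrite mulr_ge0//= -nal ler_wpM2r// ler_nat//.
have s1 := sin_ge j jn.
have s2 : 0 <= sin (j%:R * al - al).
  have -> : j%:R * al - al = j.-1%:R * al.
    by rewrite -[in LHS](prednK j0) -natr1; ring.
  by apply: sin_ge; exact: leq_trans (leq_pred _) jn.
rewrite -(pmulr_lle0 _ r0) fc.
have : 0 <= sin (j%:R * al) * (csin p - ccos p) by rewrite mulr_ge0// subr_ge0 ltW.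
have : 0 <= sin (j%:R * al - al) * ccos p by rewrite mulr_ge0// ltW.
by lra.
Qed.

End elliptic.

End Actions.

(** * Torsion twists of elliptic elements *)

Section ConjugateProduct.
Variables (G : groupTopType) (g t : G).
Local Open Scope group_scope.

Definition shifted (j : nat) : G := g ^+ j * t * g ^- j.

Fixpoint shifted_prod (m : nat) : G :=
  if m is m'.+1 then shifted_prod m' * shifted m else 1.

Lemma shiftedS j : g * shifted j * g^-1 = shifted j.+1.
Proof. by rewrite /shifted expgS invgM !mulgA. Qed.

Lemma shifted_prod_conj m : shifted 1 * (g * shifted_prod m * g^-1) = shifted_prod m.+1.
Proof.
elim: m => [|m IH]; first by rewrite /= mulg1 mulgV mulg1 mul1g.
have Pr j : shifted_prod j.+1 = shifted_prod j * shifted j.+1 by [].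
rewrite (Pr m.+1) [in LHS](Pr m) -IH -(shiftedS m.+1).
by move: (shifted 1) (shifted_prod m) (shifted m.+1) => x y z; rewrite !mulgA mulgVK.
Qed.

(** Write s_j for [shifted j] and P = s_1 ... s_n. Conjugation by g shifts indices, so g P g^-1 =
    s_1^-1 P s_{n+1}. As s_1 commutes with P, P^-1 g P = s_1^-1 s_{n+1} g, and this is g t^-1
    s_n. *)
Lemma twisted_product_conj n :
  (forall i, (i < n)%N -> t * shifted i = shifted i * t) ->
  g * t^-1 * shifted n = (shifted_prod n)^-1 * g * shifted_prod n.
Proof.
move=> ct.
have c1 j : (j < n)%N -> shifted 1 * shifted j.+1 = shifted j.+1 * shifted 1.
  move=> jn; rewrite -(shiftedS j) -(shiftedS 0).
  have -> : shifted 0 = t by rewrite /shifted expg0 invg1 mulg1 mul1g.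
  have := congr1 (fun x => g * x * g^-1) (ct j jn).
  by move: (shifted j) => x; rewrite !mulgA !mulgVK.
have cH m : (m <= n)%N -> shifted 1 * shifted_prod m = shifted_prod m * shifted 1.
  elim: m => [|m IH] mn; first by rewrite mulg1 mul1g.
  by rewrite /= mulgA IH 1?ltnW// -mulgA c1// mulgA.
have E : g * shifted_prod n = (shifted 1)^-1 * shifted_prod n * shifted n.+1 * g.
  apply: (mulgI (shifted 1)); apply: (mulIg g^-1).
  have := shifted_prod_conj n; rewrite [shifted_prod n.+1]/=.
  move: (shifted 1) (shifted_prod n) (shifted n.+1) => x y z.
  by rewrite !mulgA mulgV mul1g mulgK.
have E' : (shifted 1)^-1 * shifted_prod n = shifted_prod n * (shifted 1)^-1.
  apply: (mulgI (shifted 1)); apply: (mulIg (shifted 1)); have := cH n (leqnn n).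
  move: (shifted 1) (shifted_prod n) => x y.
  by rewrite !mulgA mulgV mul1g mulgVK => ->.
rewrite -[RHS]mulgA E E' -(shiftedS n).
have -> : shifted 1 = g * t * g^-1 by rewrite -(shiftedS 0) /shifted expg0 invg1 mulg1 mul1g.
move: (shifted_prod n) (shifted n) => x y.
by rewrite !invgM invgK !mulgA mulVg mul1g !mulgVK.
Qed.

Lemma twisted_product_torsion n m :
  (forall i, (i < n)%N -> t * shifted i = shifted i * t) -> (0 < m)%N -> g ^+ m = 1 ->
  torsion (g * t^-1 * shifted n).
Proof.
move=> ct m0 gm; exists m => //; rewrite (twisted_product_conj ct).
set H := shifted_prod n.
have -> : (H^-1 * g * H) ^+ m = H^-1 * g ^+ m * H.
  elim: (m) => [|j IH]; first by rewrite !expg0 mulg1 mulVg.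
  by rewrite !expgS IH !mulgA mulgK.
by rewrite gm mulg1 mulVg.
Qed.

End ConjugateProduct.

Section DiffeoGroup.
Context {R : realType} {k : nat}.
Implicit Types (f g h : Cdiff R k) (p : circle R).

Lemma cdiffXE f n p : (f ^+ n)%g p = iter n f p.
Proof. by elim: n => [|n IH] //; rewrite expgS iterS -IH. Qed.

Lemma cdiff_eq f g : (forall p, f p = g p) -> f = g.
Proof. by move=> fg; apply: Cdiff_inj; exact/funext. Qed.

Lemma cdiffVK f p : f ((f^-1)%g p) = p.
Proof. exact: dinvK. Qed.

Lemma cdiffKV f p : (f^-1)%g (f p) = p.
Proof. exact: dmapK. Qed.

Lemma disjoint_supports_commute f g (U : set (circle R)) :
  (forall p, ~ U p -> f p = p) -> (forall p, U p -> g p = p) -> (f * g = g * f)%g.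
Proof.
move=> fU gU; apply: cdiff_eq => p; change (f (g p) = g (f p)).
have [Up|nUp] := pselect (U p).
  rewrite gU// gU//; apply: contrapT => nU; have := fU _ nU.
  by move=> /(can_inj (dmapK f)) E; apply: nU; rewrite E.
rewrite [f p]fU// fU// => Ug; have := gU _ Ug.
by move=> /(can_inj (dmapK g)) E; apply: nUp; rewrite -E.
Qed.

Lemma elliptic_twist_torsion (al s : R) n (g h t : Cdiff R k) : 0 < sin al -> s = 2 - 2 * cos al ->
  acts_by g 1 (- 1) s (1 - s) -> (0 < n)%N -> n%:R * al = pi ->
  (forall p, ccos (h p) = - ccos p) -> (forall p, csin (h p) = - csin p) ->
  (forall p, ~ (0 < ccos p < csin p) -> t p = p) ->
  torsion (g * t^-1 * (h * t * h))%g.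
Proof.
move=> sal sE gP n0 nal hc hs tU.
have gn : (g ^+ n)%g = h.
  by apply: cdiff_eq => p; rewrite cdiffXE; exact: (elliptic_half_turn sal sE gP nal).
have hh : (h * h)%g = 1%g.
  apply: cdiff_eq => p; change (h (h p) = p).
  by apply: circle_eq; rewrite ?hc ?hs opprK.
have hV : (h^-1)%g = h by apply: (mulgI h); rewrite mulgV hh.
have -> : (h * t * h)%g = shifted g t n by rewrite /shifted gn hV.
apply: (@twisted_product_torsion _ _ _ _ (n + n)); last 2 first.
- by rewrite addn_gt0 n0.
- by rewrite expgnDr gn hh.
case=> [|i] i_n; first by rewrite /shifted expg0 invg1 mulg1 mul1g.
apply: (@disjoint_supports_commute _ _ [set p | 0 < ccos p < csin p]) => //= p pU.
(* If [q] were in the cone, its image [p] under g^{i+1} would have left it; so [t] fixes [q]. *)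
pose q := ((g ^+ i.+1)^-1)%g p; have pq : p = (g ^+ i.+1)%g q by rewrite /q cdiffVK.
change ((g ^+ i.+1)%g (t q) = p); rewrite tU// => qU.
have := elliptic_leaves_cone sal sE gP nal _ qU (j := i.+1).
rewrite -cdiffXE -pq leNgt => /(_ (ltnW i_n)).
by have /andP[-> _] := pU.
Qed.

End DiffeoGroup.

(** * The twisting diffeomorphism *)

Section Bump.
Context {R : realType}.
Implicit Types (x y : R) (m k : nat).

Lemma periodic_bounded (h : R -> R) : continuous h -> (forall y, h (y + 1) = h y) ->
  exists2 M : R, 0 < M & forall x, `|h x| <= M.
Proof.
move=> ch h1; have [M M0 hM] := continuous_bounded 0 1 ch; exists M => // x.
have [y /andP[y0 y1] /to_circle_int[n xy]] := circle_rep (to_circle x).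
by rewrite -(periodic_addz n x h1) -xy hM// y0 ltW.
Qed.

Lemma derive1_periodic (h : R -> R) x : (forall y, h (y + 1) = h y) ->
  derive1 h (x + 1) = derive1 h x.
Proof.
move=> h1; rewrite -derive1_shift (_ : (fun y => h (y + 1)) = h)//.
exact/funext.
Qed.

(** The truncated power, which is C^m: a cutoff of finite smoothness, chosen according to the class
    of diffeomorphisms wanted. *)
Definition posX m x : R := Num.max 0 x ^+ m.+1.

Lemma posX_gt0 m x : 0 < x -> posX m x = x ^+ m.+1.
Proof. by move=> x0; rewrite /posX (max_idPr (ltW x0)). Qed.

Lemma posX_le0 m x : x <= 0 -> posX m x = 0.
Proof. by move=> x0; rewrite /posX (max_idPl x0) expr0n. Qed.

Lemma posX_cont m : continuous (posX m).
Proof.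
move=> x; rewrite /posX.
have cm : continuous (fun y : R => Num.max 0 y).
  by move=> z; apply: continuous_max; [exact: cvg_cst|exact: cvg_id].
apply: (@continuous_comp _ _ _ (fun y : R => Num.max 0 y) (fun y : R => y ^+ m.+1)).
  exact: cm.
exact: exprn_continuous.
Qed.

Lemma is_derive_posX m x : is_derive x (1 : R) (posX m.+1) (m.+2%:R * posX m x).
Proof.
have [x0|x0|x0] := ltgtP x 0.
- have E : {near x, cst 0 =1 posX m.+1}.
    by near=> y; rewrite posX_le0//; apply/ltW; near: y; exact: lt_nbhsl.
  rewrite (posX_le0 _ (ltW x0)) mulr0; split.
    by apply: (near_eq_derivable E); exact: derivable_cst.
  by rewrite -(near_eq_derive _ E) derive_cst.
- have E : {near x, (fun y : R => y ^+ m.+2) =1 posX m.+1}.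
    by near=> y; rewrite posX_gt0//; near: y; exact: lt_nbhsr.
  rewrite (posX_gt0 _ x0); split.
    by apply: (near_eq_derivable E); exact: exprn_derivable.
  by rewrite -(near_eq_derive _ E) exp_derive /GRing.scale /= mulr1 mulr_natl.
(* At 0 the difference quotient of [posX m.+1] is [posX m], continuous and vanishing there. *)
- rewrite x0 posX_le0// mulr0; apply/is_derive1_caratheodory; exists (posX m); split.
  + move=> z; rewrite (posX_le0 m.+1 (lexx 0)) !subr0; case: (leP z 0) => z0.
      by rewrite !posX_le0// mul0r.
    by rewrite !posX_gt0// [in LHS]exprSr.
  + exact: posX_cont.
  + by rewrite posX_le0.
Unshelve. all: by end_near. Qed.

Lemma derive1_posX m : (posX m.+1)^`() = fun x => m.+2%:R * posX m x.
Proof. by apply/funext => x; rewrite derive1E; have [_ ->] := is_derive_posX m x. Qed.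

Lemma Ck_posX m : Ck m (posX m).
Proof.
elim: m => [|m IH]; first by apply/Ck0; exact: posX_cont.
apply/CkS; split; first by move=> x; have [] := is_derive_posX m x.
by rewrite derive1_posX; exact: CkZ.
Qed.

(* Supported in the cone 0 < cos < sin, vanishing inside it on the ray sin = 2 cos. *)
Definition bump m x : R :=
  posX m (cos2pi x) * posX m (sin2pi x - cos2pi x) * (sin2pi x - 2 * cos2pi x).

Lemma Ck_bump m : Ck m (bump m).
Proof.
have [kc ks] := @Ck_cos2pi_sin2pi R m.
have k1 : Ck m (posX m \o cos2pi) by exact: Ck_comp (Ck_posX m) kc.
have k2 : Ck m (posX m \o (fun x => sin2pi x - cos2pi x)).
  by apply: Ck_comp (Ck_posX m) _; exact: CkB.
have k3 : Ck m (fun x => sin2pi x - 2 * cos2pi x) by apply: CkB => //; exact: CkZ.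
exact: CkM (CkM k1 k2) k3.
Qed.

Lemma bumpD1 m x : bump m (x + 1) = bump m x.
Proof. by rewrite /bump cos2piD1 sin2piD1. Qed.

Lemma bump_out m x : ~~ (0 < cos2pi x < sin2pi x) -> bump m x = 0.
Proof.
rewrite negb_and -!leNgt /bump => /orP[c0|cs].
  by rewrite posX_le0// !mul0r.
by rewrite [posX _ (_ - _)]posX_le0 ?subr_le0// mulr0 mul0r.
Qed.

Lemma is_derive_bump m x : is_derive x (1 : R) (bump m.+1)
  ((m.+2%:R * posX m (cos2pi x) * (- (2 * pi) * sin2pi x) * posX m.+1 (sin2pi x - cos2pi x) +
    posX m.+1 (cos2pi x) * (m.+2%:R * posX m (sin2pi x - cos2pi x) *
       (2 * pi * cos2pi x - - (2 * pi) * sin2pi x))) * (sin2pi x - 2 * cos2pi x) +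
   posX m.+1 (cos2pi x) * posX m.+1 (sin2pi x - cos2pi x) * (2 * pi * cos2pi x + 4 * pi * sin2pi x)).
Proof.
have dc := is_derive_cos2pi x; have ds := is_derive_sin2pi x.
have dsc := is_deriveB ds dc.
have d1 := is_derive1_comp (is_derive_posX m (cos2pi x)) dc.
have d2 := is_derive1_comp (is_derive_posX m ((sin2pi - cos2pi : R -> R) x)) dsc.
have d3 := is_deriveB ds (is_deriveZ 2 dc).
have d := is_deriveM (is_deriveM d1 d2) d3.
apply: (is_derive_eq d).
set A := posX m (cos2pi x); set A' := posX m.+1 (cos2pi x).
set B := posX m (sin2pi x - cos2pi x); set B' := posX m.+1 (sin2pi x - cos2pi x).
change ((A' * B') * (2 * pi * cos2pi x - 2 * (- (2 * pi) * sin2pi x)) +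
  (sin2pi x - 2 * cos2pi x) * (A' * (m.+2%:R * B * (2 * pi * cos2pi x - - (2 * pi) * sin2pi x)) +
   B' * (m.+2%:R * A * (- (2 * pi) * sin2pi x))) =
 (m.+2%:R * A * (- (2 * pi) * sin2pi x) * B' +
    A' * (m.+2%:R * B * (2 * pi * cos2pi x - - (2 * pi) * sin2pi x))) * (sin2pi x - 2 * cos2pi x) +
   A' * B' * (2 * pi * cos2pi x + 4 * pi * sin2pi x)).
by ring.
Qed.

Lemma derive1_bump_out m x : ~~ (0 < cos2pi x < sin2pi x) -> (bump m.+1)^`() x = 0.
Proof.
move=> nU; rewrite derive1E; have [_ ->] := is_derive_bump m x.
move: nU; rewrite negb_and -!leNgt => /orP[c0|cs].
  by rewrite !(posX_le0 _ c0) !(mulr0, mul0r, addr0).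
have cs' : sin2pi x - cos2pi x <= 0 by rewrite subr_le0.
by rewrite !(posX_le0 _ cs') !(mulr0, mul0r, addr0).
Qed.

Lemma derive1_bump_ray m x : 0 < cos2pi x -> sin2pi x = 2 * cos2pi x -> 0 < (bump m.+1)^`() x.
Proof.
move=> c0 sE; rewrite derive1E; have [_ ->] := is_derive_bump m x.
have cs : 0 < sin2pi x - cos2pi x by rewrite sE; lra.
have pi0 := pi_gt0 R.
(* The factor sin - 2 cos vanishes on the ray, so only the term in which it is differentiated is
   left. *)
rewrite [X in _ * X + _](_ : _ = 0) ?mulr0 ?add0r; last by rewrite sE subrr.
rewrite (posX_gt0 _ c0) (posX_gt0 _ cs); apply: mulr_gt0.
  by apply: mulr_gt0; exact: exprn_gt0.
by rewrite sE addr_gt0 ?mulr_gt0.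
Qed.

(** The derivative on the ray merely exceeds 1; a power of [t] makes it large afterwards. *)
Lemma bump_diffeo k : exists t : Cdiff R k.+1, [/\
  forall p, ~ (0 < ccos p < csin p) -> t p = p /\ cD t p = 1,
  forall p, csin p = 2 * ccos p -> t p = p &
  forall p, 0 < ccos p -> csin p = 2 * ccos p -> 1 < cD t p].
Proof.
have kb : Ck k.+1 (bump k.+1) := Ck_bump k.+1.
have /CkS[db /Ck_cont cb] := kb.
have b1 x := derive1_periodic x (bumpD1 k.+1).
have [M M0 hM] := periodic_bounded cb b1.
(* [M] bounds the derivative of the bump, so F' >= 1/2. *)
pose F x := x + (2 * M)^-1 * bump k.+1 x.
have M20 : 0 < (2 * M)^-1 by rewrite invr_gt0 mulr_gt0.
have dF (x : R) : is_derive x (1 : R) F (1 + (2 * M)^-1 * derive1 (bump k.+1) x).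
  have db' : is_derive x (1 : R) (bump k.+1) (derive1 (bump k.+1) x).
    by rewrite derive1E; exact/derivableP.
  exact: is_deriveD (is_derive_id x (1 : R)) (is_deriveZ (2 * M)^-1 db').
have F'E x : derive1 F x = 1 + (2 * M)^-1 * derive1 (bump k.+1) x.
  by rewrite derive1E; have [_ ->] := dF x.
have kF : Ck k.+1 F by apply: CkD; [exact: Ck_id|exact: CkZ].
have [||t lt] := diffeo_of_lift kF.
- move=> x; rewrite F'E; have := hM x; rewrite ler_norml => /andP[Mb _].
  have : (2 * M)^-1 * - M <= (2 * M)^-1 * derive1 (bump k.+1) x by rewrite ler_pM2l.
  have -> : (2 * M)^-1 * - M = - 2^-1 by field; rewrite gt_eqF.
  by lra.
- by move=> x; rewrite /F bumpD1 addrAC.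
have tE x : t (to_circle x) = to_circle (F x) by have [_ ->] := lt.
exists t; split => p.
- have [x <-] := to_circle_surj p; rewrite ccos_to csin_to => /negP nU.
  rewrite tE (cD_lift _ lt) F'E derive1_bump_out// /F bump_out//.
  by rewrite mulr0 !addr0.
- have [x <-] := to_circle_surj p; rewrite ccos_to csin_to => E.
  by rewrite tE /F /bump E subrr !mulr0 addr0.
- have [x <-] := to_circle_surj p; rewrite ccos_to csin_to => c0 E.
  by rewrite (cD_lift _ lt) F'E ltrDl mulr_gt0// derive1_bump_ray.
Qed.

End Bump.

(** * Growth of the twisted parabolic element *)

Section GroupDerivative.
Context {R : realType} {k : nat}.
Implicit Types (f g h : Cdiff R k.+1) (p : circle R).

Lemma cDM f g p : cD (f * g)%g p = cD f (g p) * cD g p.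
Proof.
by apply: cD_comp; apply: increasing_Ck_mapW; exact: dmap_Ck.
Qed.

Lemma cD1 p : cD (1%g : Cdiff R k.+1) p = 1.
Proof. exact: cD_id. Qed.

Lemma cDV_mul f p : cD (f^-1)%g (f p) * cD f p = 1.
Proof. by rewrite -cDM mulVg cD1. Qed.

Lemma cD_pos f p : 0 < cD f p.
Proof.
have ge0 q (h : Cdiff R k.+1) : 0 <= cD h q.
  by apply: cD_ge0; apply: increasing_Ck_mapW; exact: dmap_Ck.
rewrite lt_neqAle ge0 andbT; apply/eqP => f0; have := cDV_mul f p.
by rewrite -f0 mulr0 => /eqP; rewrite eq_sym oner_eq0.
Qed.

Lemma cDX_fixed f p n : f p = p -> (f ^+ n)%g p = p /\ cD (f ^+ n)%g p = cD f p ^+ n.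
Proof.
move=> fp; elim: n => [|n [IH1 IH2]]; first by rewrite expr0 cD1.
rewrite expgS cDM IH1 IH2 exprS; split => //.
by change (f ((f ^+ n)%g p) = p); rewrite IH1.
Qed.

End GroupDerivative.

Section ParabolicOrbit.
Context {R : realType}.
Implicit Types (t x : R).

(* The point of the open upper half circle on the ray of (t, 1). *)
Definition upper_ptR t : R := (2 * pi)^-1 * (pi / 2 - atan t).
Definition upper_pt t : circle R := to_circle (upper_ptR t).

Lemma upper_ptR_bounds t : 0 < upper_ptR t < 1.
Proof.
have pi0 := pi_gt0 R; have l := atan_gtNpi2 t; have u := atan_ltpi2 t.
rewrite /upper_ptR mulr_gt0 ?invr_gt0 ?mulr_gt0 ?subr_gt0//= mulrC ltr_pdivrMr ?mulr_gt0//.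
by rewrite mul1r; lra.
Qed.

Lemma upper_ptR_nd t t' : t' <= t -> upper_ptR t <= upper_ptR t'.
Proof.
move=> tt; rewrite /upper_ptR ler_pM2l ?invr_gt0 ?mulr_gt0 ?pi_gt0// lerD2l lerN2.
have [->//|/eqP tN] := eqVneq t t'.
apply/ltW; rewrite -(@ltr_tan R) ?in_itv/= ?atan_gtNpi2 ?atan_ltpi2//.
by rewrite !atanK lt_neqAle tt andbT; apply/eqP => E; apply: tN.
Qed.

Lemma upper_ptR_angle t : 2 * pi * upper_ptR t = pi / 2 - atan t.
Proof. by rewrite /upper_ptR mulrA mulfV ?mul1r// mulf_neq0// gt_eqF// pi_gt0. Qed.

Lemma cos_atan_gt0 t : 0 < cos (atan t).
Proof. by rewrite cos_gt0_pihalf// atan_gtNpi2 atan_ltpi2. Qed.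

Lemma csin_upper_pt t : csin (upper_pt t) = cos (atan t).
Proof.
rewrite /upper_pt csin_to /sin2pi upper_ptR_angle sinB sin_pihalf cos_pihalf; ring.
Qed.

Lemma ccos_upper_pt t : ccos (upper_pt t) = t * cos (atan t).
Proof.
rewrite /upper_pt ccos_to /cos2pi upper_ptR_angle cosB sin_pihalf cos_pihalf mul0r mul1r add0r.
have := atanK t; rewrite /tan => {2}<-; rewrite divfK// gt_eqF// cos_atan_gt0//.
Qed.

Lemma upper_pt_cone t : (0 < ccos (upper_pt t) < csin (upper_pt t)) = (0 < t < 1).
Proof.
have c0 := cos_atan_gt0 t.
by rewrite ccos_upper_pt csin_upper_pt pmulr_lgt0// -[X in _ && (_ < X)]mul1r ltr_pM2r.
Qed.

Definition ln1Dsqr t : R := ln (1 + t ^+ 2).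

Lemma oneDsqr_gt0 t : 0 < 1 + t ^+ 2.
Proof. by rewrite ltr_wpDr ?sqr_ge0. Qed.

(** With d = u - u', 3 (1 + u'^2) - (1 + u^2) = (u' - d)^2 + u'^2 + 2 (1 - d^2), nonnegative for |d|
    <= 1: this is the origin of the 3. *)
Lemma ln1Dsqr_close t t' : `|t - t'| <= 1 -> `|ln1Dsqr t - ln1Dsqr t'| <= ln 3.
Proof.
have half u u' : `|u - u'| <= 1 -> ln1Dsqr u - ln1Dsqr u' <= ln 3.
  rewrite ler_norml => /andP[l h]; rewrite lerBlDr -lnM ?posrE ?oneDsqr_gt0//.
  rewrite ler_ln ?posrE ?mulr_gt0 ?oneDsqr_gt0//.
  have d1 : 0 <= (1 - (u - u')) * (1 + (u - u')) by rewrite mulr_ge0; lra.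
  have -> : 3 * (1 + u' ^+ 2) = 1 + u ^+ 2 + ((u' - (u - u')) ^+ 2 + u' ^+ 2 +
    2 * ((1 - (u - u')) * (1 + (u - u')))) by ring.
  rewrite lerDl; apply: addr_ge0; last by apply: mulr_ge0.
  by apply: addr_ge0; exact: sqr_ge0.
move=> tt; rewrite ler_norml half// andbT lerNl opprB half//.
by rewrite distrC.
Qed.

Section one_parabolic.
Variable g : circle R -> circle R.
Hypothesis gP : acts_by g 1 (- 1) 0 1.

Lemma parabolic_upper_pt t : g (upper_pt t) = upper_pt (t - 1).
Proof.
have [[r [r0 gc gs]] _] := gP (upper_pt t).
have c0 := cos_atan_gt0 t; have c1 := cos_atan_gt0 (t - 1).
apply: (@circle_eq_ray _ _ _ r (cos (atan t) / cos (atan (t - 1))) _ _ r0 _ gc gs).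
- exact: divr_gt0.
- by rewrite !ccos_upper_pt csin_upper_pt; field; rewrite gt_eqF.
- by rewrite !csin_upper_pt ccos_upper_pt; field; rewrite gt_eqF.
Qed.

(** The derivative is |(t, 1)|^2 / |(t - 1, 1)|^2. In this form it telescopes along orbits. *)
Lemma parabolic_cD t : ln (cD g (upper_pt t)) = ln1Dsqr t - ln1Dsqr (t - 1).
Proof.
have [_ ->] := gP (upper_pt t); rewrite ccos_upper_pt csin_upper_pt.
have -> : (1 * (t * cos (atan t)) + -1 * cos (atan t)) ^+ 2 +
   (0 * (t * cos (atan t)) + 1 * cos (atan t)) ^+ 2 =
   cos (atan t) ^+ 2 * (1 + (t - 1) ^+ 2) by ring.
rewrite cos_atan exprVn sqr_sqrtr ?(ltW (oneDsqr_gt0 _))// invfM invrK.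
by rewrite ln_div ?posrE ?oneDsqr_gt0.
Qed.

End one_parabolic.

End ParabolicOrbit.

Section TwistGrowth.
Context {R : realType} {k : nat}.
Variables g h t : Cdiff R k.+2.
Hypothesis gP : acts_by g 1 (- 1) 0 1.
Hypothesis hP : forall p, [/\ ccos (h p) = - ccos p, csin (h p) = - csin p & cD h p = 1].
Hypothesis t_out : forall p, ~ (0 < ccos p < csin p) -> t p = p /\ cD t p = 1.
Hypothesis t_ray : forall p, csin p = 2 * ccos p -> t p = p.

Let f : Cdiff R k.+2 := (g * t^-1 * (h * t * h))%g.

(** The half turn sends [p] to the lower half circle, outside the support of [t], so h t h acts at
    [p] as the identity to first order. *)
Lemma twist_at p : 0 < csin p -> t p = p -> f p = g p /\ cD f p = cD g p / cD t p.
Proof.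
move=> sp tp; have [_ hs hD] := hP p.
have [thp tD] : t (h p) = h p /\ cD t (h p) = 1.
  by apply: t_out; rewrite hs => /andP[]; lra.
have hh : h (h p) = p.
  have [c1 s1 _] := hP (h p); have [c2 s2 _] := hP p.
  by apply: circle_eq; rewrite ?c1 ?s1 ?c2 ?s2 opprK.
have w1 : (h * t * h)%g p = p.
  by change (h (t (h p)) = p); rewrite thp.
have w2 : cD (h * t * h)%g p = 1.
  rewrite !cDM tD hD; have [_ _] := hP (t (h p)).
  by change (cD h (t (h p)) = 1 -> cD h (t (h p)) * 1 * 1 = 1); move=> ->; rewrite !mulr1.
have tV : (t^-1)%g p = p by rewrite -{1}tp cdiffKV.
split; first by change (g ((t^-1)%g ((h * t * h)%g p)) = g p); rewrite w1 tV.
rewrite cDM w1 w2 mulr1 cDM tV; congr (_ * _).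
have := cDV_mul t p; rewrite tp => H.
by apply: (mulIf (lt0r_neq0 (cD_pos t p))); rewrite H mulVf// gt_eqF// cD_pos.
Qed.

(** The ray of (x, 1) is in the open cone exactly for 0 < x < 1. The [good] parameters are those
    outside it and 1/2, whose ray y = 2x is fixed by [t]; only there does [t] contribute, by
    [kick]. *)
Let L : R := ln (cD t (upper_pt 2^-1)).
Let kick (x : R) : R := if x == 2^-1 then L else 0.
Let good (x : R) : Prop := [\/ x <= 0, 1 <= x | x = 2^-1].

Lemma twist_upper_pt x : good x -> f (upper_pt x) = upper_pt (x - 1) /\
  ln (cD f (upper_pt x)) = ln1Dsqr x - ln1Dsqr (x - 1) - kick x.
Proof.
move=> gx; have s0 : 0 < csin (upper_pt x) by rewrite csin_upper_pt cos_atan_gt0.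
have [tx Dx] : t (upper_pt x) = upper_pt x /\ ln (cD t (upper_pt x)) = kick x.
  have out : (x <= 0) || (1 <= x) -> t (upper_pt x) = upper_pt x /\ ln (cD t (upper_pt x)) = kick x.
    move=> ox; have [|-> ->] := t_out (p := upper_pt x).
      by rewrite upper_pt_cone => /andP[]; move: ox => /orP[]; lra.
    rewrite ln1 /kick ifF//; apply/negP => /eqP; move: ox => /orP[]; lra.
  case: gx => [x0|x1|xE]; [by apply: out; rewrite x0|by apply: out; rewrite x1 orbT|].
  rewrite /kick xE eqxx /L; split => //; apply: t_ray.
  by rewrite ccos_upper_pt csin_upper_pt mulrA mulfV// mul1r.
have [-> ->] := twist_at s0 tx; rewrite (parabolic_upper_pt gP); split => //.
by rewrite ln_div ?posrE ?cD_pos// Dx (parabolic_cD gP).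
Qed.

Lemma twist_iter m x : (forall i, (i < m)%N -> good (x - i%:R)) ->
  (f ^+ m)%g (upper_pt x) = upper_pt (x - m%:R) /\
  ln (cD (f ^+ m)%g (upper_pt x)) = ln1Dsqr x - ln1Dsqr (x - m%:R) - \sum_(i < m) kick (x - i%:R).
Proof.
elim: m => [|m IH] gx; first by rewrite big_ord0 !subr0 subrr cD1 ln1.
have [i|IH1 IH2] := IH; first by move=> im; apply: gx; exact: ltnW.
have [f1 f2] := twist_upper_pt (gx m (leqnn _)).
have xS : x - m.+1%:R = x - m%:R - 1 by rewrite -natr1; ring.
rewrite expgS xS; split.
  by change (f ((f ^+ m)%g (upper_pt x)) = upper_pt (x - m%:R - 1)); rewrite IH1.
rewrite cDM lnM ?posrE ?cD_pos// IH1 IH2 f2 big_ord_recr/=.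
move: (ln1Dsqr x) (ln1Dsqr (x - m%:R)) (ln1Dsqr _) (kick _) (\sum_(i < m) _) => a b c e s.
by ring.
Qed.

Lemma twist_iter_int m j : ln (cD (f ^+ m)%g (upper_pt j.+1%:R)) =
  ln1Dsqr j.+1%:R - ln1Dsqr (j.+1%:R - m%:R).
Proof.
have int_cases i : j.+1%:R - i%:R <= 0 :> R \/ 1 <= j.+1%:R - i%:R :> R.
  case: (leqP i j) => ij.
    by right; rewrite lerBrDr addrC natr1 ler_nat ltnS.
  by left; rewrite subr_le0 ler_nat.
have [i _|_ ->] := @twist_iter m j.+1%:R.
  by case: (int_cases i) => H; [constructor 1|constructor 2].
rewrite big1 ?subr0// => i _; rewrite /kick ifF//.
by apply/negP => /eqP; case: (int_cases i); lra.
Qed.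

(** The orbit j + 1/2, j - 1/2, ... meets 1/2 exactly once, at time j, and this is before time m. *)
Lemma twist_iter_half m j : (j < m)%N -> ln (cD (f ^+ m)%g (upper_pt (j%:R + 2^-1))) =
  ln1Dsqr (j%:R + 2^-1) - ln1Dsqr (j%:R + 2^-1 - m%:R) - L.
Proof.
move=> jm; have half_cases i : i != j -> j%:R + 2^-1 - i%:R <= 0 :> R \/ 1 <= j%:R + 2^-1 - i%:R :> R.
  move=> ij; case: (ltngtP i j) ij => // ij _.
    have : i.+1%:R <= j%:R :> R by rewrite ler_nat.
    by rewrite -natr1; right; lra.
  have : j.+1%:R <= i%:R :> R by rewrite ler_nat.
  by rewrite -natr1; left; lra.
have [i _|_ ->] := @twist_iter m (j%:R + 2^-1).
  have [->|/half_cases[H|H]] := eqVneq i j; [constructor 3|by constructor 1|by constructor 2].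
  by rewrite addrAC subrr add0r.
rewrite (bigD1 (Ordinal jm))//= big1 ?addr0.
  by have E : j%:R + 2^-1 - j%:R = 2^-1 :> R; [ring|rewrite /kick E eqxx].
move=> i ij; rewrite /kick ifF//; apply/negP => /eqP.
have /half_cases : (i : nat) != j by apply: contra ij => /eqP E; apply/eqP/val_inj.
by case; lra.
Qed.

(** From the ray of (j + 1, 1) to that of (j + 1/2, 1), log (f^m)' drops by L, up to two errors of
    at most ln 3, from the beginnings and the ends of the two orbits. The m arcs, j < m, do not
    overlap. *)
Lemma twist_growth m : (L - 2 * ln 3) * m%:R <= logvar (forget (f ^+ m)%g) 1%g.
Proof.
have lD p : logD (forget (f ^+ m)%g) p - logD 1%g p = ln (cD (f ^+ m)%g p).
  rewrite /logD (_ : cD (1%g : ACdiff R) p = 1) ?ln1 ?subr0//; exact: cD_id.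
have [B _ vB] := logD_sub_var_le (forget (f ^+ m)%g) 1%g.
(* The angle decreases with the parameter, so the chain begins with the largest j. *)
pose u i : R := upper_ptR (m - i)%N%:R.
pose v i : R := upper_ptR ((m - i.+1)%N%:R + 2^-1).
have c : pair_chain m u v.
  move=> i im; have mi : (m - i)%N = (m - i.+1).+1 by rewrite subnSK.
  split.
  - by rewrite /u /v mi -natr1; apply: upper_ptR_nd; lra.
  - by move=> _; apply: upper_ptR_nd; rewrite lerDl.
  - have /andP[u0 _] := upper_ptR_bounds ((m - 0)%N%:R : R).
    have /andP[_ v1] := upper_ptR_bounds ((m - i.+1)%N%:R + 2^-1 : R).
    by move: u0 v1; rewrite -/(u 0%N) -/(v i); lra.
apply: le_trans (le_circle_var vB c).
rewrite mulr_natr -[X in _ *+ X](card_ord m) -sumr_const.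
apply: ler_sum => i _.
have mi : (m - i)%N = (m - i.+1).+1 by rewrite subnSK.
have ji : (m - i.+1 < m)%N by rewrite subnSK// leq_subr.
have vE : to_circle (v i) = upper_pt ((m - i.+1)%N%:R + 2^-1) by [].
have uE : to_circle (u i) = upper_pt (m - i.+1).+1%:R by rewrite /u mi.
rewrite (lD (to_circle (v i))) (lD (to_circle (u i))) vE uE.
set j := (m - i.+1)%N in ji *.
rewrite twist_iter_int (twist_iter_half ji).
have jS : j.+1%:R = j%:R + 1 :> R by rewrite natr1.
have A1 : `|ln1Dsqr (j%:R + 2^-1) - ln1Dsqr (j.+1%:R : R)| <= ln 3.
  by apply: ln1Dsqr_close; rewrite jS ler_norml; apply/andP; split; lra.
have A2 : `|ln1Dsqr (j%:R + 2^-1 - m%:R) - ln1Dsqr (j.+1%:R - m%:R : R)| <= ln 3.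
  by apply: ln1Dsqr_close; rewrite jS ler_norml; apply/andP; split; lra.
move: A1 A2; move: (ln1Dsqr _) (ln1Dsqr _) (ln1Dsqr _) (ln1Dsqr _) => a b a' b'.
rewrite !ler_norml => /andP[A1 A2] /andP[A3 A4].
by rewrite ler_normr; apply/orP; right; lra.
Qed.

End TwistGrowth.

(** * Convergence in C^k *)

Section UniformConvergence.
Context {R : realType}.
Implicit Types (F G : nat -> R -> R) (f g : R -> R) (k : nat).

Definition unif_cvg F f : Prop := forall e : R, 0 < e ->
  exists N : nat, forall n, (N <= n)%N -> forall x, `|F n x - f x| <= e.

Definition bounded_map f : Prop := exists2 M : R, 0 < M & forall x, `|f x| <= M.

(* The limit is required to have bounded derivatives, so that products converge. *)
Fixpoint Ck_unif_cvg k F f : Prop := [/\ unif_cvg F f, bounded_map f &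
  if k is k'.+1 then [/\ forall n x, derivable (F n) x 1, forall x, derivable f x 1 &
    Ck_unif_cvg k' (fun n => derive1 (F n)) (derive1 f)] else True].

Lemma Ck_unif_cvg0 k F f : Ck_unif_cvg k F f -> unif_cvg F f. Proof. by case: k => [[]|k []]. Qed.

Lemma Ck_unif_cvgW k F f : Ck_unif_cvg k.+1 F f -> Ck_unif_cvg k F f.
Proof.
elim: k F f => [|k IH] F f [cv bd [dF df kF]]; first by [].
by split => //; split => //; exact: IH.
Qed.

Lemma unif_cvg_derive1n k F f i : Ck_unif_cvg k F f -> (i <= k)%N ->
  unif_cvg (fun n => (F n)^`(i)) (f^`(i)).
Proof.
elim: i k F f => [|i IH] k F f kF ik; first exact: Ck_unif_cvg0 kF.
case: k kF ik => // k [_ _ [_ _ kF]] ik.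
have := IH _ _ _ kF ik; rewrite -derive1Sn.
by move=> H e /H[N HN]; exists N => n /HN Hn x; rewrite derive1Sn; exact: Hn.
Qed.

Lemma Ck_unif_cvg_periodic k f : Ck k f -> (forall x, f (x + 1) = f x) -> Ck_unif_cvg k (fun=> f) f.
Proof.
elim: k f => [|k IH] f kf f1.
  split => //; last exact: periodic_bounded (Ck_cont kf) f1.
  by move=> e e0; exists 0%N => n _ x; rewrite subrr normr0 ltW.
have /CkS[df kf'] := kf; split.
- by move=> e e0; exists 0%N => n _ x; rewrite subrr normr0 ltW.
- exact: periodic_bounded (Ck_cont kf) f1.
- by split => //; apply: IH => // x; exact: derive1_periodic.
Qed.

Lemma Ck_unif_cvg_cst k (c : nat -> R) (l : R) :
  (forall e : R, 0 < e -> exists N : nat, forall n, (N <= n)%N -> `|c n - l| <= e) ->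
  Ck_unif_cvg k (fun n _ => c n) (fun=> l).
Proof.
move=> cl; have cv : unif_cvg (fun n _ => c n) (fun=> l).
  by move=> e /cl[N HN]; exists N => n /HN.
have bd : bounded_map (fun=> l) by exists (`|l| + 1) => [|x]; [rewrite ltr_wpDl|rewrite lerDl].
case: k => [//|k]; split => //; split.
- by move=> n x; exact: derivable_cst.
- by move=> x; exact: derivable_cst.
rewrite derive1_cst_fun (_ : (fun n => _) = fun _ _ => 0); last first.
  by apply/funext => n; rewrite derive1_cst_fun.
by apply: Ck_unif_cvg_periodic => //; exact: Ck_cst.
Qed.

Lemma unif_cvgD F G f g : unif_cvg F f -> unif_cvg G g -> unif_cvg (fun n => F n \+ G n) (f \+ g).
Proof.
move=> Ff Gg e e0; have [N HN] := Ff _ (divr_gt0 e0 (ltr0Sn _ 1)).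
have [N' HN'] := Gg _ (divr_gt0 e0 (ltr0Sn _ 1)).
exists (maxn N N') => n; rewrite geq_max => /andP[/HN Hn /HN' Hn'] x.
rewrite /= opprD addrACA (le_trans (ler_normD _ _))// [leRHS]splitr.
exact: lerD.
Qed.

Lemma unif_cvgM F G f g : unif_cvg F f -> unif_cvg G g -> bounded_map f -> bounded_map g ->
  unif_cvg (fun n => F n \* G n) (f \* g).
Proof.
move=> Ff Gg [M M0 hM] [M' M'0 hM'] e e0.
have e10 : 0 < e / 2 / (M' + 1) by rewrite !divr_gt0// addr_gt0.
have e20 : 0 < Num.min 1 (e / 2 / M) by rewrite lt_min ltr01 !divr_gt0.
have [N HN] := Ff _ e10; have [N' HN'] := Gg _ e20.
exists (maxn N N') => n; rewrite geq_max => /andP[/HN Hn /HN' Hn'] x.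
have Gb : `|G n x| <= M' + 1.
  rewrite -(subrK (g x) (G n x)) addrC (le_trans (ler_normD _ _))// lerD//.
  by rewrite (le_trans (Hn' x))// ge_min lexx.
have Gc : `|G n x - g x| <= e / 2 / M.
  by rewrite (le_trans (Hn' x))// ge_min lexx orbT.
have -> : (F n \* G n) x - (f \* g) x = (F n x - f x) * G n x + f x * (G n x - g x).
  by rewrite /=; ring.
rewrite (le_trans (ler_normD _ _))// !normrM [leRHS]splitr; apply: lerD.
  apply: (@le_trans _ _ (e / 2 / (M' + 1) * (M' + 1))); first by apply: ler_pM.
  by rewrite divfK// gt_eqF// addr_gt0.
apply: (@le_trans _ _ (M * (e / 2 / M))); first by apply: ler_pM.
by rewrite mulrC divfK// gt_eqF.
Qed.

Lemma unif_cvgV F f (m : R) : 0 < m -> (forall x, m <= f x) -> unif_cvg F f ->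
  unif_cvg (fun n x => (F n x)^-1) (fun x => (f x)^-1).
Proof.
move=> m0 fm Ff e e0.
have e10 : 0 < Num.min (m / 2) (e * (m * (m / 2))) by rewrite lt_min !mulr_gt0// invr_gt0.
have [N HN] := Ff _ e10; exists N => n /HN Hn x.
have := Hn x; rewrite le_min => /andP[]; rewrite ler_norml => /andP[l _] h.
have fx := fm x; have f0 : 0 < f x := lt_le_trans m0 fx.
have Fm : m / 2 <= F n x by lra.
have F0 : 0 < F n x by apply: lt_le_trans Fm; rewrite divr_gt0.
have -> : (F n x)^-1 - (f x)^-1 = - (F n x - f x) / (f x * F n x).
  by field; rewrite !gt_eqF.
rewrite normrM normrN [X in _ * X]ger0_norm; last by rewrite invr_ge0 mulr_ge0 ?ltW.
rewrite ler_pdivrMr ?mulr_gt0// (le_trans h)// ler_pM2l//.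
by apply: ler_pM => //; [exact: ltW|rewrite divr_ge0// ltW].
Qed.

Lemma bounded_mapM f g : bounded_map f -> bounded_map g -> bounded_map (f \* g).
Proof.
move=> [M M0 hM] [M' M'0 hM']; exists (M * M'); first exact: mulr_gt0.
by move=> x; rewrite normrM ler_pM.
Qed.

Lemma bounded_mapD f g : bounded_map f -> bounded_map g -> bounded_map (f \+ g).
Proof.
move=> [M M0 hM] [M' M'0 hM']; exists (M + M'); first exact: addr_gt0.
by move=> x; rewrite (le_trans (ler_normD _ _))// lerD.
Qed.

Lemma bounded_mapV f (m : R) : 0 < m -> (forall x, m <= f x) -> bounded_map (fun x => (f x)^-1).
Proof.
move=> m0 fm; exists m^-1; first by rewrite invr_gt0.
move=> x; have f0 := lt_le_trans m0 (fm x).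
by rewrite ger0_norm ?invr_ge0 ?(ltW f0)// lef_pV2 ?posrE.
Qed.

Lemma derive1D_fun f g : (forall x, derivable f x 1) -> (forall x, derivable g x 1) ->
  derive1 (f \+ g) = derive1 f \+ derive1 g.
Proof.
move=> df dg; apply/funext => x.
by rewrite derive1E (deriveD (df x) (dg x)) /= !derive1E.
Qed.

Lemma derive1M_fun f g : (forall x, derivable f x 1) -> (forall x, derivable g x 1) ->
  derive1 (f \* g) = (f \* derive1 g) \+ (g \* derive1 f).
Proof.
move=> df dg; apply/funext => x.
by rewrite derive1E (deriveM (df x) (dg x)) /= !derive1E.
Qed.

Lemma Ck_unif_cvgD k F G f g : Ck_unif_cvg k F f -> Ck_unif_cvg k G g ->
  Ck_unif_cvg k (fun n => F n \+ G n) (f \+ g).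
Proof.
elim: k F G f g => [|k IH] F G f g [cF bf H] [cG bg H'].
  by split => //; [exact: unif_cvgD|exact: bounded_mapD].
have [dF df kF] := H; have [dG dg kG] := H'; split; [exact: unif_cvgD|exact: bounded_mapD|split].
- by move=> n x; exact: (derivableD (dF n x) (dG n x)).
- by move=> x; exact: (derivableD (df x) (dg x)).
- rewrite (derive1D_fun df dg) (_ : (fun n => _) = fun n => derive1 (F n) \+ derive1 (G n)).
    exact: IH.
  by apply/funext => n; exact (derive1D_fun (dF n) (dG n)).
Qed.

Lemma Ck_unif_cvgM k F G f g : Ck_unif_cvg k F f -> Ck_unif_cvg k G g ->
  Ck_unif_cvg k (fun n => F n \* G n) (f \* g).
Proof.
elim: k F G f g => [|k IH] F G f g kF kG.
  case: kF => cF bf _; case: kG => cG bg _.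
  by split => //; [exact: unif_cvgM|exact: bounded_mapM].
have [kF1 kG1] := (Ck_unif_cvgW kF, Ck_unif_cvgW kG).
case: kF => cF bf [dF df kF]; case: kG => cG bg [dG dg kG].
split; [exact: unif_cvgM|exact: bounded_mapM|split].
- by move=> n x; exact: (derivableM (dF n x) (dG n x)).
- by move=> x; exact: (derivableM (df x) (dg x)).
- rewrite (derive1M_fun df dg)
    (_ : (fun n => _) = fun n => (F n \* derive1 (G n)) \+ (G n \* derive1 (F n))).
    by apply: Ck_unif_cvgD; exact: IH.
  by apply/funext => n; exact (derive1M_fun (dF n) (dG n)).
Qed.

Lemma Ck_unif_cvgV k F f (m : R) : 0 < m -> (forall x, m <= f x) -> (forall n x, F n x != 0) ->
  Ck_unif_cvg k F f -> Ck_unif_cvg k (fun n x => (F n x)^-1) (fun x => (f x)^-1).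
Proof.
move=> m0 fm F0; have f0 x : f x != 0 by rewrite gt_eqF// (lt_le_trans m0).
elim: k => [|k IH] kF.
  case: kF => cF bf _; split => //; [exact: (unif_cvgV m0 fm cF)|exact: (bounded_mapV m0 fm)].
have ih := IH (Ck_unif_cvgW kF); case: kF => cF bf [dF df kF].
split; [exact: (unif_cvgV m0 fm cF)|exact: (bounded_mapV m0 fm)|split].
- by move=> n x; exact: derivable_inv (dF n x).
- by move=> x; exact: derivable_inv (df x).
- rewrite (derive1_inv f0 df) (_ : (fun n => _) = fun n => (fun x => - 1 * derive1 (F n) x) \*
    ((fun x => (F n x)^-1) \* (fun x => (F n x)^-1))).
    apply: Ck_unif_cvgM; last exact: Ck_unif_cvgM.
    apply: (Ck_unif_cvgM (F := fun _ _ => - 1)) => //.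
    by apply: Ck_unif_cvg_cst => e e0; exists 0%N => n _; rewrite subrr normr0 ltW.
  by apply/funext => n; exact (derive1_inv (F0 n) (dF n)).
Qed.

(** Boundedness is asked of the derivative of [T] and not of [T], which will be the lift of a
    diffeomorphism. *)
Lemma Ck_unif_cvg_comp k F f (T : R -> R) : Ck k T -> Ck_unif_cvg k.-1 (fun=> derive1 T) (derive1 T) ->
  Ck_unif_cvg k F f -> Ck_unif_cvg k (fun n => F n \o T) (f \o T).
Proof.
elim: k F f => [|k IH] F f kT uT kF.
  case: kF => cF [M M0 hM] _; split => //; last by exists M => // x; exact: hM.
  by move=> e /cF[N HN]; exists N => n /HN Hn x; exact: Hn.
case: kF => cF [M M0 hM] [dF df kF]; have kT1 := CkW kT; have /CkS[dT _] := kT.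
split.
- by move=> e /cF[N HN]; exists N => n /HN Hn x; exact: Hn.
- by exists M => // x; exact: hM.
split.
- by move=> n x; exact: derivable_comp1.
- by move=> x; exact: derivable_comp1.
- rewrite (derive1_comp_fun df dT) (_ : (fun n => _) = fun n => (derive1 (F n) \o T) \* derive1 T).
    apply: Ck_unif_cvgM => //; apply: IH => //.
    by move: uT; case: (k) => [|j] //=; exact: Ck_unif_cvgW.
  by apply/funext => n; exact (derive1_comp_fun (dF n) dT).
Qed.

End UniformConvergence.

Section DistanceConvergence.
Context {R : realType}.

Lemma cderiveSn (f : circle R -> circle R) F i : is_lift F f ->
  cderive f i.+1 = (derive1 F)^`(i).
Proof. by move=> lF; rewrite /cderive derive1Sn -(cderive1E lF). Qed.

Lemma Ck_unif_cvg_derive1n k (F : nat -> R -> R) f (e : R) : Ck_unif_cvg k F f -> 0 < e ->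
  exists N : nat, forall n, (N <= n)%N -> forall i, (i <= k)%N -> forall x,
    `|derive1n i (F n) x - derive1n i f x| <= e.
Proof.
move=> kF e0; suff H j : (j <= k.+1)%N -> exists N : nat, forall n, (N <= n)%N ->
    forall i, (i < j)%N -> forall x, `|derive1n i (F n) x - derive1n i f x| <= e.
  by have [N HN] := H _ (leqnn _); exists N => n Nn i ik x; exact: HN.
elim: j => [|j IH] jk; first by exists 0%N.
have [N HN] := IH (ltnW jk); have [N' HN'] := unif_cvg_derive1n kF (jk : (j <= k)%N) e0.
exists (maxn N N') => n; rewrite geq_max => /andP[Nn N'n] i.
rewrite ltnS leq_eqVlt => /predU1P[-> x|ij x]; first exact: HN'.
exact: HN.
Qed.

Lemma circle_dist_le (x y : R) : circle_dist (to_circle x) (to_circle y) <= `|x - y|.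
Proof.
apply: inf_le_of_mem; last by exists x => //; exists y.
by move=> _ [a _ [b _ <-]].
Qed.

(** The maps agree at [p0], so their lifts differ there by an integer; the mean value theorem over
    at most one turn bounds the C^0 distance by that of the derivatives. *)
Lemma Ck_dist_to0 k (f : Cdiff R k.+1) (fn : nat -> Cdiff R k.+1) (F : R -> R)
    (Fn : nat -> R -> R) (p0 : circle R) :
  is_lift F f -> (forall n, is_lift (Fn n) (fn n)) ->
  (forall x, derivable F x 1) -> (forall n x, derivable (Fn n) x 1) ->
  Ck_unif_cvg k (fun n => derive1 (Fn n)) (derive1 F) -> (forall n, fn n p0 = f p0) ->
  forall e : R, 0 < e -> exists N : nat, forall n, (N <= n)%N -> Ck_dist f (fn n) < e.
Proof.
move=> lF lFn dF dFn kF fp0 e e0.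
(* The distance has k + 2 terms, orders 0 to k + 1; one more in the denominator makes the final
   inequality strict. *)
have d0 : 0 < e / k.+3%:R by rewrite divr_gt0.
have [N HN] := Ck_unif_cvg_derive1n kF d0; exists N => n /HN{HN} Hn.
set d := e / k.+3%:R in d0 Hn.
apply: (@le_lt_trans _ _ (d + \sum_(1 <= i < k.+2) d)); last first.
  rewrite sumr_const_nat subn1 /= -mulrS -mulr_natr /d mulrAC ltr_pdivrMr//.
  by rewrite ltr_pM2l// ltr_nat.
rewrite /Ck_dist; apply: lerD; last first.
  apply: ler_sum_nat => -[//|i] /andP[_ ik]; apply: ge_sup.
    exists `|cderive f i.+1 0 - cderive (fn n) i.+1 0|; exists 0 => //.
    by rewrite /= in_itv/= lexx ler01.
  move=> _ [x _ <-]; rewrite (cderiveSn _ lF) (cderiveSn _ (lFn n)) distrC.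
  exact: Hn.
apply: ge_sup; first by exists (circle_dist (f p0) (fn n p0)); exists p0.
move=> _ [p _ <-].
have [x0 x0p] := to_circle_surj p0; have [y yp] := to_circle_surj p.
pose x := y - (Num.floor (y - x0))%:~R.
have xp : to_circle x = p by rewrite /x to_circleB.
have xx : x0 <= x < x0 + 1.
  by have /andP[] := floor_itv (y - x0); rewrite intrD /x; lra.
have [_ EF] := lF; have [_ EFn] := lFn n.
have /to_circle_int[c Fc] : to_circle (Fn n x0) = to_circle (F x0).
  by rewrite EF EFn x0p fp0.
rewrite -xp -EF -EFn -(to_circleB (Fn n x) c).
apply: le_trans (circle_dist_le _ _) _.
pose D z := F z - Fn n z.
have -> : F x - (Fn n x - c%:~R) = D x - D x0 by rewrite /D Fc; ring.
have dD z : derivable D z 1 by exact: derivableB.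
have [] := @MVT_segment R D (derive1 D) x0 x.
- by have /andP[] := xx.
- by move=> z _; rewrite derive1E; exact/derivableP.
- by apply: continuous_subspaceT; exact: derivable_cont.
move=> z _ ->; have D'z : `|derive1 D z| <= d.
  have -> : derive1 D z = derive1 F z - derive1 (Fn n) z.
    by rewrite derive1E (deriveB (dF z) (dFn n z)) -!derive1E.
  by rewrite distrC; exact: (Hn 0%N).
rewrite normrM -[leRHS]mulr1 ler_pM// ger0_norm ?subr_ge0; last by have /andP[] := xx.
by move: xx; lra.
Qed.

Section moebius_sequence.
Variables (k : nat) (a b e d : nat -> R) (a' b' e' d' : R).
Hypothesis ca : forall eps : R, 0 < eps -> exists N : nat, forall n, (N <= n)%N -> `|a n - a'| <= eps.
Hypothesis cb : forall eps : R, 0 < eps -> exists N : nat, forall n, (N <= n)%N -> `|b n - b'| <= eps.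
Hypothesis ce : forall eps : R, 0 < eps -> exists N : nat, forall n, (N <= n)%N -> `|e n - e'| <= eps.
Hypothesis cd : forall eps : R, 0 < eps -> exists N : nat, forall n, (N <= n)%N -> `|d n - d'| <= eps.
Hypothesis a0 : forall n, 0 < a n.
Hypothesis det1 : forall n, a n * d n - b n * e n = 1.
Hypothesis be : forall n, (b n + e n) ^+ 2 < 4 * (a n * d n).
Hypothesis a'0 : 0 < a'.
Hypothesis det1' : a' * d' - b' * e' = 1.
Hypothesis be' : (b' + e') ^+ 2 < 4 * (a' * d').

Lemma Ck_unif_cvg_mnorm2V : Ck_unif_cvg k (fun n x => (mnorm2 (a n) (b n) (e n) (d n) x)^-1)
  (fun x => (mnorm2 a' b' e' d' x)^-1).
Proof.
have [kc ks] := @Ck_cos2pi_sin2pi R k.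
have uC := Ck_unif_cvg_periodic kc (@cos2piD1 R); have uS := Ck_unif_cvg_periodic ks (@sin2piD1 R).
have u1 : Ck_unif_cvg k (fun n => mv1 (a n) (b n)) (mv1 a' b').
  exact: Ck_unif_cvgD (Ck_unif_cvgM (Ck_unif_cvg_cst k ca) uC) (Ck_unif_cvgM (Ck_unif_cvg_cst k cb) uS).
have u2 : Ck_unif_cvg k (fun n => mv2 (e n) (d n)) (mv2 e' d').
  exact: Ck_unif_cvgD (Ck_unif_cvgM (Ck_unif_cvg_cst k ce) uC) (Ck_unif_cvgM (Ck_unif_cvg_cst k cd) uS).
have u : Ck_unif_cvg k (fun n => mnorm2 (a n) (b n) (e n) (d n)) (mnorm2 a' b' e' d').
  have QE A B C D : mnorm2 A B C D = (mv1 A B \* mv1 A B) \+ (mv2 C D \* mv2 C D) :> (R -> R).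
    by apply/funext => x; rewrite /mnorm2 !expr2.
  rewrite QE (_ : (fun n => mnorm2 _ _ _ _) = fun n =>
    (mv1 (a n) (b n) \* mv1 (a n) (b n)) \+ (mv2 (e n) (d n) \* mv2 (e n) (d n))).
    exact: Ck_unif_cvgD (Ck_unif_cvgM u1 u1) (Ck_unif_cvgM u2 u2).
  by apply/funext => n; exact: QE.
have Q0 x : 0 < mnorm2 a' b' e' d' x by exact: mnorm2_gt0.
have kQ : Ck 0 (mnorm2 a' b' e' d').
  have [kc0 ks0] := @Ck_cos2pi_sin2pi R 0.
  have k1 : Ck 0 (mv1 a' b') by apply: CkD; exact: CkZ.
  have k2 : Ck 0 (mv2 e' d') by apply: CkD; exact: CkZ.
  apply: (@Ck_ext _ _ ((mv1 a' b' \* mv1 a' b') \+ (mv2 e' d' \* mv2 e' d'))).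
    by move=> x; rewrite /= -!expr2.
  by apply: CkD; exact: CkM.
have [M M0 hM] : exists2 M : R, 0 < M & forall x, `|(mnorm2 a' b' e' d' x)^-1| <= M.
  apply: periodic_bounded.
    by apply/Ck0; apply: CkV => // x; rewrite gt_eqF.
  by move=> x; rewrite /mnorm2 /mv1 /mv2 cos2piD1 sin2piD1.
apply: (Ck_unif_cvgV (m := M^-1)) u; first by rewrite invr_gt0.
  move=> x; have := hM x; rewrite ger0_norm ?invr_ge0 ?(ltW (Q0 x))// => h.
  by rewrite -[leRHS]invrK lef_pV2 ?posrE ?invr_gt0.
by move=> n x; rewrite gt_eqF// mnorm2_gt0.
Qed.

(** With the fixed factor on the right, the derivative of a lift of g_n t is (M_n' o T) T', where
    M_n' = 1 / |A_n v|^2 converges with all the derivatives concerned. The base point becomes t^-1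
    p0. *)
Lemma moebius_conv (t g : Cdiff R k.+1) (gn : nat -> Cdiff R k.+1) (p0 : circle R) :
  is_lift (mlift a' b' e' d') g -> (forall n, is_lift (mlift (a n) (b n) (e n) (d n)) (gn n)) ->
  (forall n, gn n p0 = g p0) ->
  forall eps : R, 0 < eps -> exists N : nat, forall n, (N <= n)%N ->
    Ck_dist (g * t)%g (gn n * t)%g < eps.
Proof.
move=> lg lgn gp0.
have [T [lT iT kT]] := dmap_Ck t; have /CkS[dT kT'] := kT.
have dM x : derivable (mlift a' b' e' d') x 1.
  by have [] := is_derive_mlift a'0 det1' be' x.
have dMn n x : derivable (mlift (a n) (b n) (e n) (d n)) x 1.
  by have [] := is_derive_mlift (a0 n) (det1 n) (be n) x.
have M'E : derive1 (mlift a' b' e' d') = fun x => (mnorm2 a' b' e' d' x)^-1.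
  apply/funext => x; rewrite derive1E.
  by have [_ ->] := is_derive_mlift a'0 det1' be' x.
have Mn'E n : derive1 (mlift (a n) (b n) (e n) (d n)) =
    fun x => (mnorm2 (a n) (b n) (e n) (d n) x)^-1.
  apply/funext => x; rewrite derive1E.
  by have [_ ->] := is_derive_mlift (a0 n) (det1 n) (be n) x.
have T'1 x : derive1 T (x + 1) = derive1 T x by exact: (lift_derive1_periodic 1 x lT).
have uT : Ck_unif_cvg k (fun=> derive1 T) (derive1 T) by exact: Ck_unif_cvg_periodic.
have uT' : Ck_unif_cvg k.-1 (fun=> derive1 T) (derive1 T).
  by move: uT; case: (k) => [|j] //; exact: Ck_unif_cvgW.
apply: (@Ck_dist_to0 k _ _ (mlift a' b' e' d' \o T)
  (fun n => mlift (a n) (b n) (e n) (d n) \o T) ((t^-1)%g p0)).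
- exact: is_lift_comp.
- by move=> n; exact: is_lift_comp.
- by move=> x; exact: derivable_comp1.
- by move=> n x; exact: derivable_comp1.
- rewrite (derive1_comp_fun dM dT) (_ : (fun n => _) =
    fun n => (derive1 (mlift (a n) (b n) (e n) (d n)) \o T) \* derive1 T); last first.
    by apply/funext => n; exact (derive1_comp_fun (dMn n) dT).
  apply: Ck_unif_cvgM uT; apply: (Ck_unif_cvg_comp _ uT'); first exact: CkW.
  rewrite M'E (_ : (fun n => _) = fun n x => (mnorm2 (a n) (b n) (e n) (d n) x)^-1).
    exact: Ck_unif_cvg_mnorm2V.
  exact/funext.
- move=> n; change (gn n (t ((t^-1)%g p0)) = g (t ((t^-1)%g p0))).
  by rewrite cdiffVK gp0.
Qed.

End moebius_sequence.

End DistanceConvergence.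

(** * The distorted elements are neither closed nor open *)

Section LimitsOfTorsion.
Context {R : realType}.

Lemma inv_nat_small (e : R) : 0 < e -> exists N : nat, forall n, (N <= n)%N -> n.+1%:R^-1 < e.
Proof.
move=> e0; exists (Num.bound e^-1) => n Nn; rewrite invf_plt ?posrE//.
apply: (@lt_le_trans _ _ (Num.bound e^-1)%:R); last by rewrite ler_nat leqW.
by rewrite archi_boundP// invr_ge0 ltW.
Qed.

Lemma cos_small_angle (e : R) : 0 < e -> exists N : nat, forall n, (N <= n)%N ->
  `|2 - 2 * cos (pi / n.+1%:R)| <= e.
Proof.
move=> e0; have e20 : 0 < e / 2 by exact: divr_gt0.
have /cvgrPdist_lt/(_ _ e20) := @continuous_cos R 0.
rewrite cos0 => -[d /= d0 Hd].
have [N HN] := inv_nat_small (divr_gt0 d0 (pi_gt0 R)); exists N => n /HN nd.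
have pn : `|0 - pi / n.+1%:R| < d.
  by rewrite sub0r normrN ger0_norm ?divr_ge0 ?pi_ge0// mulrC -ltr_pdivlMr// pi_gt0.
have := Hd _ pn; rewrite (_ : 2 - 2 * _ = 2 * (1 - cos (pi / n.+1%:R))); last by ring.
by move=> h; rewrite normrM ger0_norm// mulrC -ler_pdivlMr// ltW.
Qed.

Lemma logvar_twist_limit k : exists (f : Cdiff R k.+2) (fn : nat -> Cdiff R k.+2),
  [/\ forall n, torsion (fn n),
      forall e : R, 0 < e -> exists n, Ck_dist f (fn n) < e &
      forall m, m%:R <= logvar (forget (f ^+ m)%g) 1%g].
Proof.
(* Discarding the first angles gives s <= 1/2, whence (1 - s)^2 < 4 (1 - s), the condition for
   [mlift] at g_s. The successors in [al] keep the angle below pi. *)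
have [N0 HN0] := @cos_small_angle (2^-1) ltac:(by rewrite invr_gt0).
pose al n : R := pi / (n + N0).+2%:R.
pose s n : R := 2 - 2 * cos (al n).
have pi0 := pi_gt0 R.
have s_small n : s n <= 2^-1.
  have := HN0 (n + N0).+1 ltac:(by rewrite leqW// leq_addl).
  by apply: le_trans; exact: ler_norm.
have s_ge0 n : 0 <= s n by rewrite subr_ge0 ger_pMr// cos_le1.
have al_pos n : 0 < al n by rewrite divr_gt0.
have al_lt n : al n < pi.
  by rewrite /al ltr_pdivrMr// ltr_pMr// ltr1n.
have sal n : 0 < sin (al n) by apply: sin_gt0_pi; rewrite al_pos al_lt.
have [h hP] := @half_rotation R k.+1.
have [t [t_out t_ray t_D]] := @bump_diffeo R k.+1.
have det0 : (1 : R) * 1 - (- 1) * 0 = 1 by ring.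
have be0 : (-1 + 0 : R) ^+ 2 < 4 * (1 * 1) by rewrite addr0 sqrrN !expr1n; lra.
have [g lg _] := mlift_diffeo ltr01 det0 be0 k.+1.
have gP := mlift_acts_by ltr01 det0 be0 lg.
have detn n : (1 : R) * (1 - s n) - (- 1) * s n = 1 by ring.
have ben n : (-1 + s n) ^+ 2 < 4 * (1 * (1 - s n)).
  by have := s_small n; have := s_ge0 n; nra.
have /choice[gn lgn] : forall n, exists g' : Cdiff R k.+2,
    is_lift (mlift 1 (- 1) (s n) (1 - s n)) g'.
  by move=> n; have [g' ? _] := mlift_diffeo ltr01 (detn n) (ben n) k.+1; exists g'.
have gnP n := mlift_acts_by ltr01 (detn n) (ben n) (lgn n).
pose L1 : R := ln (cD t (upper_pt 2^-1)).
have L10 : 0 < L1.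
  apply: ln_gt0; apply: t_D; first by rewrite ccos_upper_pt mulr_gt0 ?invr_gt0// cos_atan_gt0.
  by rewrite ccos_upper_pt csin_upper_pt mulrA mulfV// mul1r.
(* Chosen so that N L1 - 2 ln 3 >= 1: the variation then grows at rate at least 1. *)
pose N := Num.bound ((2 * ln 3 + 1) / L1).
have NL : 2 * ln 3 + 1 <= N%:R * L1.
  rewrite -ler_pdivrMr//; apply: ltW; apply: archi_boundP.
  apply: divr_ge0; last exact: ltW.
  by apply: addr_ge0 => //; apply: mulr_ge0 => //; apply: ln_ge0; rewrite ler1n.
pose tN : Cdiff R k.+2 := (t ^+ N)%g.
have tN_out p : ~ (0 < ccos p < csin p) -> tN p = p /\ cD tN p = 1.
  move=> /t_out[tp Dp]; have [-> ->] := cDX_fixed N tp.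
  by rewrite Dp expr1n.
have tN_ray p : csin p = 2 * ccos p -> tN p = p.
  by move=> /t_ray tp; have [] := cDX_fixed N tp.
pose w : Cdiff R k.+2 := (tN^-1 * (h * tN * h))%g.
exists (g * w)%g, (fun n => gn n * w)%g; split.
- move=> n; rewrite /w mulgA.
  apply: (@elliptic_twist_torsion _ _ (al n) (s n) (n + N0).+2) => //.
  + by rewrite /al mulrC divfK.
  + by move=> p; have [] := hP p.
  + by move=> p; have [] := hP p.
  + by move=> p /tN_out[].
- have cvs (e : R) : 0 < e -> exists M : nat, forall n, (M <= n)%N -> `|s n| <= e.
    move=> /cos_small_angle[M HM]; exists M => n Mn.
    by apply: (HM (n + N0).+1); rewrite leqW// (leq_trans Mn)// leq_addr.
  have cvc (c e : R) : 0 < e -> exists M : nat, forall n, (M <= n)%N -> `|c - c| <= e.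
    by move=> e0; exists 0%N => n _; rewrite subrr normr0 ltW.
  (* Every g_s sends (1, 1) to (0, 1), whatever s. *)
  have base n : gn n (upper_pt 1) = g (upper_pt 1).
    have [[r [r0 c1 c2]] _] := gP (upper_pt 1); have [[r' [r'0 c1' c2']] _] := gnP n (upper_pt 1).
    apply: (circle_eq_ray r'0 r0 c1' c2'); first exact: c1.
    by rewrite c2 ccos_upper_pt csin_upper_pt; ring.
  move=> e e0.
  have [||M HM] := @moebius_conv R k.+1 (fun=> 1) (fun=> - 1) s (fun n => 1 - s n) 1 (- 1) 0 1
    (cvc 1) (cvc (- 1)) _ _ (fun=> ltr01) detn ben ltr01 det0 be0 w g gn (upper_pt 1) lg lgn base e e0.
  + by move=> e' /cvs[M HM]; exists M => n /HM; rewrite subr0.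
  + by move=> e' /cvs[M HM]; exists M => n /HM; rewrite addrAC subrr add0r normrN.
  by exists M; exact: HM.
- move=> m; rewrite /w mulgA.
  apply: le_trans (twist_growth gP hP tN_out tN_ray m).
  have [_ tNp] := cDX_fixed N (t_ray (upper_pt 2^-1)
    ltac:(by rewrite ccos_upper_pt csin_upper_pt mulrA mulfV// mul1r)).
  rewrite -/tN in tNp; rewrite tNp lnXn ?cD_pos// -/L1.
  rewrite -[leLHS]mul1r; apply: ler_wpM2r; first exact: ler0n.
  by rewrite lerBrDl -[L1 *+ N]mulr_natl.
Qed.

Lemma not_closed_Ck k (S : set (Cdiff R k)) f : ~ S f ->
  (forall e : R, 0 < e -> exists2 f', S f' & Ck_dist f f' < e) -> ~ closed S.
Proof.
move=> nSf lim; rewrite -openC => /open_CkE/(_ f nSf)[e /lim[f' Sf' ff'] H].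
exact: H ff' Sf'.
Qed.

Lemma not_closed_AC (S : set (ACdiff R)) f : ~ S f ->
  (forall e : R, 0 < e -> exists2 f', S f' & AC_dist f f' < e) -> ~ closed S.
Proof.
move=> nSf lim; rewrite -openC => /open_ACE/(_ f nSf)[e /lim[f' Sf' ff'] H].
exact: H ff' Sf'.
Qed.

Lemma forget_torsion k (f : Cdiff R k.+2) : torsion f -> torsion (forget f).
Proof. by move=> [n n0 fn]; exists n; rewrite // -forgetX fn forget1g. Qed.

Lemma AC_undistorted (f : ACdiff R) (c C : R) : 0 < c ->
  (forall m : nat, c * m%:R - C <= logvar (f ^+ m)%g 1%g) -> ~ AC_distorted R f.
Proof.
move=> c0 growth; have [nd nt] := linear_growth_undistorted logvar_ri_cont c0 growth.
by case.
Qed.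

Lemma Ck_undistorted k (f : Cdiff R k.+2) (c C : R) : 0 < c ->
  (forall m : nat, c * m%:R - C <= logvar (forget (f ^+ m)%g) 1%g) -> ~ Ck_distorted R k.+2 f.
Proof.
move=> c0 growth.
have growth' m : c * m%:R - C <=
    logvar (forget (f ^+ m)%g) (forget (1 : Cdiff R k.+2)%g).
  by rewrite forget1g.
have [nd nt] := linear_growth_undistorted
  (ri_cont_pseudometric_pullback (@forgetM R k) (@forget_continuous R k) logvar_ri_cont) c0 growth'.
by case.
Qed.

End LimitsOfTorsion.

Section Hyperbolic.
Context {R : realType}.

(** Stated in C^2, so that [moebius_conv] gives the convergence and [forget_dist] brings it to
    Diff^{1+AC}. *)
Lemma hyperbolic_near_identity (e : R) : 0 < e -> exists2 f : Cdiff R 2,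
  Ck_dist 1%g f < e & exists2 c : R, 0 < c & forall m, c * m%:R <= logvar (forget (f ^+ m)%g) 1%g.
Proof.
move=> e0; pose l n : R := 1 + n.+1%:R^-1.
have l1 n : 1 < l n by rewrite ltrDl invr_gt0.
have l0 n : 0 < l n by exact: lt_trans ltr01 (l1 n).
have det0 : (1 : R) * 1 - 0 * 0 = 1 by ring.
have be0 : (0 + 0 : R) ^+ 2 < 4 * (1 * 1) by rewrite addr0 expr0n /=; lra.
(* The identity is presented as the action of the identity matrix, to be the limit in
   [moebius_conv]. *)
have [g lg _] := mlift_diffeo ltr01 det0 be0 1.
have gP := mlift_acts_by ltr01 det0 be0 lg.
have g1 : g = 1%g.
  apply: cdiff_eq => p; have [[r [r0 c1 c2]] _] := gP p.
  apply: (circle_eq_ray r0 ltr01 c1 c2); first by rewrite /=; ring.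
  by rewrite /=; ring.
have detn n : l n * (l n)^-1 - 0 * 0 = 1 by rewrite mulfV ?gt_eqF// mul0r subr0.
have ben n : (0 + 0 : R) ^+ 2 < 4 * (l n * (l n)^-1).
  by rewrite mulfV ?gt_eqF// addr0 expr0n /=; lra.
have /choice[gn lgn] : forall n, exists g' : Cdiff R 2, is_lift (mlift (l n) 0 0 (l n)^-1) g'.
  by move=> n; have [g' ? _] := mlift_diffeo (l0 n) (detn n) (ben n) 1; exists g'.
have gnP n := mlift_acts_by (l0 n) (detn n) (ben n) (lgn n).
have cvl (eps : R) : 0 < eps -> exists M : nat, forall n, (M <= n)%N -> `|l n - 1| <= eps.
  move=> /inv_nat_small[M HM]; exists M => n /HM h.
  by rewrite /l addrC addKr ger0_norm ?invr_ge0// ltW.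
have cvlV (eps : R) : 0 < eps -> exists M : nat, forall n, (M <= n)%N -> `|(l n)^-1 - 1| <= eps.
  move=> /cvl[M HM]; exists M => n /HM; apply: le_trans.
  have -> : (l n)^-1 - 1 = (1 - l n) * (l n)^-1 by field; rewrite gt_eqF.
  rewrite normrM distrC ler_piMr// ger0_norm ?invr_ge0 ?ltW//.
  by rewrite invf_lt1.
have cv0 (eps : R) : 0 < eps -> exists M : nat, forall n, (M <= n)%N -> `|0 - 0 : R| <= eps.
  by move=> eps0; exists 0%N => n _; rewrite subrr normr0 ltW.
have fixS n p : csin p = 0 -> 0 < ccos p -> gn n p = p.
  move=> s0 cp; have [[r [r0 c1 c2]] _] := gnP n p.
  apply: (circle_eq_ray r0 (l0 n) c1 c2); first by rewrite s0; ring.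
  by rewrite s0; ring.
have fixC n p : ccos p = 0 -> 0 < csin p -> gn n p = p.
  move=> c0 sp; have [[r [r0 c1 c2]] _] := gnP n p.
  have lV0 : 0 < (l n)^-1 by rewrite invr_gt0.
  apply: (circle_eq_ray r0 lV0 c1 c2); first by rewrite c0; ring.
  by rewrite c0; ring.
pose p0 : circle R := to_circle 0; pose q0 : circle R := upper_pt 0.
have p0E : ccos p0 = 1 /\ csin p0 = 0.
  by rewrite /p0 ccos_to csin_to /cos2pi /sin2pi mulr0 cos0 sin0.
have q0E : ccos q0 = 0 /\ csin q0 = 1.
  by rewrite /q0 ccos_upper_pt csin_upper_pt atan0 cos0 mul0r.
have fp n : gn n p0 = p0 by apply: fixS; rewrite ?p0E.1 ?p0E.2.
have fq n : gn n q0 = q0 by apply: fixC; rewrite ?q0E.1 ?q0E.2.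
have base n : gn n p0 = g p0 by rewrite fp g1.
have [M HM] := @moebius_conv R 1 l (fun=> 0) (fun=> 0) (fun n => (l n)^-1) 1 0 0 1
    cvl cv0 cv0 cvlV l0 detn ben ltr01 det0 be0 1%g g gn p0 lg lgn base e e0.
exists (gn M); first by have := HM M (leqnn M); rewrite !mulg1 g1.
set G := gn M; set lam := l M.
have lam1 : 1 < lam := l1 M.
have lam0 : 0 < lam := l0 M.
have lnlam : 0 < ln lam by exact: ln_gt0.
exists (4 * ln lam); first by rewrite mulr_gt0.
move=> m; have [B _ vB] := logD_sub_var_le (forget (G ^+ m)%g) 1%g.
(* One interval suffices, from the fixed ray of (1, 0), where the derivative is l^-2, to that of (0,
   1), where it is l^2. *)
have c : pair_chain 1 (fun=> 0 : R) (fun=> upper_ptR 0).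
  have /andP[a b] := upper_ptR_bounds (0 : R).
  by case=> // _; split=> //; [exact: ltW|rewrite add0r; exact: ltW].
apply: le_trans (le_circle_var vB c); rewrite /chain_sum big_ord1 -/p0 -/(upper_pt 0) -/q0.
have lD p : logD (forget (G ^+ m)%g) p - logD 1%g p = ln (cD (G ^+ m)%g p).
  rewrite /logD (_ : cD (1%g : ACdiff R) p = 1) ?ln1 ?subr0//; exact: cD_id.
rewrite (lD q0) (lD p0).
have [_ ->] := cDX_fixed m (fq M); have [_ ->] := cDX_fixed m (fp M).
rewrite !lnXn ?cD_pos//.
have Dp : ln (cD G p0) = - 2 * ln lam.
  have [_ ->] := gnP M p0; rewrite p0E.1 p0E.2 !mulr0 !mulr1 !addr0.
  rewrite -/lam [0 ^+ 2]expr0n /= ?addr0 ?add0r.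
  by rewrite lnV ?posrE ?exprn_gt0// lnXn// -[ln lam *+ 2]mulr_natl mulNr.
have Dq : ln (cD G q0) = 2 * ln lam.
  have [_ ->] := gnP M q0; rewrite q0E.1 q0E.2 !mulr0 !mulr1 !add0r.
  rewrite -/lam [0 ^+ 2]expr0n /= ?addr0 ?add0r.
  by rewrite exprVn invrK lnXn// -[ln lam *+ 2]mulr_natl.
rewrite -/G -/p0 -/q0 Dp Dq -mulrnBl (_ : 2 * ln lam - -2 * ln lam = 4 * ln lam); last by ring.
by rewrite -[(4 * ln lam) *+ m]mulr_natr ler_norm.
Qed.

End Hyperbolic.

Theorem corollary1p5 (R : realType) :
  (forall k : nat, (2 <= k)%N -> ~ closed (Ck_distorted R k)) /\
  ~ closed (AC_distorted R) /\
  ~ open (AC_distorted R).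
Proof.
split; [|split].
- case=> [|[|k]]// _; have [f [fn [tor lim growth]]] := @logvar_twist_limit R k.
  apply: (@not_closed_Ck R k.+2 _ f).
    by apply: (@Ck_undistorted R k f 1 0) => // m; rewrite mul1r subr0.
  by move=> e /lim[n fe]; exists (fn n) => //; right.
(* The C^2 example serves again: the inclusion in Diff^{1+AC} does not increase distances and
   preserves torsion. *)
- have [f [fn [tor lim growth]]] := @logvar_twist_limit R 0.
  apply: (@not_closed_AC R _ (forget f)).
    apply: (@AC_undistorted R (forget f) 1 0 ltr01) => m.
    by rewrite mul1r subr0 -forgetX; exact: growth.
  move=> e /lim[n fe]; exists (forget (fn n)); first by right; exact: forget_torsion.
  exact: le_lt_trans (forget_dist f (fn n)) fe.
- move=> /open_ACE oD.
  have D1 : AC_distorted R 1%g by right; exists 1%N.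
  have [e /hyperbolic_near_identity[f fe [c c0 growth]] H] := oD _ D1.
  apply: (@AC_undistorted R (forget f) c 0 c0) => [m|].
    by rewrite subr0 -forgetX; exact: growth.
  apply: H; rewrite -(forget1g 0); exact: le_lt_trans (forget_dist _ _) fe.
Qed.
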